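(* Let $\mu,\chi>0$ and $\gamma,\kappa\ge 0$. There exists a constant $C$ depending only on the material coefficients $\mu,\chi,\gamma,\kappa$ such that, for all initial data $(u_0,w_0)\in L^2_\sigma(\mathbb{R}^3)\times L^2(\mathbb{R}^3)$, the solution $(u_L,w_L)$ of the linear micropolar system with initial data $(u_0,w_0)$ satisfies, for all $t\ge 1$, $$\Big\|u_L(t)-e^{\mu t\Delta}u_0-\tfrac12\operatorname{curl} e^{\mu t\Delta}w_0\Big\|_{L^2}\le \frac{C}{t}\|u_0\|_{L^2}+\frac{C}{t^{3/2}}\|\mathbb{P}w_0\|_{L^2}$$ and $$\Big\|w_L(t)-\tfrac12\operatorname{curl} e^{\mu t\Delta}u_0+\tfrac14\Delta e^{\mu t\Delta}\mathbb{P}w_0\Big\|_{L^2}\le \frac{C}{t^{3/2}}\|u_0\|_{L^2}+\frac{C}{t^{2}}\|w_0\|_{L^2}.$$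
   Context: $L^2_\sigma(\mathbb{R}^3)$ is the space of vector fields $\mathbb{R}^3\to\mathbb{R}^3$ in $L^2$ that are divergence free in the sense of distributions; $L^2(\mathbb{R}^3)$ for $w_0$ means $\mathbb{R}^3$-valued $L^2$ fields. $\mathbb{P}$ is the $L^2$-orthogonal projector onto divergence-free vector fields. $e^{\mu t\Delta}$ is the heat semigroup. The linear micropolar system on $\mathbb{R}^3$, $t>0$, is $$\partial_t u_L=(\mu+\chi)\Delta u_L+2\chi\operatorname{curl} w_L,\quad \partial_t w_L=\gamma\Delta w_L+\kappa\nabla(\operatorname{div} w_L)+2\chi\operatorname{curl}u_L-4\chi w_L,\quad \operatorname{div}u_L=0,$$ with $(u_L,w_L)|_{t=0}=(u_0,w_0)$; its solution is the unique $L^2$ solution obtained by solving, for a.e. frequency $\xi$, the corresponding linear ODE system for the spatial Fourier transforms. *)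

(* Defs.v *)
From HB Require Import structures.
From mathcomp Require Import all_boot all_order all_algebra.
From mathcomp Require Import all_classical all_reals all_analysis.
From mathcomp Require Import complex.
Set Implicit Arguments.
Unset Strict Implicit.
Unset Printing Implicit Defensive.
Import Order.TTheory GRing.Theory Num.Theory.
Import numFieldNormedType.Exports.
Local Open Scope classical_set_scope.
Local Open Scope ring_scope.
Local Open Scope complex_scope.

Section VectorAlgebra.
Context {K : comNzRingType}.
Implicit Types u v : 'rV[K]_3.

Definition dot u v : K := \sum_i u 0 i * v 0 i.

(* Indices are added modulo 3, by the ring structure of 'I_3. *)
Definition cross u v : 'rV[K]_3 :=
  \row_i (u 0 (i + 1) * v 0 (i + 2) - u 0 (i + 2) * v 0 (i + 1)).

End VectorAlgebra.

(* R^3 as a domain is the triple product: it carries the product topology, the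
   product sigma-algebra and the product Lebesgue measure. Vector values are
   row vectors. *)
Notation space3 R := (R * R * R)%type.
Notation field3 R := (space3 R -> 'rV[R]_3).
Notation leb3 R :=
  ((@lebesgue_measure R \x @lebesgue_measure R) \x @lebesgue_measure R)%E.

Section Calculus.
Context {R : realType}.
Implicit Types (x y : space3 R) (f g : space3 R -> R) (u v w : field3 R).

Definition coords x : 'rV[R]_3 := \row_i [:: x.1.1; x.1.2; x.2]`_i.

Definition basis3 (i : 'I_3) : space3 R :=
  ((i == 0)%:R, (i == 1)%:R, (i == 2)%:R).

Definition partial (i : 'I_3) f : space3 R -> R := fun x => 'D_(basis3 i) f x.

Definition curl u : field3 R := fun x =>
  \row_i (partial (i + 1) (fun y => u y 0 (i + 2)) x
        - partial (i + 2) (fun y => u y 0 (i + 1)) x).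

Definition laplacian u : field3 R := fun x =>
  \row_j \sum_i partial i (partial i (fun y => u y 0 j)) x.

(* Partial derivatives of all orders exist and are continuous. *)
Definition smooth f : Prop := forall s : seq 'I_3,
  continuous (foldr partial f s) /\
  forall i x, derivable (foldr partial f s) x (basis3 i).

Definition test_function f : Prop :=
  smooth f /\ compact (closure [set x | f x != 0]).

Definition L2_field u : Prop :=
  forall i, (fun x => u x 0 i) \in Lfun (leb3 R) 2%:E.

Definition L2norm u : \bar R :=
  Lnorm (leb3 R) 2%:E (fun x => (Num.sqrt (dot (u x) (u x)))%:E).

Definition L2inner u v : R := (\int[leb3 R]_x dot (u x) (v x))%R.

Definition weakly_div_free u : Prop := forall f, test_function f ->
  (\int[leb3 R]_x (\sum_i u x 0 i * partial i f x))%R = 0.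

Definition L2sigma u : Prop := L2_field u /\ weakly_div_free u.

(* v is (a representative of) the orthogonal projection of u on L2sigma *)
Definition is_leray_proj u v : Prop :=
  L2sigma v /\ forall w, L2sigma w -> L2inner (u - v) w = 0.

(* The heat semigroup e^{s Delta}, s > 0, by convolution with the Gaussian
   kernel (4 pi s)^{-3/2} exp (- |x|^2 / (4 s)). *)
Definition heat_kernel (s : R) x : R :=
  Num.sqrt (4 * pi * s) ^- 3 * expR (- dot (coords x) (coords x) / (4 * s)).

Definition heat (s : R) u : field3 R := fun x =>
  \row_i (\int[leb3 R]_y (heat_kernel s (x - y) * u y 0 i))%R.

End Calculus.

Section Fourier.
Context {R : realType}.
Implicit Types (f : space3 R -> R) (F : space3 R -> R[i]).

(* int f(x) exp (- i xi.x) dx, for integrable f *)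
Definition fourier1 f : space3 R -> R[i] := fun xi =>
  (\int[leb3 R]_x (f x * cos (dot (coords xi) (coords x))))%R -i*
  (\int[leb3 R]_x (f x * sin (dot (coords xi) (coords x))))%R.

(* F is (a representative of) the Plancherel transform of f: the graph of the
   L^2 transform is the closure in L^2 of the graph of fourier1 on the
   intersection of L^1 and L^2. *)
Definition is_fourier2 f F : Prop :=
  [/\ f \in Lfun (leb3 R) 2%:E,
      (fun xi => complex.Re (F xi)) \in Lfun (leb3 R) 2%:E,
      (fun xi => complex.Im (F xi)) \in Lfun (leb3 R) 2%:E &
      exists g : nat -> space3 R -> R,
      [/\ forall n, g n \in Lfun (leb3 R) 1%:E /\ g n \in Lfun (leb3 R) 2%:E,
          Lnorm (leb3 R) 2%:E (fun x => (g n x - f x)%:E)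
            @[n --> \oo] --> 0%E &
          Lnorm (leb3 R) 2%:E
              (fun xi => (ComplexField.Normc.normc (fourier1 (g n) xi - F xi))%:E)
            @[n --> \oo] --> 0%E]].

Definition is_fourier_field (u : field3 R) (U : space3 R -> 'rV[R[i]]_3) : Prop :=
  forall j, is_fourier2 (fun x => u x 0 j) (fun xi => U xi 0 j).

End Fourier.

Section Micropolar.
Context {R : realType}.
Implicit Types (U W : R -> 'rV[R[i]]_3).

(* Derivative of a function of a real variable with values in C^3. *)
Definition has_cderiv U (t : R) (d : 'rV[R[i]]_3) : Prop := forall j,
  is_derive t 1 (fun s => complex.Re (U s 0 j)) (complex.Re (d 0 j)) /\
  is_derive t 1 (fun s => complex.Im (U s 0 j)) (complex.Im (d 0 j)).

Definition right_continuous0 U : Prop := forall j,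
  (complex.Re (U s 0 j) @[s --> 0^'+] --> complex.Re (U 0 0 j)) /\
  (complex.Im (U s 0 j) @[s --> 0^'+] --> complex.Im (U 0 0 j)).

(* i xi, the Fourier symbol of the gradient *)
Definition grad_symbol (xi : space3 R) : 'rV[R[i]]_3 :=
  \row_j (0 +i* coords xi 0 j).

(* The linear micropolar system at frequency xi, on t > 0. *)
Definition micropolar_ode (mu chi gamma kappa : R) (xi : space3 R) U W : Prop :=
  let D := grad_symbol xi in
  forall t : R, 0 < t ->
  [/\ has_cderiv U t
        (((mu + chi)%:C * dot D D) *: U t + (2 * chi)%:C *: cross D (W t)),
      has_cderiv W t
        ((gamma%:C * dot D D) *: W t + (kappa%:C * dot D (W t)) *: D
         + (2 * chi)%:C *: cross D (U t) - (4 * chi)%:C *: W t) &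
      dot D (U t) = 0].

(* The values at t <= 0 of u and w are irrelevant; the initial data enter
   through their transforms U 0 and W 0. *)
Definition micropolar_solution (mu chi gamma kappa : R) (u0 w0 : field3 R)
    (u w : R -> field3 R) : Prop :=
  exists U W : R -> space3 R -> 'rV[R[i]]_3,
  [/\ is_fourier_field u0 (U 0), is_fourier_field w0 (W 0),
      forall t, 0 < t -> is_fourier_field (u t) (U t) /\
                         is_fourier_field (w t) (W t) &
      {ae leb3 R, forall xi,
        [/\ right_continuous0 (U ^~ xi), right_continuous0 (W ^~ xi) &
            micropolar_ode mu chi gamma kappa xi (U ^~ xi) (W ^~ xi)]}].

End Micropolar.

(* Main.v *)
(** At a frequency [xi] with [rho = |xi|^2], write [D] for the gradient symbol. Applying [D x] to the equation
of the microrotation [W] closes the system for [(U, D x W)]: it is a 2x2 system with a slow eigenvalue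
[- mu rho + O(rho^2)] and a fast one below [- 4 chi], while [D . W] decays exponentially by itself. The slow
eigenvector is [(1, k)] with [k = 1/2 + O(rho)]; replacing [k] by [1/2] and the slow exponential by the heat
semigroup [exp (- mu rho t)] gives the two profiles of the theorem, with errors [O(rho^2 t)] and [O(rho)] times
[exp (- a rho t)], that is, a gain of one power of [t] over the profiles. High frequencies decay exponentially.

The transfer to physical space does not use Plancherel's equality, only two inequalities with lossy constants:
[f] is compared with an absolutely convergent inverse transform by duality ([inversion]), and the transform is
bounded by [4 (2 pi)^3] times the norm ([ft_bound]). The Leray projection is only known through its variational
definition; testing it against Gaussian-damped solenoidal fields and against gradients shows that its heat flow
is the inverse transform of the projected symbol ([leray_heat]). *)

From HB Require Import structures.
From mathcomp Require Import all_boot all_order all_algebra.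
From mathcomp Require Import all_classical all_reals all_analysis measurable_realfun.
From mathcomp Require Import complex ring lra.
Require Import Defs.
Set Implicit Arguments.
Unset Strict Implicit.
Unset Printing Implicit Defensive.
Import Order.TTheory GRing.Theory Num.Theory.
Import numFieldNormedType.Exports.
Local Open Scope classical_set_scope.
Local Open Scope ring_scope.

(** * Real-valued integrals and square integrability *)

(** The transform is given only as the [L2] closure of a graph, so neither isometry nor inversion is
    at hand. Every identity is first proved by Fubini for absolutely convergent integrals and then
    carried to the limit; a damping [gs e] with [e] tending to 0 makes the integrals converge, and
    Fatou's lemma removes it. Two lossy inequalities suffice because both profiles are heat flows:
    their symbols carry a Gaussian, so they and their derivatives are convergent integrals at every
    point. The losses cost only a factor 4 in the energies, since the [c3^-1] of [inversion] cancels
    the [c3] of [ft_bound].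

    The rates are a matter of counting [rho]. Each curl multiplies the squared size of a symbol by
    [rho], which [exp (- a rho t)] converts into [1 / t]; this is the half power of [t] between the
    two data. Moreover [|D x W|^2] is [rho] times the square of the projected symbol, which is why
    only the projected datum enters the velocity estimate. Since [D] is [i] times a real vector, the
    complex system is two copies of one real system, and the ODE analysis is entirely real. *)

Lemma cvg_le_const (R : realType) (u : nat -> R) l M :
  u n @[n --> \oo] --> l -> (forall n, u n <= M) -> l <= M.
Proof.
move=> ul uM; move/cvg_lim : (ul) => <- //; apply: limr_le; last exact: nearW.
by apply/cvg_ex; exists l.
Qed.

Lemma cvg_ge_const (R : realType) (u : nat -> R) l M :
  u n @[n --> \oo] --> l -> (forall n, M <= u n) -> M <= l.
Proof.
move=> ul uM; move/cvg_lim : (ul) => <- //; apply: limr_ge; last exact: nearW.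
by apply/cvg_ex; exists l.
Qed.

Lemma cvg_eventually (R : realType) (u v : nat -> R) N (l : R) :
  (forall n, (N <= n)%N -> u n = v n) -> v n @[n --> \oo] --> l -> u n @[n --> \oo] --> l.
Proof.
move=> uv vl; apply: cvg_trans vl; apply: near_eq_cvg.
by exists N => // n /= Nn; rewrite uv.
Qed.

Section Toolkit.
Context {d : measure_display} {T : measurableType d} {R : realType}.
Variable mu : {measure set T -> \bar R}.
Implicit Types f g h : T -> R.

Definition L1 f := mu.-integrable setT (EFin \o f).
(** The extended integral cut down by [fine], hence 0 when it is not finite; this is why linearity
    and monotonicity carry [L1] premises. *)
Definition Int f : R := (\int[mu]_x f x)%R.
Definition L2 f := measurable_fun setT f /\ L1 (fun x => f x ^+ 2).

Lemma L1_meas f : L1 f -> measurable_fun setT f.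
Proof. by move=> /integrableP[/measurable_EFinP]. Qed.

Lemma L1_le f g : measurable_fun setT f -> L1 g -> (forall x, `|f x| <= g x) -> L1 f.
Proof.
move=> mf Lg fg; apply: (le_integrable _ _ _ Lg) => //.
  exact/measurable_EFinP.
by move=> x _ /=; rewrite lee_fin (le_trans (fg x))// ler_norm.
Qed.

Lemma L1_ext f g : f =1 g -> L1 f -> L1 g.
Proof. by move=> /funext ->. Qed.

Lemma L1D f g : L1 f -> L1 g -> L1 (fun x => f x + g x).
Proof. by move=> Lf Lg; exact: (integrableD _ Lf Lg). Qed.

Lemma L1N f : L1 f -> L1 (fun x => - f x).
Proof. by move=> Lf; exact: (integrableN Lf). Qed.

Lemma L1B f g : L1 f -> L1 g -> L1 (fun x => f x - g x).
Proof. by move=> Lf Lg; exact: (integrableB _ Lf Lg). Qed.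

Lemma L1Z c f : L1 f -> L1 (fun x => c * f x).
Proof. by move=> Lf; exact: (integrableZl _ _ Lf). Qed.

Lemma L1_norm f : L1 f -> L1 (fun x => `|f x|).
Proof. by move=> Lf; exact: (integrable_norm Lf). Qed.

Lemma L1_0 : L1 (fun=> 0).
Proof. exact: integrable0. Qed.

Lemma L1_sum (I : Type) (s : seq I) (F : I -> T -> R) :
  (forall i, L1 (F i)) -> L1 (fun x => \sum_(i <- s) F i x).
Proof.
move=> LF; elim: s => [|i s IH].
  by apply: L1_ext L1_0 => x; rewrite big_nil.
by apply: L1_ext (L1D (LF i) IH) => x; rewrite big_cons.
Qed.

Lemma L1_bM c f g : measurable_fun setT f -> (forall x, `|f x| <= c) -> L1 g ->
  L1 (fun x => f x * g x).
Proof.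
move=> mf fc Lg; apply: (L1_le _ (L1Z c (L1_norm Lg))).
  by apply: measurable_funM => //; exact: L1_meas.
by move=> x; rewrite normrM ler_wpM2r.
Qed.

Lemma Int_ext f g : f =1 g -> Int f = Int g.
Proof. by move=> /funext ->. Qed.

Lemma IntD f g : L1 f -> L1 g -> Int (fun x => f x + g x) = Int f + Int g.
Proof. by move=> Lf Lg; exact: (RintegralD _ Lf Lg). Qed.

Lemma IntB f g : L1 f -> L1 g -> Int (fun x => f x - g x) = Int f - Int g.
Proof. by move=> Lf Lg; exact: (RintegralB _ Lf Lg). Qed.

Lemma IntZ c f : L1 f -> Int (fun x => c * f x) = c * Int f.
Proof. by move=> Lf; exact: (RintegralZl _ _ Lf). Qed.

Lemma Int_0 : Int (fun=> 0) = 0.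
Proof. by rewrite /Int /Rintegral integral0. Qed.

Lemma IntN f : L1 f -> Int (fun x => - f x) = - Int f.
Proof.
move=> Lf; rewrite -[RHS]mulN1r -IntZ//.
by apply: Int_ext => x; rewrite mulN1r.
Qed.

Lemma Int_sum (I : Type) (s : seq I) (F : I -> T -> R) :
  (forall i, L1 (F i)) ->
  Int (fun x => \sum_(i <- s) F i x) = \sum_(i <- s) Int (F i).
Proof.
move=> LF; elim: s => [|i s IH].
  by rewrite big_nil -[RHS]Int_0; apply: Int_ext => x; rewrite big_nil.
rewrite big_cons -IH -IntD//; last exact: L1_sum.
by apply: Int_ext => x; rewrite big_cons.
Qed.

Lemma Int_ge0 f : (forall x, 0 <= f x) -> 0 <= Int f.
Proof. by move=> f0; apply: Rintegral_ge0. Qed.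

Lemma Int_le f g : L1 f -> L1 g -> (forall x, f x <= g x) -> Int f <= Int g.
Proof. by move=> Lf Lg fg; exact: (le_Rintegral _ Lf Lg). Qed.

Lemma Int_norm f : L1 f -> `|Int f| <= Int (fun x => `|f x|).
Proof. by move=> Lf; exact: (le_normr_Rintegral _ Lf). Qed.

Lemma Int_EFin f : L1 f -> (\int[mu]_x (f x)%:E)%E = (Int f)%:E.
Proof. by move=> Lf; rewrite /Int /Rintegral fineK//; exact: integrable_fin_num. Qed.

(** Replacing [f] by the minimum of [f] and [g] changes it on a null set only, which leaves the
    integral unchanged and reduces the claim to a pointwise comparison. *)
Lemma Int_ae_le f g : L1 f -> L1 g -> {ae mu, forall x, f x <= g x} ->
  Int f <= Int g.
Proof.
move=> Lf Lg fg.
have -> : Int f = Int (fun x => Num.min (f x) (g x)).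
  congr fine; apply: ae_eq_integral => //.
  - by apply/measurable_EFinP; exact: L1_meas.
  - apply/measurable_EFinP; apply: measurable_minr; exact: L1_meas.
  - by apply: filterS fg => x fg _; rewrite min_l.
apply: Int_le => // [|x]; last by rewrite ge_min lexx orbT.
apply: (@L1_le _ (fun x => `|f x| + `|g x|)).
- by apply: measurable_minr; exact: L1_meas.
- by apply: L1D; exact: L1_norm.
- move=> x; rewrite /Num.min; case: ifP => _; first by rewrite lerDl.
  by rewrite lerDr.
Qed.

Lemma Int_dom (F : nat -> T -> R) f g : (forall n, measurable_fun setT (F n)) ->
  L1 g -> (forall n x, `|F n x| <= g x) -> (forall x, F n x @[n --> \oo] --> f x) ->
  L1 f /\ Int (F n) @[n --> \oo] --> Int f.
Proof.
move=> mF Lg Fg Ff.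
have mf : measurable_fun setT f.
  by apply: (measurable_fun_cvg (h:=F)).
have fg x : `|f x| <= g x.
  apply: (@cvg_le_const _ (fun n => `|F n x|)) => //.
  by apply: cvg_norm; exact: Ff.
have Lf : L1 f by apply: L1_le Lg fg.
split => //.
have := @dominated_cvg _ _ _ mu setT measurableT (fun n => EFin \o F n) (EFin \o f)
  (EFin \o g).
move=> /(_ _ _ _ Lg) H.
apply: fine_cvg; rewrite fineK; last exact: integrable_fin_num.
apply: H => //.
- by move=> n; exact/measurable_EFinP.
- by move=> x _; apply: cvg_EFin; [exact: nearW|exact: Ff].
- by move=> n x _ /=; rewrite lee_fin.
Qed.

(** The tool for removing a Gaussian damping: a bound uniform in the damping yields at once the
    integrability of the undamped function and the same bound. *)
Lemma Int_fatou (F : nat -> T -> R) f M : (forall n, L1 (F n)) ->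
  (forall n x, 0 <= F n x) -> (forall x, F n x @[n --> \oo] --> f x) ->
  (forall n, Int (F n) <= M) -> L1 f /\ Int f <= M.
Proof.
move=> LF F0 Ff IM.
have mf : measurable_fun setT f.
  by apply: (measurable_fun_cvg (h:=F)) => // n; exact: L1_meas.
have f0 x : 0 <= f x by apply: (cvg_ge_const (Ff x)).
have H : (\int[mu]_x (f x)%:E <= M%:E)%E.
  have -> : (\int[mu]_x (f x)%:E = \int[mu]_x limn_einf (fun n => (F n x)%:E))%E.
    apply: eq_integral => x _.
    have /cvg_limn_einf_sup[-> //] : (F n x)%:E @[n --> \oo] --> (f x)%:E.
    by apply: cvg_EFin; [exact: nearW|exact: Ff].
  apply: (le_trans (fatou _ _ _ _)) => //.
  - by move=> n; apply/measurable_EFinP; exact: L1_meas.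
  - by move=> n x _; rewrite lee_fin.
  - rewrite limn_einf_lim; apply: lime_le; first exact: is_cvg_einfs.
    apply: nearW => n; apply: ge_ereal_inf.
    exists (\int[mu]_x (F n x)%:E)%E; last by rewrite Int_EFin// lee_fin.
    by exists n => //=.
have Lf : L1 f.
  apply/integrableP; split; first exact/measurable_EFinP.
  apply: le_lt_trans (ltry M); apply: le_trans H.
  rewrite le_eqVlt; apply/orP; left; apply/eqP; apply: eq_integral => x _ /=.
  by rewrite ger0_norm.
by split=> //; rewrite -lee_fin -Int_EFin.
Qed.

Lemma L2_ext f g : f =1 g -> L2 f -> L2 g.
Proof. by move=> /funext ->. Qed.

Lemma L2_mul f g : L2 f -> L2 g -> L1 (fun x => f x * g x).
Proof.
move=> [mf Lf] [mg Lg]; apply: (L1_le _ (L1D Lf Lg)).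
  exact: measurable_funM.
move=> x; rewrite normrM -(normr_id (f x)) -(normr_id (g x)) -[f x ^+ 2]real_normK ?num_real//.
rewrite -[g x ^+ 2]real_normK ?num_real// !normr_id.
set a := `|f x|; set b := `|g x|; have := sqr_ge0 (a - b).
have : 0 <= a * b by rewrite mulr_ge0 /a/b//.
nra.
Qed.

Lemma L2_le f g : measurable_fun setT f -> L2 g -> (forall x, `|f x| <= `|g x|) -> L2 f.
Proof.
move=> mf [_ Lg] fg; split=> //; apply: L1_le Lg _.
  exact: measurable_funX.
by move=> x; rewrite normrX -[X in _ <= X]real_normK ?num_real// lerXn2r ?nnegrE.
Qed.

Lemma L2Z c f : L2 f -> L2 (fun x => c * f x).
Proof.
move=> [mf Lf]; split; first exact: measurable_funM.
by apply: L1_ext (L1Z (c ^+ 2) Lf) => x; rewrite exprMn.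
Qed.

Lemma L2D f g : L2 f -> L2 g -> L2 (fun x => f x + g x).
Proof.
move=> Lf Lg; split; first by apply: measurable_funD; [case: Lf|case: Lg].
apply: (L1_ext _ (L1D (L1D Lf.2 Lg.2) (L1Z 2 (L2_mul Lf Lg)))) => x /=; ring.
Qed.

Lemma L2N f : L2 f -> L2 (fun x => - f x).
Proof. by move=> /(L2Z (-1)); apply: L2_ext => x; rewrite mulN1r. Qed.

Lemma L2B f g : L2 f -> L2 g -> L2 (fun x => f x - g x).
Proof. by move=> Lf /L2N; exact: L2D. Qed.

Lemma L2_0 : L2 (fun=> 0).
Proof. by split=> //; apply: L1_ext L1_0 => x; rewrite expr0n. Qed.

Lemma L2_sum (I : Type) (s : seq I) (F : I -> T -> R) :
  (forall i, L2 (F i)) -> L2 (fun x => \sum_(i <- s) F i x).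
Proof.
move=> LF; elim: s => [|i s IH].
  by apply: L2_ext L2_0 => x; rewrite big_nil.
by apply: L2_ext (L2D (LF i) IH) => x; rewrite big_cons.
Qed.

Lemma L2_bM c f g : measurable_fun setT f -> (forall x, `|f x| <= c) -> L2 g ->
  L2 (fun x => f x * g x).
Proof.
move=> mf fc Lg; apply: (L2_le _ (L2Z c Lg)).
  by apply: measurable_funM => //; case: Lg.
by move=> x; rewrite !normrM ler_wpM2r// (le_trans (fc x))// ler_norm.
Qed.

(** The integral of [(s f + t g)^2] is a nonnegative quadratic form in [s] and [t]; its value at
    [s = - b], [t = a] is [a] times the claimed difference. *)
Lemma cauchy_schwarz f g : L2 f -> L2 g ->
  Int (fun x => f x * g x) ^+ 2 <= Int (fun x => f x ^+ 2) * Int (fun x => g x ^+ 2).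
Proof.
move=> Lf Lg; set a := Int (fun x => f x ^+ 2); set b := Int _; set c := Int (fun x => g x ^+ 2).
have a0 : 0 <= a by apply: Int_ge0 => x; exact: sqr_ge0.
have c0 : 0 <= c by apply: Int_ge0 => x; exact: sqr_ge0.
have H s t : 0 <= s ^+ 2 * a + 2 * s * t * b + t ^+ 2 * c.
  have -> : s ^+ 2 * a + 2 * s * t * b + t ^+ 2 * c =
      Int (fun x => (s * f x + t * g x) ^+ 2).
    have LA := L1Z (s ^+ 2) Lf.2; have LB := L1Z (2 * s * t) (L2_mul Lf Lg).
    have LC := L1Z (t ^+ 2) Lg.2.
    rewrite -(IntZ _ Lf.2) -(IntZ _ (L2_mul Lf Lg)) -(IntZ _ Lg.2).
    rewrite -(IntD LA LB) -(IntD (L1D LA LB) LC).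
    by apply: Int_ext => x; ring.
  by apply: Int_ge0 => x; exact: sqr_ge0.
have [a_gt0|] := ltP 0 a.
  have := H (- b) a; have -> : (- b) ^+ 2 * a + 2 * - b * a * b + a ^+ 2 * c = a * (a * c - b ^+ 2) by ring.
  by rewrite pmulr_rge0// subr_ge0.
move=> a_le0; have a00 : a = 0 by apply/eqP; rewrite eq_le a_le0.
rewrite a00 mul0r.
have [->|b0] := eqVneq b 0; first by rewrite expr0n.
(* With [a = 0] the form is affine in [s]; this choice of [s] gives it the value [-1], so [b] has to
   vanish. *)
have := H (- (c + 1) / (2 * b)) 1; rewrite a00.
have -> : (- (c + 1) / (2 * b)) ^+ 2 * 0 + 2 * (- (c + 1) / (2 * b)) * 1 * b + 1 ^+ 2 * c = -1.
  by field.
lra.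
Qed.

End Toolkit.

(** * Fubini for real-valued integrals *)

Section FubiniReal.
Context d1 d2 (T1 : measurableType d1) (T2 : measurableType d2) (R : realType).
Variables (m1 : {sigma_finite_measure set T1 -> \bar R})
          (m2 : {sigma_finite_measure set T2 -> \bar R}).
Local Notation m12 := (m1 \x m2)%E.

Lemma L1_tensor (f : T1 -> R) (g : T2 -> R) : L1 m1 f -> L1 m2 g ->
  L1 m12 (fun z => f z.1 * g z.2).
Proof.
move=> Lf Lg; apply/integrable12ltyP.
  apply/measurable_EFinP; apply: measurable_funM.
    by apply: measurableT_comp; [exact: L1_meas Lf|exact: measurable_fst].
  by apply: measurableT_comp; [exact: L1_meas Lg|exact: measurable_snd].
under eq_integral => x _.
  under eq_integral => y _ do rewrite /= normrM.
  rewrite (Int_EFin (L1Z _ (L1_norm Lg))) (IntZ _ (L1_norm Lg)) mulrC.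
  over.
by rewrite (Int_EFin (L1Z _ (L1_norm Lf))) ltry.
Qed.

(** The inner integral is finite for almost every [x] only; elsewhere [Int] takes the default value
    0, so the iterated integrals are compared through equality almost everywhere. *)
Lemma fub_ae1 (F : T1 * T2 -> R) : L1 m12 F ->
  (\int[m1]_x (Int m2 (fun y => F (x, y)))%:E = \int[m12]_z (F z)%:E)%E.
Proof.
move=> LF; rewrite -(integral12_prod_meas1 LF).
have IF := integrable_fubini_F LF.
have mI : measurable_fun setT (fubini_F m2 (EFin \o F)) by case/integrableP: IF.
apply: ae_eq_integral => //.
  by apply/measurable_EFinP; exact: (measurableT_comp (@fine_measurable R _ measurableT) mI).
by apply: filterS (integrable_ae measurableT IF) => x /(_ I) H _; rewrite fineK.
Qed.

Lemma fub_ae2 (F : T1 * T2 -> R) : L1 m12 F ->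
  (\int[m2]_y (Int m1 (fun x => F (x, y)))%:E = \int[m12]_z (F z)%:E)%E.
Proof.
move=> LF; rewrite -(integral21_prod_meas1 LF).
have mI : measurable_fun setT (fubini_G m1 (EFin \o F)) by exact (measurable_fubini_G LF).
apply: ae_eq_integral => //.
  by apply/measurable_EFinP; exact: (measurableT_comp (@fine_measurable R _ measurableT) mI).
apply: filterS (ae_integrable2 LF) => y H _; rewrite fineK//.
exact: integrable_fin_num H.
Qed.

Lemma Int_fub1 (F : T1 * T2 -> R) : L1 m12 F ->
  Int m1 (fun x => Int m2 (fun y => F (x, y))) = Int m12 F.
Proof. by move=> LF; rewrite {1 3}/Int /Rintegral fub_ae1. Qed.

Lemma Int_fub2 (F : T1 * T2 -> R) : L1 m12 F ->
  Int m2 (fun y => Int m1 (fun x => F (x, y))) = Int m12 F.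
Proof. by move=> LF; rewrite {1 3}/Int /Rintegral fub_ae2. Qed.

Lemma Int_tensor (f : T1 -> R) (g : T2 -> R) : L1 m1 f -> L1 m2 g ->
  Int m12 (fun z => f z.1 * g z.2) = Int m1 f * Int m2 g.
Proof.
move=> Lf Lg; rewrite -(Int_fub1 (L1_tensor Lf Lg)) /= mulrC -(IntZ _ Lf).
by apply: Int_ext => x; rewrite (IntZ _ Lg) mulrC.
Qed.

(** Tonelli's theorem gives measurability for nonnegative integrands. Adding [|a|] makes the
    integrand nonnegative because [|k| <= 1], and the constant thus added is subtracted again. *)
Lemma measurable_Int_param (a : T2 -> R) (k : T1 * T2 -> R) : L1 m2 a ->
  measurable_fun setT k -> (forall z, `|k z| <= 1) ->
  measurable_fun setT (fun x => Int m2 (fun y => a y * k (x, y))).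
Proof.
move=> La mk k1.
have mkx x : measurable_fun setT (fun y => k (x, y)).
  by apply: measurableT_comp => //; exact: pair1_measurable.
have Lak x : L1 m2 (fun y => a y * k (x, y)).
  by apply: L1_ext (L1_bM (mkx x) (fun y => k1 (x, y)) La) => y; rewrite mulrC.
have -> : (fun x => Int m2 (fun y => a y * k (x, y))) =
    (fun x => Int m2 (fun y => `|a y| + a y * k (x, y)) - Int m2 (fun y => `|a y|)).
  by apply/funext => x; rewrite (IntD (L1_norm La) (Lak x)) addrAC subrr add0r.
apply: measurable_funB => //; apply: measurableT_comp; first exact: fine_measurable.
apply: (@measurable_fun_fubini_tonelli_F _ _ _ _ _ m2
   (fun z : T1 * T2 => (`|a z.2| + a z.2 * k z)%:E)).
  apply/measurable_EFinP.
  have ma : measurable_fun setT (fun z : T1 * T2 => a z.2).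
    by apply: measurableT_comp; [exact: L1_meas La|exact: measurable_snd].
  by apply: measurable_funD; [exact: measurableT_comp|exact: measurable_funM].
move=> [x y] /=; rewrite lee_fin.
have : `|a y * k (x, y)| <= `|a y| by rewrite normrM ler_piMr.
by rewrite ler_norml => /andP[H _]; rewrite addrC -lerBlDr sub0r.
Qed.

Lemma Int_param_le (a : T2 -> R) (k : T1 * T2 -> R) x : L1 m2 a ->
  measurable_fun setT k -> (forall z, `|k z| <= 1) ->
  `|Int m2 (fun y => a y * k (x, y))| <= Int m2 (fun y => `|a y|).
Proof.
move=> La mk k1.
have mkx : measurable_fun setT (fun y => k (x, y)).
  by apply: measurableT_comp => //; exact: pair1_measurable.
have Lak : L1 m2 (fun y => a y * k (x, y)).
  by apply: L1_ext (L1_bM mkx (fun y => k1 (x, y)) La) => y; rewrite mulrC.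
apply: (le_trans (Int_norm Lak)); apply: Int_le; [exact: L1_norm|exact: L1_norm|].
by move=> y; rewrite normrM ler_piMr.
Qed.

(** Transposition of an integral operator with bounded kernel. For the cosine and sine of a scalar
    product it is the source of the Parseval identities below. *)
Lemma Int_sym (a : T2 -> R) (g : T1 -> R) (k : T1 * T2 -> R) : L1 m2 a -> L1 m1 g ->
  measurable_fun setT k -> (forall z, `|k z| <= 1) ->
  Int m1 (fun x => g x * Int m2 (fun y => a y * k (x, y))) =
  Int m2 (fun y => a y * Int m1 (fun x => g x * k (x, y))).
Proof.
move=> La Lg mk k1.
have LF : L1 m12 (fun z => k z * (g z.1 * a z.2)).
  exact: (L1_bM mk k1 (L1_tensor Lg La)).
have E1 := Int_fub1 LF; have E2 := Int_fub2 LF; rewrite /= in E1 E2.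
transitivity (Int m12 (fun z => k z * (g z.1 * a z.2))).
  rewrite -E1; apply: Int_ext => x.
  rewrite -IntZ; first by apply: Int_ext => y; ring.
  apply: L1_ext (L1_bM _ (fun y => k1 (x, y)) La) => [y|]; first by rewrite mulrC.
  by apply: measurableT_comp => //; exact: pair1_measurable.
rewrite -E2; apply: Int_ext => y.
rewrite -IntZ; first by apply: Int_ext => x; ring.
apply: L1_ext (L1_bM _ (fun x => k1 (x, y)) Lg) => [x|]; first by rewrite mulrC.
by apply: measurableT_comp => //; exact: pair2_measurable.
Qed.

End FubiniReal.

(** * Sigma-finiteness of product measures *)

Section ProdSigmaFinite.
Context d1 d2 (T1 : measurableType d1) (T2 : measurableType d2) (R : realType).
Variables (m1 : {sigma_finite_measure set T1 -> \bar R})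
          (m2 : {sigma_finite_measure set T2 -> \bar R}).

Lemma prod_sigma_finite : sigma_finite setT (m1 \x m2)%E.
Proof.
have /sigma_finiteP[F [TF ndF Foo]] := sigma_finiteT m1.
have /sigma_finiteP[G [TG ndG Goo]] := sigma_finiteT m2.
exists (fun n => F n `*` G n).
  rewrite -setXTT TF TG predeqE => -[x y]; split.
    move=> [/= [n _ Fnx] [k _ Gky]]; exists (maxn n k) => //; split.
    - by move: x Fnx; exact/subsetPset/ndF/leq_maxl.
    - by move: y Gky; exact/subsetPset/ndG/leq_maxr.
  by move=> [n _ []/= ? ?]; split; exists n.
move=> k; have [? ?] := Foo k; have [? ?] := Goo k.
split; first exact: measurableX.
by rewrite product_measure1E// lte_mul_pinfty// ge0_fin_numE.
Qed.

(* The library's canonical sigma-finite structure on product measures is only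
   inferred for subprobabilities. *)
Definition prodsf : {sigma_finite_measure set (T1 * T2)%type -> \bar R} :=
  HB.pack (m1 \x m2)%E (Measure_isSigmaFinite.Build _ _ _ (m1 \x m2)%E prod_sigma_finite).

End ProdSigmaFinite.

(** * Calculus on the line and Gaussian integrals *)

Section PointwiseDerive.
Context {R : realType} {V : normedModType R}.
Implicit Types (f g : V -> R) (x v : V).

(** Restriction to a line turns a directional derivative into an ordinary one at 0, so that
    one-variable rules and differentiation under the integral apply on space. *)
Lemma is_derive_lineP f x v d :
  is_derive x v f d <-> is_derive (0 : R) (1 : R) (fun t : R => f (t *: v + x)) d.
Proof.
have E : (fun h : R => h^-1 *: ((f \o shift x) (h *: v) - f x)) =
   (fun h : R => h^-1 *: (((fun t : R => f (t *: v + x)) \o shift (0:R)) (h *: (1 : R)) - f (0 *: v + x))).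
  apply/funext => h /=; rewrite addr0 scale0r add0r.
  by congr (_ *: (f (_ *: _ + _) - _)); rewrite /GRing.scale /= mulr1.
split => -[D E1]; split.
- by move: D; rewrite /derivable E.
- by rewrite -E1 /derive E.
- by rewrite /derivable E.
- by rewrite -E1 /derive E.
Qed.

Lemma is_derive_mul f g x v df dg : is_derive x v f df -> is_derive x v g dg ->
  is_derive x v (fun y => f y * g y) (df * g x + f x * dg).
Proof.
move=> Df Dg; have := is_deriveM Df Dg; rewrite /GRing.scale /= => H.
by apply: (is_derive_eq H); rewrite addrC [g x * df]mulrC.
Qed.

Lemma is_derive_add f g x v df dg : is_derive x v f df -> is_derive x v g dg ->
  is_derive x v (fun y => f y + g y) (df + dg).
Proof. by move=> Df Dg; exact: (is_deriveD Df Dg). Qed.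

Lemma is_derive_opp f x v df : is_derive x v f df ->
  is_derive x v (fun y => - f y) (- df).
Proof. by move=> Df; exact: (is_deriveN Df). Qed.

Lemma is_derive_sub f g x v df dg : is_derive x v f df -> is_derive x v g dg ->
  is_derive x v (fun y => f y - g y) (df - dg).
Proof. by move=> Df Dg; exact: (is_deriveB Df Dg). Qed.

Lemma is_derive_const c x v : is_derive x v (fun=> c : R) 0.
Proof. exact: is_derive_cst. Qed.

Lemma is_derive_scale c f x v df : is_derive x v f df ->
  is_derive x v (fun y => c * f y) (c * df).
Proof.
by move=> Df; apply: (is_derive_eq (is_derive_mul (is_derive_const c x v) Df)); rewrite mul0r add0r.
Qed.

Lemma is_derive_chain (h : R -> R) f x v a b : is_derive (f x) (1 : R) h a ->
  is_derive x v f b -> is_derive x v (fun y => h (f y)) (a * b).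
Proof.
move=> Dh /is_derive_lineP Df; apply/is_derive_lineP.
apply: (@is_derive1_comp _ h (fun t : R => f (t *: v + x))) => //.
by rewrite scale0r add0r.
Qed.

Lemma is_derive_E f x v d : is_derive x v f d -> 'D_v f x = d.
Proof. by move=> H; rewrite derive_val. Qed.

End PointwiseDerive.

Section RealLine.
Context {R : realType}.
Local Notation leb := (@lebesgue_measure R).

Lemma is_derive_exp (f : R -> R) x df : is_derive x (1 : R) f df ->
  is_derive x (1 : R) (fun y => expR (f y)) (expR (f x) * df).
Proof. by apply: is_derive_chain; exact: is_derive_expR. Qed.

Lemma is_derive_sinM (a x : R) : is_derive x (1 : R) (fun y => sin (a * y)) (a * cos (a * x)).
Proof.
have H := is_derive_scale a (is_derive_id x (1 : R)).
by apply: (is_derive_eq (is_derive_chain (is_derive_sin _) H)); rewrite mulr1 mulrC.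
Qed.

Lemma is_derive_cosM (a x : R) : is_derive x (1 : R) (fun y => cos (a * y)) (- (a * sin (a * x))).
Proof.
have H := is_derive_scale a (is_derive_id x (1 : R)).
by apply: (is_derive_eq (is_derive_chain (is_derive_cos _) H)); rewrite mulr1 mulrC mulrN.
Qed.

Lemma is_derive_gauss (s x : R) :
  is_derive x (1 : R) (fun t => expR (- (s * t ^+ 2))) (- (2 * s * x) * expR (- (s * x ^+ 2))).
Proof.
have H := is_derive_opp (is_derive_scale s (is_derive_mul (is_derive_id x (1 : R)) (is_derive_id x (1 : R)))).
apply: (is_derive_eq (is_derive_exp H)) => /=; ring.
Qed.

Lemma is_derive_continuous (f f' : R -> R) : (forall x, is_derive x (1 : R) f (f' x)) -> continuous f.
Proof.
by move=> H x; apply: differentiable_continuous; apply/derivable1_diffP; case: (H x).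
Qed.

Lemma continuous_measurable (f : R -> R) : continuous f -> measurable_fun setT f.
Proof. by move=> cf; exact: continuous_measurable_fun. Qed.

(** The integrals over [[-n, n]] have two limits: [Int f] by dominated convergence, and 0 by the
    fundamental theorem of calculus and the decay of [F]. *)
Lemma Int_derive0 (F f : R -> R) : (forall x, is_derive x (1 : R) F (f x)) ->
  continuous f -> L1 leb f ->
  F n%:R @[n --> \oo] --> (0 : R) -> F (- n%:R) @[n --> \oo] --> (0 : R) -> Int leb f = 0.
Proof.
move=> DF cf Lf Fp Fm.
have cF := is_derive_continuous DF.
pose J (n : nat) : set R := [set` `[- n%:R, n%:R]].
have mJ n : measurable (J n) by exact: measurable_itv.
have IJ n : (0 < n)%N -> Int leb (fun x => f x * \1_(J n) x) = F n%:R - F (- n%:R).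
  move=> n0.
  have nn : - n%:R < n%:R :> R by rewrite -subr_gt0 opprK addr_gt0 // ltr0n.
  have -> : Int leb (fun x => f x * \1_(J n) x) = fine (\int[leb]_(x in J n) (f x)%:E)%E.
    rewrite integral_mkcond /Int /Rintegral; congr fine; apply: eq_integral => x _.
    by rewrite patchE indicE; case: (x \in J n); rewrite ?mulr1 ?mulr0.
  rewrite (continuous_FTC2 (F := F) nn) //.
  - by apply: continuous_subspaceT.
  - split=> [x _|| ]; first by case: (DF x).
      by apply: cvg_at_right_filter; exact: cF.
    by apply: cvg_at_left_filter; exact: cF.
  - by move=> x _; rewrite derive1E; exact: is_derive_E.
have [_ H] : L1 leb f /\ Int leb (fun x => f x * \1_(J n) x) @[n --> \oo] --> Int leb f.
  apply: (@Int_dom _ _ _ leb (fun n x => f x * \1_(J n) x) f (fun x => `|f x|)).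
  - move=> n; apply: measurable_funM; first exact: continuous_measurable.
    exact (measurable_indic (mJ n)).
  - exact: L1_norm.
  - by move=> n x; rewrite normrM ler_piMr// indicE; case: (_ \in _); rewrite ?normr1 ?normr0.
  - move=> x; have [N xN] : exists N : nat, `|x| <= N%:R.
      by exists (Num.truncn `|x|).+1; apply/ltW; rewrite truncnS_gt.
    apply: (@cvg_eventually _ _ (fun=> f x) N); last exact: cvg_cst.
    move=> n Nn; rewrite indicE mem_set ?mulr1// /J /= in_itv/= -ler_norml.
    by rewrite (le_trans xN)// ler_nat.
have H2 : Int leb (fun x => f x * \1_(J n) x) @[n --> \oo] --> (0 : R).
  rewrite -(subr0 (0 : R)); apply: (cvg_eventually (N := 1) IJ); exact: (cvgB Fp Fm).
exact: (cvg_unique _ H H2).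
Qed.

(** From [x ^+ n <= 1 + x ^+ n.+1]: the exponential dominates 1, and its Taylor term of order [n.+1]
    dominates the power. The two constants add up to the witness. *)
Lemma exp_dominates (n : nat) (a : R) : 0 < a ->
  exists C, 0 < C /\ forall x, 0 <= x -> x ^+ n * expR (- (a * x)) <= C.
Proof.
move=> a0; exists (1 + (n.+1)`!%:R / a ^+ n.+1); split.
  by rewrite addr_gt0// divr_gt0// ?exprn_gt0// ltr0n fact_gt0.
move=> x x0; rewrite expRN ler_pdivrMr ?expR_gt0//.
have ax : 0 <= a * x by rewrite mulr_ge0// ltW.
have := expR_ge1Dxn n ax; have := expR_ge1Dx (a * x) => H1 H.
have fn : (0 : R) < (n.+1)`!%:R by rewrite ltr0n fact_gt0.
have xn : x ^+ n <= 1 + x ^+ n.+1.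
  have [x1|/ltW x1] := leP x 1; first by rewrite (le_trans (exprn_ile1 _ x0 x1))// lerDl exprn_ge0.
  by rewrite (le_trans (ler_weXn2l x1 (leqnSn n)))// lerDr.
apply: (le_trans xn); rewrite mulrDl mul1r lerD//; first by rewrite (le_trans _ H1)// lerDl.
have H2 : (a * x) ^+ n.+1 <= (n.+1)`!%:R * expR (a * x).
  rewrite [leRHS]mulrC -(ler_pdivrMr _ _ fn).
  by move: H; set u := _ / _; lra.
rewrite mulrAC ler_pdivlMr ?exprn_gt0//; apply: le_trans H2.
by rewrite exprMn mulrC.
Qed.

Lemma gauss_ge0 (s t : R) : 0 <= expR (- (s * t ^+ 2)).
Proof. exact: expR_ge0. Qed.

(** Up to the factor [sqrt (pi / s)] the integrand is the normal density of mean [m] and variance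
    [1 / (2 s)]. *)
Lemma gauss_shift_Int (s m : R) : 0 < s ->
  L1 leb (fun t => expR (- (s * (t - m) ^+ 2))) /\
  Int leb (fun t => expR (- (s * (t - m) ^+ 2))) = Num.sqrt (pi / s).
Proof.
move=> s0; pose sg : R := (Num.sqrt (2 * s))^-1.
have s20 : 0 < 2 * s by rewrite mulr_gt0.
have sg2 : sg ^+ 2 = (2 * s)^-1 by rewrite exprVn sqr_sqrtr// ltW.
have sg0 : sg != 0 by rewrite invr_eq0 gt_eqF// sqrtr_gt0.
have pk : normal_peak sg = (Num.sqrt (pi / s))^-1.
  rewrite /normal_peak sg2; congr (Num.sqrt _)^-1.
  by move: (pi : R) => p; field; rewrite gt_eqF.
have pk0 : Num.sqrt (pi / s) != 0 :> R by rewrite gt_eqF// sqrtr_gt0 divr_gt0// pi_gt0.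
have E : (fun t : R => expR (- (s * (t - m) ^+ 2))) = (fun t => Num.sqrt (pi / s) * normal_pdf m sg t).
  apply/funext => t; rewrite normal_pdfE// pk [RHS]mulrA mulfV// mul1r /normal_fun sg2.
  by congr expR; field; rewrite gt_eqF.
have L : L1 leb (normal_pdf m sg) by exact: integrable_normal_pdf.
rewrite E; split; first exact: L1Z.
by rewrite IntZ// /Int /Rintegral integral_normal_pdf mulr1.
Qed.

Lemma gauss_Int (s : R) : 0 < s ->
  L1 leb (fun t => expR (- (s * t ^+ 2))) /\
  Int leb (fun t => expR (- (s * t ^+ 2))) = Num.sqrt (pi / s).
Proof. by move=> /(gauss_shift_Int 0); under eq_fun do rewrite subr0. Qed.

Lemma continuous_gauss (s : R) : continuous (fun t : R => expR (- (s * t ^+ 2))).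
Proof. exact: is_derive_continuous (is_derive_gauss s). Qed.

(** One half of the Gaussian absorbs the power; the other half is the integrable majorant. *)
Lemma L1_gaussX (s : R) (n : nat) : 0 < s -> L1 leb (fun t => t ^+ n * expR (- (s * t ^+ 2))).
Proof.
move=> s0; have s20 : 0 < s / 2 by rewrite divr_gt0.
have [C [C0 HC]] := exp_dominates n s20.
apply: (L1_le _ (L1Z (1 + C) (gauss_Int s20).1)).
  by apply: measurable_funM; [exact: measurable_funX|apply: continuous_measurable; exact: continuous_gauss].
move=> t; rewrite normrM (ger0_norm (gauss_ge0 _ _)) normrX.
have -> : expR (- (s * t ^+ 2)) = expR (- (s / 2 * t ^+ 2)) * expR (- (s / 2 * t ^+ 2)).
  by rewrite -expRD; congr expR; field.
rewrite mulrA ler_wpM2r ?gauss_ge0//.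
have := HC _ (sqr_ge0 t); set E := expR _ => H.
have E0 : 0 <= E by exact: expR_ge0.
have E1 : E <= 1.
  by rewrite -expR0 ler_expR oppr_le0 mulr_ge0 ?sqr_ge0// ltW.
have xn : `|t| ^+ n <= 1 + (t ^+ 2) ^+ n.
  rewrite -(real_normK (num_real t)) -exprM mulnC exprM.
  set y := `|t| ^+ n; have := sqr_ge0 (y - 1); have : 0 <= y by rewrite exprn_ge0.
  nra.
apply: (le_trans (ler_wpM2r E0 xn)); rewrite mulrDl mul1r.
by apply: lerD => //.
Qed.

(** The sign [e] serves both ends of the line: [1] and [-1] give the two boundary limits that
    [Int_derive0] asks for. *)
Lemma gauss_n_cvg0 (s : R) (h : R -> R) (e : R) : 0 < s -> (forall t, `|h t| <= 1) -> `|e| = 1 ->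
  expR (- (s * (e * n%:R) ^+ 2)) * h (e * n%:R) @[n --> \oo] --> (0 : R).
Proof.
move=> s0 h1 e1; apply/cvgr0Pnorm_le => eps eps0.
near=> n.
have n1 : 1 <= n%:R :> R by rewrite ler1n; near: n; exact: nbhs_infty_gt.
rewrite normrM (ger0_norm (expR_ge0 _)); apply: (le_trans (ler_piMr (expR_ge0 _) (h1 _))).
have -> : (e * n%:R) ^+ 2 = n%:R ^+ 2.
  by rewrite exprMn -(real_normK (num_real e)) e1 expr1n mul1r.
rewrite expRN -[eps]invrK lef_pV2 ?posrE ?expR_gt0 ?invr_gt0//.
apply: (le_trans _ (expR_ge1Dx _)).
have nn : s * n%:R <= s * n%:R ^+ 2 by rewrite ler_wpM2l ?(ltW s0)// expr2 ler_peMl.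
have : eps^-1 / s <= n%:R by near: n; exact: nbhs_infty_ger.
rewrite ler_pdivrMr// mulrC => H; rewrite (le_trans H)// (le_trans nn)// lerDr//.
Unshelve. all: by end_near. Qed.

End RealLine.

Section DerInt.
Context {d : measure_display} {T : measurableType d} {R : realType}.
Variable mu : {measure set T -> \bar R}.

Lemma is_derive_Int (f f' : R -> T -> R) (G : T -> R) :
  (forall x y, is_derive x (1 : R) (f^~ y) (f' x y)) -> (forall x, L1 mu (f x)) ->
  L1 mu G -> (forall x y, `|f' x y| <= G y) ->
  forall x, is_derive x (1 : R) (fun x => Int mu (f x)) (Int mu (f' x)).
Proof.
move=> Df Lf LG fG x.
have G0 y : 0 <= G y by apply: le_trans (fG x y).
have Ix : [set` `]x - 1, x + 1[] x by rewrite /= in_itv/= ltrBlDr ltrDl ltr01.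
have H1 : forall x0 y, [set` `]x - 1, x + 1[] x0 -> setT y -> derivable (f^~ y) x0 1.
  by move=> x0 y _ _; case: (Df x0 y).
have H2 x0 y : partial1of2 f x0 y = f' x0 y by rewrite partial1of2E; exact: is_derive_E.
have H3 x0 y : [set` `]x - 1, x + 1[] x0 -> setT y -> `|partial1of2 f x0 y| <= G y by rewrite H2.
split; first exact (derivable_under_integral measurableT Ix (fun x _ => Lf x) H1 G0 LG H3).
rewrite -derive1E (differentiation_under_integral measurableT Ix (fun x _ => Lf x) H1 G0 LG H3).
by apply: Int_ext => y; rewrite H2.
Qed.

End DerInt.

(** * Fourier integrals of one-dimensional Gaussians *)

Section GaussCos.
Context {R : realType}.
Local Notation leb := (@lebesgue_measure R).

Lemma L1_trig (h g : R -> R) : continuous h -> (forall t, `|h t| <= 1) -> L1 leb g ->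
  L1 leb (fun t => g t * h t).
Proof.
move=> ch h1 Lg; have H := @L1_bM _ _ _ leb 1 h g (continuous_measurable ch) h1 Lg.
by apply: (L1_ext _ H) => t; rewrite mulrC.
Qed.

Lemma cos_norm_le1 (x : R) : `|cos x| <= 1.
Proof. by rewrite ler_norml cos_geN1 cos_le1. Qed.

Lemma sin_norm_le1 (x : R) : `|sin x| <= 1.
Proof. by rewrite ler_norml sin_geN1 sin_le1. Qed.

Lemma continuous_cosM (a : R) : continuous (fun t : R => cos (a * t)).
Proof. exact: is_derive_continuous (is_derive_cosM a). Qed.

Lemma continuous_sinM (a : R) : continuous (fun t : R => sin (a * t)).
Proof. exact: is_derive_continuous (is_derive_sinM a). Qed.

Lemma is_derive_sinMD (a p x : R) : is_derive x (1 : R) (fun y => sin (a * y + p)) (a * cos (a * x + p)).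
Proof.
have H := is_derive_add (is_derive_scale a (is_derive_id x (1 : R))) (is_derive_const p x (1:R)).
by apply: (is_derive_eq (is_derive_chain (is_derive_sin _) H)); rewrite mulr1 addr0 mulrC.
Qed.

Lemma is_derive_cosMD (a p x : R) : is_derive x (1 : R) (fun y => cos (a * y + p)) (- (a * sin (a * x + p))).
Proof.
have H := is_derive_add (is_derive_scale a (is_derive_id x (1 : R))) (is_derive_const p x (1:R)).
by apply: (is_derive_eq (is_derive_chain (is_derive_cos _) H)); rewrite mulr1 addr0 mulrC mulrN.
Qed.

Lemma continuous_cosMD (a p : R) : continuous (fun t : R => cos (a * t + p)).
Proof. exact: is_derive_continuous (is_derive_cosMD a p). Qed.

Lemma continuous_sinMD (a p : R) : continuous (fun t : R => sin (a * t + p)).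
Proof. exact: is_derive_continuous (is_derive_sinMD a p). Qed.

(** As a function of [x] the integral solves [g' = - x g / (2 s)]. The phase [p] covers cosine and
    sine in one computation, with [p = 0] and [p = - pi / 2]. *)
Lemma gauss_cosD (s p x : R) : 0 < s ->
  Int leb (fun t => expR (- (s * t ^+ 2)) * cos (x * t + p)) =
  cos p * Num.sqrt (pi / s) * expR (- (x ^+ 2 / (4 * s))).
Proof.
move=> s0; pose g (x : R) := Int leb (fun t => expR (- (s * t ^+ 2)) * cos (x * t + p)).
have Lg := (gauss_Int s0).1.
have Ltg : L1 leb (fun t => t * expR (- (s * t ^+ 2))).
  by apply: L1_ext (L1_gaussX 1 s0) => t; rewrite expr1.
have Dg y : is_derive y (1 : R) g (Int leb (fun t => - (t * expR (- (s * t ^+ 2)) * sin (y * t + p)))).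
  apply: (@is_derive_Int _ _ _ leb (fun y t => expR (- (s * t ^+ 2)) * cos (y * t + p))
     (fun y t => - (t * expR (- (s * t ^+ 2)) * sin (y * t + p)))
     (fun t => `|t * expR (- (s * t ^+ 2))|)).
  - move=> z t; have := is_derive_scale (expR (- (s * t ^+ 2))) (is_derive_cosMD t p z).
    have -> : (fun y => expR (- (s * t ^+ 2)) * cos (t * y + p)) = (fun y => expR (- (s * t ^+ 2)) * cos (y * t + p)).
      by apply/funext => u; rewrite [t * u]mulrC.
    by move=> H; apply: (is_derive_eq H); rewrite (mulrC z t); ring.
  - by move=> z; apply: (@L1_trig (fun t => cos (z * t + p))) => //; [exact: continuous_cosMD|move=> t; exact: cos_norm_le1].
  - exact: L1_norm.
  - by move=> z t; rewrite normrN normrM ler_piMr// sin_norm_le1.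
have Lts y : L1 leb (fun t => t * expR (- (s * t ^+ 2)) * sin (y * t + p)).
  by apply: (@L1_trig (fun t => sin (y * t + p))) => //; [exact: continuous_sinMD|move=> t; exact: sin_norm_le1].
have Lgc y : L1 leb (fun t => expR (- (s * t ^+ 2)) * cos (y * t + p)).
  by apply: (@L1_trig (fun t => cos (y * t + p))) => //; [exact: continuous_cosMD|move=> t; exact: cos_norm_le1].
(* Integration by parts, in the form that the derivative of the Gaussian times the sine integrates
   to 0. *)
have IP y : 2 * s * Int leb (fun t => t * expR (- (s * t ^+ 2)) * sin (y * t + p)) = y * g y.
  apply/esym/subr0_eq; rewrite /g -(IntZ _ (Lts y)) -(IntZ _ (Lgc y)).
  rewrite -(IntB (L1Z _ (Lgc y)) (L1Z _ (Lts y))).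
  have DF t : is_derive t (1 : R) (fun t => expR (- (s * t ^+ 2)) * sin (y * t + p))
     (y * (expR (- (s * t ^+ 2)) * cos (y * t + p)) - 2 * s * (t * expR (- (s * t ^+ 2)) * sin (y * t + p))).
    apply: (is_derive_eq (is_derive_mul (is_derive_gauss s t) (is_derive_sinMD y p t))); ring.
  apply: (Int_derive0 DF).
  - move=> t; apply: cvgB; apply: cvgM; [exact: cvg_cst| |exact: cvg_cst|].
      by apply: cvgM; [exact: continuous_gauss|exact: continuous_cosMD].
    apply: cvgM; last exact: continuous_sinMD.
    by apply: cvgM; [exact: cvg_id|exact: continuous_gauss].
  - exact: L1B (L1Z _ (Lgc y)) (L1Z _ (Lts y)).
  - have := @gauss_n_cvg0 _ s (fun t => sin (y * t + p)) 1 s0 (fun t => sin_norm_le1 _) (normr1 _).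
    by under eq_fun do rewrite mul1r.
  - have := @gauss_n_cvg0 _ s (fun t => sin (y * t + p)) (-1) s0 (fun t => sin_norm_le1 _).
    by rewrite normrN1 => /(_ erefl); under eq_fun do rewrite mulN1r.
have s40 : 4 * s != 0 by rewrite mulf_neq0// gt_eqF.
(* Multiplication by the integrating factor [expR (y ^+ 2 / (4 * s))] gives a function with zero
   derivative, equal to its value at 0. *)
have Dh y : is_derive y (1 : R) (fun y => g y * expR (y ^+ 2 / (4 * s))) 0.
  have H2 : is_derive y (1 : R) (fun y => expR (y ^+ 2 / (4 * s))) (expR (y ^+ 2 / (4 * s)) * (y / (2 * s))).
    apply: is_derive_exp.
    have := is_derive_scale (4 * s)^-1 (is_derive_mul (is_derive_id y (1 : R)) (is_derive_id y (1 : R))).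
    have -> : (fun y : R => (4 * s)^-1 * (y * y)) = (fun y => y ^+ 2 / (4 * s)) by apply/funext => u; ring.
    by move=> H; apply: (is_derive_eq H); field; rewrite gt_eqF.
  apply: (is_derive_eq (is_derive_mul (Dg y) H2)); rewrite (IntN (Lts y)).
  have := IP y; set J := Int _ _ => HJ.
  have -> : J = y * g y / (2 * s) by rewrite -HJ; field; rewrite gt_eqF.
  by field; rewrite gt_eqF.
have := is_derive_0_is_cst x 0 Dh; rewrite expr0n mul0r expR0 mulr1.
have -> : g 0 = cos p * Num.sqrt (pi / s).
  rewrite -(gauss_Int s0).2 -(IntZ _ Lg); apply: Int_ext => t.
  by rewrite mul0r add0r mulrC.
by move=> <-; rewrite -mulrA -expRD subrr expR0 mulr1.
Qed.

Lemma gauss_cos (s x : R) : 0 < s ->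
  Int leb (fun t => expR (- (s * t ^+ 2)) * cos (x * t)) =
  Num.sqrt (pi / s) * expR (- (x ^+ 2 / (4 * s))).
Proof.
move=> s0; have := gauss_cosD 0 x s0; rewrite cos0 mul1r => <-.
by apply: Int_ext => t; rewrite addr0.
Qed.

Lemma gauss_sin (s x : R) : 0 < s ->
  Int leb (fun t => expR (- (s * t ^+ 2)) * sin (x * t)) = 0.
Proof.
move=> s0; have := gauss_cosD (- (pi / 2)) x s0.
rewrite cosN cos_pihalf !mul0r => H; rewrite -[RHS]H; apply: Int_ext => t.
by rewrite cosD cosN sinN cos_pihalf sin_pihalf mulr0 sub0r mulrN1 opprK.
Qed.

End GaussCos.

(** * Gaussians and trigonometric integrals on space *)

Section Space3.
Context {R : realType}.
Local Notation leb := (@lebesgue_measure R).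
Local Notation sp := (R * R * R)%type.

(** The measures of [leb3], repackaged with a sigma-finite structure so that the Fubini lemmas
    apply; statements pass from one form to the other by conversion. *)
Definition leb2s : {sigma_finite_measure set (measurableTypeR R * measurableTypeR R)%type -> \bar R} := prodsf leb leb.
Definition leb3s : {sigma_finite_measure set (measurableTypeR R * measurableTypeR R * measurableTypeR R)%type -> \bar R} := prodsf leb2s leb.
Implicit Types (x y xi : sp) (a b f g : sp -> R).

Definition dp x y : R := x.1.1 * y.1.1 + x.1.2 * y.1.2 + x.2 * y.2.
(** It has two roles: for [s = mu t] it is the Fourier symbol of the heat semigroup, and for [s]
    tending to 0 it is a damping factor tending to 1. *)
Definition gs (s : R) x : R := expR (- (s * dp x x)).

Lemma dotE x y : dot (coords x) (coords y) = dp x y.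
Proof. by rewrite /dot !big_ord_recl big_ord0 !mxE /= addr0 /dp addrA. Qed.

Lemma dpC x y : dp x y = dp y x.
Proof. by rewrite /dp mulrC [x.1.2 * _]mulrC [x.2 * _]mulrC. Qed.

Lemma dpBl x y z : dp (x - y) z = dp x z - dp y z.
Proof. rewrite /dp /=; ring. Qed.

Lemma dpDl x y z : dp (x + y) z = dp x z + dp y z.
Proof. rewrite /dp /=; ring. Qed.

Lemma dp_ge0 x : 0 <= dp x x.
Proof. by rewrite /dp -!expr2 !addr_ge0// sqr_ge0. Qed.

Lemma gsE s x : gs s x = expR (- (s * x.1.1 ^+ 2)) * expR (- (s * x.1.2 ^+ 2)) * expR (- (s * x.2 ^+ 2)).
Proof. by rewrite /gs /dp -!expRD; congr expR; ring. Qed.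

Lemma gs_ge0 s x : 0 <= gs s x.
Proof. exact: expR_ge0. Qed.

Lemma gs_gt0 s x : 0 < gs s x.
Proof. exact: expR_gt0. Qed.

Lemma gs_le1 s x : 0 <= s -> gs s x <= 1.
Proof. by move=> s0; rewrite /gs -expR0 ler_expR oppr_le0 mulr_ge0// dp_ge0. Qed.

Lemma gsD s t x : gs (s + t) x = gs s x * gs t x.
Proof. by rewrite /gs -expRD; congr expR; ring. Qed.

Lemma measurable_p1 : measurable_fun setT (fun x : sp => x.1.1).
Proof. by apply: (measurableT_comp (f := fst)) => //; exact: measurable_fst. Qed.

Lemma measurable_p2 : measurable_fun setT (fun x : sp => x.1.2).
Proof. by apply: (measurableT_comp (f := snd)) => //; exact: measurable_fst. Qed.

Lemma measurable_p3 : measurable_fun setT (fun x : sp => x.2).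
Proof. exact: measurable_snd. Qed.

Lemma measurable_dp d (T : measurableType d) (u v : T -> sp) :
  measurable_fun setT u -> measurable_fun setT v -> measurable_fun setT (fun z => dp (u z) (v z)).
Proof.
move=> mu mv; have H (p : sp -> R) (w : T -> sp) : measurable_fun setT p -> measurable_fun setT w ->
  measurable_fun setT (fun z => p (w z)) by move=> mp mw; exact: measurableT_comp.
apply: measurable_funD; first apply: measurable_funD; apply: measurable_funM.
- exact: (H _ _ measurable_p1 mu).
- exact: (H _ _ measurable_p1 mv).
- exact: (H _ _ measurable_p2 mu).
- exact: (H _ _ measurable_p2 mv).
- exact: (H _ _ measurable_p3 mu).
- exact: (H _ _ measurable_p3 mv).
Qed.

Lemma measurable_dpr x : measurable_fun setT (fun y => dp x y).
Proof. by apply: measurable_dp. Qed.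

Lemma measurable_cosR : measurable_fun setT (@cos R).
Proof. by apply: continuous_measurable; exact: continuous_cos. Qed.

Lemma measurable_sinR : measurable_fun setT (@sin R).
Proof. by apply: continuous_measurable; exact: continuous_sin. Qed.

Lemma measurable_cosdp : measurable_fun setT (fun z : sp * sp => cos (dp z.1 z.2)).
Proof.
apply: (measurableT_comp measurable_cosR); apply: measurable_dp.
  exact: measurable_fst.
exact: measurable_snd.
Qed.

Lemma measurable_sindp : measurable_fun setT (fun z : sp * sp => sin (dp z.1 z.2)).
Proof.
apply: (measurableT_comp measurable_sinR); apply: measurable_dp.
  exact: measurable_fst.
exact: measurable_snd.
Qed.

Lemma measurable_gs s : measurable_fun setT (gs s).
Proof.
apply: (measurableT_comp (@measurable_expR R)); apply: measurableT_comp => //.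
by apply: measurable_funM => //; exact: measurable_dp.
Qed.

Lemma L1_tensor3 (f g h : R -> R) : L1 leb f -> L1 leb g -> L1 leb h ->
  L1 leb3s (fun x => f x.1.1 * g x.1.2 * h x.2).
Proof.
move=> Lf Lg Lh.
exact: (@L1_tensor _ _ _ _ _ leb2s leb _ _ (L1_tensor Lf Lg) Lh).
Qed.

Lemma Int_tensor3 (f g h : R -> R) : L1 leb f -> L1 leb g -> L1 leb h ->
  Int leb3s (fun x => f x.1.1 * g x.1.2 * h x.2) = Int leb f * Int leb g * Int leb h.
Proof.
move=> Lf Lg Lh.
rewrite (@Int_tensor _ _ _ _ _ leb2s leb (fun z => f z.1 * g z.2) h (L1_tensor Lf Lg) Lh).
by rewrite (@Int_tensor _ _ _ _ _ leb leb f g Lf Lg).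
Qed.

Lemma L1_gs s : 0 < s -> L1 leb3s (gs s).
Proof.
move=> s0; have H := (gauss_Int s0).1.
by apply: L1_ext (L1_tensor3 H H H) => x; rewrite gsE.
Qed.

Lemma gs_shift_Int s x : 0 < s -> L1 leb3s (fun y => gs s (x - y)) /\
  Int leb3s (fun y => gs s (x - y)) = Num.sqrt (pi / s) ^+ 3.
Proof.
move=> s0; have [L1a I1] := gauss_shift_Int x.1.1 s0.
have [L2a I2] := gauss_shift_Int x.1.2 s0; have [L3a I3] := gauss_shift_Int x.2 s0.
have E : (fun y => gs s (x - y)) = (fun y => expR (- (s * (y.1.1 - x.1.1) ^+ 2)) *
   expR (- (s * (y.1.2 - x.1.2) ^+ 2)) * expR (- (s * (y.2 - x.2) ^+ 2))).
  by apply/funext => y; rewrite gsE /= -!expRD; congr expR; ring.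
rewrite E (Int_tensor3 L1a L2a L3a) I1 I2 I3; split; last by move: (Num.sqrt _) => q; ring.
exact (L1_tensor3 L1a L2a L3a).
Qed.

(** Real and imaginary parts of the integral of [a(xi) exp(i x.xi)]; keeping them apart keeps the
    whole theory within real-valued integrals. *)
Definition Ct a x := Int leb3s (fun xi => a xi * cos (dp x xi)).
Definition St a x := Int leb3s (fun xi => a xi * sin (dp x xi)).

Lemma L1_cosdp a x : L1 leb3s a -> L1 leb3s (fun xi => a xi * cos (dp x xi)).
Proof.
move=> La; apply: L1_ext (@L1_bM _ _ _ leb3s 1 (fun xi => cos (dp x xi)) _ _ _ La) => [xi||xi].
- by rewrite mulrC.
- exact: (measurableT_comp measurable_cosR (measurable_dpr x)).
- exact: cos_norm_le1.
Qed.

Lemma L1_sindp a x : L1 leb3s a -> L1 leb3s (fun xi => a xi * sin (dp x xi)).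
Proof.
move=> La; apply: L1_ext (@L1_bM _ _ _ leb3s 1 (fun xi => sin (dp x xi)) _ _ _ La) => [xi||xi].
- by rewrite mulrC.
- exact: (measurableT_comp measurable_sinR (measurable_dpr x)).
- exact: sin_norm_le1.
Qed.

Lemma measurable_Ct a : L1 leb3s a -> measurable_fun setT (Ct a).
Proof.
move=> La; exact: (@measurable_Int_param _ _ _ _ _ leb3s a _ La measurable_cosdp (fun z => cos_norm_le1 _)).
Qed.

Lemma measurable_St a : L1 leb3s a -> measurable_fun setT (St a).
Proof.
move=> La; exact: (@measurable_Int_param _ _ _ _ _ leb3s a _ La measurable_sindp (fun z => sin_norm_le1 _)).
Qed.

Lemma Ct_bound a x : L1 leb3s a -> `|Ct a x| <= Int leb3s (fun y => `|a y|).
Proof.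
move=> La; exact: (@Int_param_le _ _ _ _ _ leb3s a _ x La measurable_cosdp (fun z => cos_norm_le1 _)).
Qed.

Lemma St_bound a x : L1 leb3s a -> `|St a x| <= Int leb3s (fun y => `|a y|).
Proof.
move=> La; exact: (@Int_param_le _ _ _ _ _ leb3s a _ x La measurable_sindp (fun z => sin_norm_le1 _)).
Qed.

Lemma Ct_sym a g : L1 leb3s a -> L1 leb3s g ->
  Int leb3s (fun x => g x * Ct a x) = Int leb3s (fun x => a x * Ct g x).
Proof.
move=> La Lg.
rewrite (@Int_sym _ _ _ _ _ leb3s leb3s a g _ La Lg measurable_cosdp (fun z => cos_norm_le1 _)).
apply: Int_ext => y; congr (_ * _); apply: Int_ext => x /=.
by rewrite dpC.
Qed.

Lemma St_sym a g : L1 leb3s a -> L1 leb3s g ->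
  Int leb3s (fun x => g x * St a x) = Int leb3s (fun x => a x * St g x).
Proof.
move=> La Lg.
rewrite (@Int_sym _ _ _ _ _ leb3s leb3s a g _ La Lg measurable_sindp (fun z => sin_norm_le1 _)).
apply: Int_ext => y; congr (_ * _); apply: Int_ext => x /=.
by rewrite dpC.
Qed.

(** The addition formulas split the cosine into products of one-dimensional factors. Products
    containing a sine integrate to 0, and one product of Gaussians remains. *)
Lemma Ct_gs s x : 0 < s -> Ct (gs s) x = Num.sqrt (pi / s) ^+ 3 * gs (4 * s)^-1 x.
Proof.
move=> s0.
pose c z t := expR (- (s * t ^+ 2)) * cos (z * t); pose d z t := expR (- (s * t ^+ 2)) * sin (z * t).
have Lc z : L1 leb (c z).
  by apply: (@L1_trig _ (fun t => cos (z * t))); [exact: continuous_cosM|move=> t; exact: cos_norm_le1|exact: (gauss_Int s0).1].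
have Ld z : L1 leb (d z).
  by apply: (@L1_trig _ (fun t => sin (z * t))); [exact: continuous_sinM|move=> t; exact: sin_norm_le1|exact: (gauss_Int s0).1].
have E : (fun xi => gs s xi * cos (dp x xi)) = (fun xi =>
  (c x.1.1 xi.1.1 * c x.1.2 xi.1.2 * c x.2 xi.2 - d x.1.1 xi.1.1 * d x.1.2 xi.1.2 * c x.2 xi.2) -
  (c x.1.1 xi.1.1 * d x.1.2 xi.1.2 * d x.2 xi.2 + d x.1.1 xi.1.1 * c x.1.2 xi.1.2 * d x.2 xi.2)).
  by apply/funext => xi; rewrite gsE /dp !cosD !sinD /c /d; ring.
rewrite /Ct E.
rewrite (IntB (L1B (L1_tensor3 (Lc _) (Lc _) (Lc _)) (L1_tensor3 (Ld _) (Ld _) (Lc _)))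
              (L1D (L1_tensor3 (Lc _) (Ld _) (Ld _)) (L1_tensor3 (Ld _) (Lc _) (Ld _)))).
rewrite (IntB (L1_tensor3 (Lc _) (Lc _) (Lc _)) (L1_tensor3 (Ld _) (Ld _) (Lc _))).
rewrite (IntD (L1_tensor3 (Lc _) (Ld _) (Ld _)) (L1_tensor3 (Ld _) (Lc _) (Ld _))).
rewrite !Int_tensor3// /c /d !(gauss_sin _ s0) !(gauss_cos _ s0).
rewrite !(mulr0, mul0r) addr0 !subr0 gsE.
have HE z : z ^+ 2 / (4 * s) = (4 * s)^-1 * z ^+ 2 by rewrite mulrC.
rewrite !HE.
by move: (Num.sqrt _) => q; ring.
Qed.

(** The factor of the inversion formula for the unnormalized transform. *)
Definition c3 : R := (2 * pi) ^+ 3.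

Lemma c3_gt0 : 0 < c3.
Proof. by rewrite exprn_gt0// mulr_gt0// pi_gt0. Qed.

Lemma heat_kernelE s x : 0 < s -> heat_kernel s x = c3^-1 * Ct (gs s) x.
Proof.
move=> s0; rewrite Ct_gs// /heat_kernel dotE /gs mulrA; congr (_ * expR _); last first.
  by rewrite mulrC mulrN.
have -> : c3 = (Num.sqrt (pi / s) * Num.sqrt (4 * pi * s)) ^+ 3.
  rewrite -sqrtrM; last by rewrite divr_ge0 ?pi_ge0// ltW.
  have -> : pi / s * (4 * pi * s) = (2 * pi) ^+ 2 by move: (pi : R) => p; field; rewrite gt_eqF.
  by rewrite sqrtr_sqr ger0_norm// mulr_ge0// pi_ge0.
have q0 : Num.sqrt (pi / s) != 0 by rewrite gt_eqF// sqrtr_gt0 divr_gt0// pi_gt0.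
by rewrite exprMn [in RHS]invfM [RHS]mulrAC mulVf ?mul1r// expf_neq0.
Qed.

Lemma heat_kernel_ge0 s x : 0 <= heat_kernel s x.
Proof. by rewrite mulr_ge0 ?expR_ge0// invr_ge0 exprn_ge0// sqrtr_ge0. Qed.

Lemma heat_kernel_gs s x : 0 < s -> heat_kernel s x = Num.sqrt (4 * pi * s) ^- 3 * gs (4 * s)^-1 x.
Proof. by move=> s0; rewrite /heat_kernel dotE /gs mulNr [dp x x / _]mulrC. Qed.

Lemma heat_kernel_Int s x : 0 < s -> L1 leb3s (fun y => heat_kernel s (x - y)) /\
  Int leb3s (fun y => heat_kernel s (x - y)) = 1.
Proof.
move=> s0; have s40 : 0 < (4 * s)^-1 by rewrite invr_gt0 mulr_gt0.
have [LG IG] := gs_shift_Int x s40.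
have -> : (fun y => heat_kernel s (x - y)) = (fun y => Num.sqrt (4 * pi * s) ^- 3 * gs (4 * s)^-1 (x - y)).
  by apply/funext => y; rewrite heat_kernel_gs.
split; first exact: L1Z.
rewrite (IntZ _ LG) IG invrK; have -> : pi * (4 * s) = 4 * pi * s by move: (pi : R) => p; ring.
by rewrite mulVf// expf_neq0// gt_eqF// sqrtr_gt0 !mulr_gt0// pi_gt0.
Qed.

End Space3.

(** * Bessel's inequality *)

Section ProdIntegrable.
Context d1 d2 (T1 : measurableType d1) (T2 : measurableType d2) (R : realType).
Variables (m1 : {sigma_finite_measure set T1 -> \bar R})
          (m2 : {sigma_finite_measure set T2 -> \bar R}).

Lemma L1_prod12 (F : T1 * T2 -> R) (h : T1 -> R) : measurable_fun setT F ->
  (forall x, L1 m2 (fun y => F (x, y))) ->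
  (forall x, Int m2 (fun y => `|F (x, y)|) = h x) -> L1 m1 h -> L1 (m1 \x m2)%E F.
Proof.
move=> mF LF hE Lh; apply/integrable12ltyP; first exact/measurable_EFinP.
under eq_integral => x _.
  rewrite (eq_integral (fun y => (`|F (x, y)|)%:E)) // (Int_EFin (L1_norm (LF x))) hE.
  over.
by rewrite (Int_EFin Lh) ltry.
Qed.

Lemma L1_prod21 (F : T1 * T2 -> R) (h : T2 -> R) : measurable_fun setT F ->
  (forall y, L1 m1 (fun x => F (x, y))) ->
  (forall y, Int m1 (fun x => `|F (x, y)|) = h y) -> L1 m2 h -> L1 (m1 \x m2)%E F.
Proof.
move=> mF LF hE Lh; apply/integrable21ltyP; first exact/measurable_EFinP.
under eq_integral => y _.
  rewrite (eq_integral (fun x => (`|F (x, y)|)%:E)) // (Int_EFin (L1_norm (LF y))) hE.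
  over.
by rewrite (Int_EFin Lh) ltry.
Qed.

End ProdIntegrable.

Section Bessel.
Context {R : realType}.
Local Notation sp := (R * R * R)%type.
Local Notation mu := (@leb3s R).
Implicit Types (x y xi : sp) (a b f g p q w : sp -> R).

Lemma L1_mulCt w f : L1 mu w -> L1 mu f -> L1 mu (fun x => w x * Ct f x).
Proof.
move=> Lw Lf.
apply: L1_ext (@L1_bM _ _ _ mu _ (Ct f) w (measurable_Ct Lf) (fun x => Ct_bound x Lf) Lw) => x.
by rewrite mulrC.
Qed.

Lemma L1_mulSt w f : L1 mu w -> L1 mu f -> L1 mu (fun x => w x * St f x).
Proof.
move=> Lw Lf.
apply: L1_ext (@L1_bM _ _ _ mu _ (St f) w (measurable_St Lf) (fun x => St_bound x Lf) Lw) => x.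
by rewrite mulrC.
Qed.

(** The weighted polarized energy of two transforms is a double integral against the transform of
    the weight at [x - y]; the sum of products is the addition formula for [cos (x.xi - y.xi)]. *)
Lemma Phi_conv g f w : L1 mu g -> L1 mu f -> L1 mu w ->
  Int mu (fun xi => w xi * (Ct g xi * Ct f xi + St g xi * St f xi)) =
  Int mu (fun x => g x * Int mu (fun y => f y * Ct w (x - y))).
Proof.
move=> Lg Lf Lw.
have L1' := L1_mulCt Lw Lf; have L2' := L1_mulSt Lw Lf.
transitivity (Int mu (fun x => g x * Ct (fun xi => w xi * Ct f xi) x) +
              Int mu (fun x => g x * St (fun xi => w xi * St f xi) x)).
  rewrite (Ct_sym L1' Lg) (St_sym L2' Lg) -(IntD (L1_mulCt L1' Lg) (L1_mulSt L2' Lg)).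
  by apply: Int_ext => xi; ring.
rewrite -(IntD (L1_mulCt Lg L1') (L1_mulSt Lg L2')).
apply: Int_ext => x; rewrite -mulrDr; congr (_ * _).
rewrite /Ct /St -(IntD (L1_cosdp x L1') (L1_sindp x L2')).
have mk : measurable_fun setT (fun z : sp * sp => cos (dp (x - z.1) z.2)).
  have -> : (fun z : sp * sp => cos (dp (x - z.1) z.2)) = (fun z : sp * sp => cos (dp x z.2 - dp z.1 z.2)).
    by apply/funext => z; rewrite dpBl.
  apply: (measurableT_comp measurable_cosR); by apply: measurable_funB; apply: measurable_dp.
rewrite (@Int_sym _ _ _ _ _ mu mu w f _ Lw Lf mk (fun z => cos_norm_le1 _)) /=.
apply: Int_ext => xi; rewrite -!mulrA -mulrDr; congr (_ * _).
rewrite mulrC [_ * sin _]mulrC /Ct /St -(IntZ _ (L1_cosdp xi Lf)) -(IntZ _ (L1_sindp xi Lf)).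
rewrite -(IntD (L1Z _ (L1_cosdp xi Lf)) (L1Z _ (L1_sindp xi Lf))).
by apply: Int_ext => y; rewrite dpBl cosB [dp xi y]dpC; ring.
Qed.

Lemma measurable_gs_sub (s : R) : measurable_fun setT (fun z : sp * sp => gs s (z.1 - z.2)).
Proof.
have -> : (fun z : sp * sp => gs s (z.1 - z.2)) =
   (fun z : sp * sp => expR (- (s * (dp z.1 z.1 - 2 * dp z.1 z.2 + dp z.2 z.2)))).
  by apply/funext => z; rewrite /gs dpBl [dp z.1 _]dpC [dp z.2 _]dpC !dpBl [dp z.2 z.1]dpC; congr expR; ring.
apply: (measurableT_comp (@measurable_expR R)); apply: measurableT_comp => //.
have m1 : measurable_fun setT (fst : sp * sp -> sp) by exact: measurable_fst.
have m2 : measurable_fun setT (snd : sp * sp -> sp) by exact: measurable_snd.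
apply: measurable_funM => //; apply: measurable_funD; last exact: measurable_dp.
by apply: measurable_funB; [exact: measurable_dp|apply: measurable_funM => //; exact: measurable_dp].
Qed.

Lemma gs_sub_sym (s : R) x y : gs s (x - y) = gs s (y - x).
Proof. by rewrite /gs /dp /=; congr expR; ring. Qed.

(** Schur's test: [g(x) g(y)] is at most the half sum of the squares, and the symmetric kernel has
    the same mass in each variable. *)
Lemma gs_schur (s : R) g : 0 < s -> L1 mu g -> L2 mu g ->
  Int mu (fun x => g x * Int mu (fun y => g y * gs s (x - y))) <=
  Num.sqrt (pi / s) ^+ 3 * Int mu (fun x => g x ^+ 2).
Proof.
move=> s0 Lg [mg Lg2]; set J := _ ^+ 3.
have mG := measurable_gs_sub s.
have mg1 : measurable_fun setT (fun z : sp * sp => g z.1).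
  by apply: (measurableT_comp mg); exact: measurable_fst.
have mg2 : measurable_fun setT (fun z : sp * sp => g z.2).
  by apply: (measurableT_comp mg); exact: measurable_snd.
have LG x := (gs_shift_Int x s0).1; have IG x : Int mu (fun y => gs s (x - y)) = J := (gs_shift_Int x s0).2.
have LF1 : L1 (mu \x mu)%E (fun z : sp * sp => g z.1 ^+ 2 * gs s (z.1 - z.2)).
  apply: (@L1_prod12 _ _ _ _ _ mu mu _ (fun x => J * g x ^+ 2)).
  - by apply: measurable_funM => //; exact: measurable_funX.
  - by move=> x; exact (L1Z (g x ^+ 2) (LG x)).
  - move=> x /=; rewrite mulrC -(IG x) -(IntZ _ (LG x)); apply: Int_ext => y.
    by rewrite ger0_norm// mulr_ge0// ?sqr_ge0 ?gs_ge0.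
  - exact: L1Z.
have LF2 : L1 (mu \x mu)%E (fun z : sp * sp => g z.2 ^+ 2 * gs s (z.1 - z.2)).
  apply: (@L1_prod21 _ _ _ _ _ mu mu _ (fun x => J * g x ^+ 2)).
  - by apply: measurable_funM => //; exact: measurable_funX.
  - move=> x; have H : L1 mu (fun y => gs s (y - x)) by apply: L1_ext (LG x) => y; rewrite gs_sub_sym.
    exact (L1Z (g x ^+ 2) H).
  - move=> x /=; rewrite mulrC -(IG x) -(IntZ _ (LG x)); apply: Int_ext => y.
    by rewrite gs_sub_sym ger0_norm// mulr_ge0// ?sqr_ge0 ?gs_ge0.
  - exact: L1Z.
have LF : L1 (mu \x mu)%E (fun z : sp * sp => gs s (z.1 - z.2) * (g z.1 * g z.2)).
  have G1 (z : sp * sp) : `|gs s (z.1 - z.2)| <= 1 by rewrite ger0_norm ?gs_ge0// gs_le1// ltW.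
  exact (@L1_bM _ _ _ (mu \x mu)%E 1 _ _ mG G1 (L1_tensor Lg Lg)).
have E0 := Int_fub1 LF; have E1 := Int_fub1 LF1; have E2 := Int_fub2 LF2; rewrite /= in E0 E1 E2.
have -> : Int mu (fun x => g x * Int mu (fun y => g y * gs s (x - y))) =
    Int (mu \x mu)%E (fun z : sp * sp => gs s (z.1 - z.2) * (g z.1 * g z.2)).
  rewrite -E0; apply: Int_ext => x; rewrite -IntZ.
    by apply: Int_ext => y; ring.
  apply: L1_ext (@L1_bM _ _ _ mu 1 (fun y => gs s (x - y)) g _ _ Lg) => [y||y].
  - by rewrite mulrC.
  - by apply: L1_meas; exact: LG.
  - by rewrite ger0_norm ?gs_ge0// gs_le1// ltW.
have -> : J * Int mu (fun x => g x ^+ 2) =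
    Int (mu \x mu)%E (fun z : sp * sp => 2^-1 * (g z.1 ^+ 2 * gs s (z.1 - z.2) + g z.2 ^+ 2 * gs s (z.1 - z.2))).
  rewrite (IntZ _ (L1D LF1 LF2)) (IntD LF1 LF2) -E1 -E2.
  have -> : Int mu (fun x => Int mu (fun y => g x ^+ 2 * gs s (x - y))) = J * Int mu (fun x => g x ^+ 2).
    rewrite -(IntZ _ Lg2); apply: Int_ext => x; rewrite (IntZ _ (LG x)) IG mulrC//.
  have -> : Int mu (fun y => Int mu (fun x => g y ^+ 2 * gs s (x - y))) = J * Int mu (fun x => g x ^+ 2).
    rewrite -(IntZ _ Lg2); apply: Int_ext => x; rewrite -(IG x) mulrC -(IntZ _ (LG x)).
    by apply: Int_ext => y; rewrite gs_sub_sym.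
  by field.
apply: Int_le => //; first exact: L1Z (L1D LF1 LF2).
move=> z; rewrite -subr_ge0; set G := gs s _.
have -> : 2^-1 * (g z.1 ^+ 2 * G + g z.2 ^+ 2 * G) - G * (g z.1 * g z.2) = 2^-1 * G * (g z.1 - g z.2) ^+ 2.
  by field.
by apply: mulr_ge0; [rewrite mulr_ge0// gs_ge0|exact: sqr_ge0].
Qed.

(** The parameter [s] cancels, which makes the bound in [bessel] uniform in the damping. *)
Lemma Ct_gs_Int (s : R) : 0 < s -> Num.sqrt (pi / s) ^+ 3 * Num.sqrt (pi / (4 * s)^-1) ^+ 3 = c3 :> R.
Proof.
move=> s0; rewrite -exprMn -sqrtrM; last by rewrite divr_ge0 ?pi_ge0// ltW.
have -> : pi / s * (pi / (4 * s)^-1) = (2 * pi) ^+ 2 :> R by move: (pi : R) => u; field; rewrite gt_eqF.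
by rewrite sqrtr_sqr ger0_norm// mulr_ge0// pi_ge0.
Qed.

Lemma inv_succ_cvg0 : (n.+1%:R : R)^-1 @[n --> \oo] --> (0 : R).
Proof. exact: cvg_harmonic. Qed.

Lemma gs_harmonic_cvg x : gs (n.+1%:R : R)^-1 x @[n --> \oo] --> (1 : R).
Proof.
have H : - (n.+1%:R^-1 * dp x x) @[n --> \oo] --> - (0 * dp x x) by apply: cvgN; apply: cvgMl; exact: inv_succ_cvg0.
have H2 : expR (- (n.+1%:R^-1 * dp x x)) @[n --> \oo] --> expR (- (0 * dp x x)).
  by apply: continuous_cvg H; exact: continuous_expR.
by move: H2; rewrite mul0r oppr0 expR0.
Qed.

(** With the damping [gs (e n)], [Phi_conv] turns the energy of the transform into a Gaussian double
    integral, [gs_schur] bounds it by [c3] times the energy of [g] for every [n], and [Int_fatou]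
    removes the damping. *)
Lemma bessel g : L1 mu g -> L2 mu g ->
  [/\ L2 mu (Ct g), L2 mu (St g) &
   Int mu (fun x => Ct g x ^+ 2 + St g x ^+ 2) <= c3 * Int mu (fun x => g x ^+ 2)].
Proof.
move=> Lg L2g.
have [L I] : L1 mu (fun x => Ct g x ^+ 2 + St g x ^+ 2) /\
    Int mu (fun x => Ct g x ^+ 2 + St g x ^+ 2) <= c3 * Int mu (fun x => g x ^+ 2).
  pose e (n : nat) : R := n.+1%:R^-1.
  have e0 n : 0 < e n by rewrite invr_gt0.
  apply: (@Int_fatou _ _ _ mu (fun n x => gs (e n) x * (Ct g x * Ct g x + St g x * St g x))).
  - move=> n; have L1' := L1_mulCt (L1_mulCt (L1_gs (e0 n)) Lg) Lg.
    have L2' := L1_mulSt (L1_mulSt (L1_gs (e0 n)) Lg) Lg.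
    by apply: L1_ext (L1D L1' L2') => x; ring.
  - by move=> n x; rewrite mulr_ge0 ?gs_ge0// -!expr2 addr_ge0// sqr_ge0.
  - move=> x; rewrite -[X in _ --> X]mul1r -!expr2; apply: cvgMl.
    exact: gs_harmonic_cvg.
  - move=> n; rewrite (Phi_conv Lg Lg (L1_gs (e0 n))).
    have s0 : 0 < (4 * e n)^-1 by rewrite invr_gt0 mulr_gt0.
    have LG x : L1 mu (fun y => g y * gs (4 * e n)^-1 (x - y)).
      apply: L1_ext (@L1_bM _ _ _ mu 1 (fun y => gs (4 * e n)^-1 (x - y)) g _ _ Lg) => [y||y].
      + by rewrite mulrC.
      + by apply: L1_meas; exact: (gs_shift_Int x s0).1.
      + by rewrite ger0_norm ?gs_ge0// gs_le1// ltW.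
    have -> : (fun x => g x * Int mu (fun y => g y * Ct (gs (e n)) (x - y))) =
      (fun x => Num.sqrt (pi / e n) ^+ 3 * (g x * Int mu (fun y => g y * gs (4 * e n)^-1 (x - y)))).
      apply/funext => x; rewrite mulrCA; congr (_ * _); rewrite -(IntZ _ (LG x)).
      by apply: Int_ext => y; rewrite Ct_gs// mulrCA.
    rewrite IntZ; last first.
      apply: (@L1_ext _ _ _ mu (fun x => g x * Int mu (fun y => g y * gs (4 * e n)^-1 (x - y)))) => //.
      have mG := measurable_gs_sub (4 * e n)^-1.
      have G1 z : `|gs (4 * e n)^-1 (z.1 - z.2 : sp)| <= 1.
        by rewrite ger0_norm ?gs_ge0// gs_le1// ltW.
      apply: L1_ext (@L1_bM _ _ _ mu _ (fun x => Int mu (fun y => g y * gs (4 * e n)^-1 (x - y))) g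
        (measurable_Int_param Lg mG G1) (fun x => Int_param_le x Lg mG G1) Lg) => x.
      by rewrite mulrC.
    apply: (le_trans (ler_wpM2l _ (gs_schur s0 Lg L2g))).
      by rewrite exprn_ge0// sqrtr_ge0.
    by rewrite mulrA Ct_gs_Int.
split=> //.
- split; first exact (measurable_Ct Lg).
  apply: (L1_le _ L); first by apply: measurable_funX; exact (measurable_Ct Lg).
  by move=> x; rewrite ger0_norm ?sqr_ge0// lerDl sqr_ge0.
- split; first exact (measurable_St Lg).
  apply: (L1_le _ L); first by apply: measurable_funX; exact (measurable_St Lg).
  by move=> x; rewrite ger0_norm ?sqr_ge0// lerDr sqr_ge0.
Qed.

End Bessel.

(** * The Plancherel transform *)

Lemma cvg0_sqr (R : realType) (c e : nat -> R) K : (forall n, c n ^+ 2 <= K * e n) ->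
  e n @[n --> \oo] --> (0 : R) -> c n @[n --> \oo] --> (0 : R).
Proof.
move=> ce e0; apply/cvgr0Pnorm_le => eps eps0.
have H : K * e n @[n --> \oo] --> (0 : R) by rewrite -(mulr0 K); apply: cvgMr.
have eps20 : 0 < eps ^+ 2 by rewrite exprn_gt0.
move/cvgr0Pnorm_le : H => /(_ _ eps20) [N _ HN].
exists N => // n Nn /=.
rewrite -sqrtr_sqr -(ger0_norm (ltW eps0)) -sqrtr_sqr; apply: ler_wsqrtr.
by apply: le_trans (ce n) _; apply: le_trans (ler_norm _) _; exact: HN.
Qed.

Lemma cvgR_unique (R : realType) (u : nat -> R) (l l' : R) :
  u n @[n --> \oo] --> l -> u n @[n --> \oo] --> l' -> l = l'.
Proof. by move=> h h'; exact: (cvg_unique _ h h'). Qed.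

Lemma cvgR_ext (R : realType) (u v : nat -> R) (l : R) :
  (forall n, u n = v n) -> v n @[n --> \oo] --> l -> u n @[n --> \oo] --> l.
Proof. by move=> /funext ->. Qed.

Section L2Limits.
Context {d : measure_display} {T : measurableType d} {R : realType}.
Variable mu : {measure set T -> \bar R}.
Implicit Types f g : T -> R.

Lemma L2cvg_Int (u : nat -> T -> R) f v : (forall n, L2 mu (u n)) -> L2 mu f -> L2 mu v ->
  Int mu (fun x => (u n x - f x) ^+ 2) @[n --> \oo] --> (0 : R) ->
  Int mu (fun x => u n x * v x) @[n --> \oo] --> Int mu (fun x => f x * v x).
Proof.
move=> Lu Lf Lv uf; apply/subr_cvg0.
apply: (@cvg0_sqr _ _ (fun n => Int mu (fun x => (u n x - f x) ^+ 2)) (Int mu (fun x => v x ^+ 2))) => // n.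
have -> : Int mu (fun x => u n x * v x) - Int mu (fun x => f x * v x) =
   Int mu (fun x => (u n x - f x) * v x).
  rewrite -(IntB (L2_mul (Lu n) Lv) (L2_mul Lf Lv)).
  by apply: Int_ext => x; rewrite mulrBl.
by rewrite mulrC; exact: (cauchy_schwarz (L2B (Lu n) Lf) Lv).
Qed.

Lemma L2cvg_dom (u : nat -> T -> R) f g : (forall n, measurable_fun setT (u n)) -> L2 mu g ->
  measurable_fun setT f ->
  (forall n x, `|u n x - f x| <= g x) -> (forall x, u n x @[n --> \oo] --> f x) ->
  Int mu (fun x => (u n x - f x) ^+ 2) @[n --> \oo] --> (0 : R).
Proof.
move=> mu_ [mg Lg] mf ug uf.
have [_] : L1 mu (fun=> 0) /\ Int mu (fun x => (u n x - f x) ^+ 2) @[n --> \oo] --> Int mu (fun=> 0).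
  apply: (@Int_dom _ _ _ mu (fun n x => (u n x - f x) ^+ 2) (fun=> 0) (fun x => g x ^+ 2)) => //.
  - by move=> n; apply: measurable_funX; exact: measurable_funB.
  - move=> n x; rewrite normrX lerXn2r ?nnegrE//.
    by apply: le_trans (ug n x).
  - move=> x; have -> : (0 : R) = (f x - f x) * (f x - f x) by rewrite subrr mul0r.
    by apply: cvgM; apply: cvgB => //; exact: cvg_cst.
by rewrite Int_0.
Qed.

End L2Limits.

Section Transform.
Context {R : realType}.
Local Notation sp := (R * R * R)%type.
Local Notation mu := (@leb3s R).
Implicit Types (x y xi : sp) (a b f g p q w : sp -> R).

(* [f] has Plancherel transform [a + i b] *)
Definition ft f a b := [/\ L2 mu f, L2 mu a, L2 mu b &
  exists g : nat -> sp -> R, [/\ forall n, L1 mu (g n) /\ L2 mu (g n),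
    Int mu (fun x => (g n x - f x) ^+ 2) @[n --> \oo] --> (0 : R),
    Int mu (fun x => (Ct (g n) x - a x) ^+ 2) @[n --> \oo] --> (0 : R) &
    Int mu (fun x => (St (g n) x + b x) ^+ 2) @[n --> \oo] --> (0 : R)]].

Definition L12 f := L1 mu f /\ L2 mu f.

(* the real part of the integral of (a + i b) exp (i x.xi) *)
Definition Rt a b x := Ct a x - St b x.

Lemma L2_Rt p q : L12 p -> L12 q -> L2 mu (Rt p q).
Proof.
by move=> [p1 p2] [q1 q2]; apply: L2B; [case: (bessel p1 p2)|case: (bessel q1 q2)].
Qed.

Lemma bessel_C p : L12 p -> Int mu (fun x => Ct p x ^+ 2) <= c3 * Int mu (fun x => p x ^+ 2).
Proof.
move=> [p1 p2]; have [[_ h1] [_ h2] h3] := bessel p1 p2.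
by apply: le_trans h3; apply: Int_le => //; [exact: L1D|move=> x; rewrite lerDl sqr_ge0].
Qed.

Lemma bessel_S p : L12 p -> Int mu (fun x => St p x ^+ 2) <= c3 * Int mu (fun x => p x ^+ 2).
Proof.
move=> [p1 p2]; have [[_ h1] [_ h2] h3] := bessel p1 p2.
by apply: le_trans h3; apply: Int_le => //; [exact: L1D|move=> x; rewrite lerDr sqr_ge0].
Qed.

(** Cosine and sine parts are estimated separately through [(u - v)^2 <= 2 (u^2 + v^2)], whence the
    factor 2. *)
Lemma Rt_bound p q : L12 p -> L12 q ->
  Int mu (fun x => Rt p q x ^+ 2) <= 2 * c3 * Int mu (fun x => p x ^+ 2 + q x ^+ 2).
Proof.
move=> hp hq; have [p1 p2] := hp; have [q1 q2] := hq.
have [Cp Sp _] := bessel p1 p2; have [Cq Sq _] := bessel q1 q2.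
apply: (@le_trans _ _ (Int mu (fun x => 2 * (Ct p x ^+ 2 + St q x ^+ 2)))).
  apply: Int_le; [exact: (L2_Rt hp hq).2|exact: (L1Z 2 (L1D Cp.2 Sq.2))|].
  move=> x; rewrite -subr_ge0 /Rt; set u := Ct p x; set v := St q x.
  have -> : 2 * (u ^+ 2 + v ^+ 2) - (u - v) ^+ 2 = (u + v) ^+ 2 by ring.
  exact: sqr_ge0.
rewrite (IntZ _ (L1D Cp.2 Sq.2)) (IntD Cp.2 Sq.2) (IntD p2.2 q2.2) -mulrA ler_pM2l// mulrDr.
by apply: lerD; [exact: bessel_C|exact: bessel_S].
Qed.

Lemma Int_Rt g p q : L1 mu g -> L12 p -> L12 q ->
  Int mu (fun x => g x * Rt p q x) = Int mu (fun x => p x * Ct g x - q x * St g x).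
Proof.
move=> Lg [p1 _] [q1 _].
rewrite (IntB (L1_mulCt p1 Lg) (L1_mulSt q1 Lg)) -(Ct_sym p1 Lg) -(St_sym q1 Lg).
rewrite -(IntB (L1_mulCt Lg p1) (L1_mulSt Lg q1)).
by apply: Int_ext => x; rewrite /Rt mulrBr.
Qed.

(** Fubini for the integrable approximants [g n], then a limit in [L2] on both sides. For test
    functions of the form [Rt p q] no inversion formula is involved. *)
Lemma parseval_Rt f a b p q : ft f a b -> L12 p -> L12 q ->
  Int mu (fun x => f x * Rt p q x) = Int mu (fun x => a x * p x + b x * q x).
Proof.
move=> [Lf La Lb [g [Lg gf ga gb]]] hp hq.
have H1 := L2cvg_Int (fun n => (Lg n).2) Lf (L2_Rt hp hq) gf.
have Cg n : L2 mu (Ct (g n)) by case: (bessel (Lg n).1 (Lg n).2).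
have Sg n : L2 mu (St (g n)) by case: (bessel (Lg n).1 (Lg n).2).
have H2 := L2cvg_Int Cg La hp.2 ga.
have H3 : Int mu (fun x => St (g n) x * q x) @[n --> \oo] --> Int mu (fun x => - b x * q x).
  apply: (L2cvg_Int Sg (L2N Lb) hq.2); apply: cvgR_ext gb => n.
  by apply: Int_ext => x; rewrite opprK.
have E n : Int mu (fun x => g n x * Rt p q x) =
   Int mu (fun x => Ct (g n) x * p x) - Int mu (fun x => St (g n) x * q x).
  rewrite (Int_Rt (Lg n).1 hp hq) -(IntB (L2_mul (Cg n) hp.2) (L2_mul (Sg n) hq.2)).
  by apply: Int_ext => x; rewrite mulrC [q x * _]mulrC.
have H4 : Int mu (fun x => g n x * Rt p q x) @[n --> \oo] -->
    Int mu (fun x => a x * p x) - Int mu (fun x => - b x * q x).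
  by apply: (cvgR_ext E); exact: cvgB.
rewrite (cvgR_unique H1 H4).
rewrite -(IntB (L2_mul La hp.2) (L2_mul (L2N Lb) hq.2)).
by apply: Int_ext => x; rewrite mulNr opprK.
Qed.

Lemma L2_gs (s : R) : 0 < s -> L2 mu (gs s).
Proof.
move=> s0; split; first exact (measurable_gs s).
have s20 : 0 < s + s by rewrite addr_gt0.
by apply: L1_ext (L1_gs s20) => x; rewrite gsD expr2.
Qed.

Lemma L12_gs_mul (s : R) f : 0 < s -> L2 mu f -> L12 (fun x => gs s x * f x).
Proof.
move=> s0 Lf; split; first exact: L2_mul (L2_gs s0) Lf.
have G1 x : `|gs s x| <= 1.
  by rewrite ger0_norm ?gs_ge0// gs_le1// ltW.
exact (@L2_bM _ _ _ mu 1 (gs s) f (measurable_gs s) G1 Lf).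
Qed.

Lemma L12_bM c (h f : sp -> R) : measurable_fun setT h -> (forall x, `|h x| <= c) -> L12 f ->
  L12 (fun x => h x * f x).
Proof. move=> mh hc [f1 f2]; split.
  exact (@L1_bM _ _ _ mu c h f mh hc f1).
exact (@L2_bM _ _ _ mu c h f mh hc f2).
 Qed.

Lemma L12_gs (s : R) : 0 < s -> L12 (gs s).
Proof. move=> s0; split; [exact: L1_gs|exact: L2_gs]. Qed.

Lemma L12N f : L12 f -> L12 (fun x => - f x).
Proof. by move=> [h1 h2]; split; [exact: L1N|exact: L2N]. Qed.

Lemma L12D f g : L12 f -> L12 g -> L12 (fun x => f x + g x).
Proof. by move=> [h1 h2] [k1 k2]; split; [exact: L1D|exact: L2D]. Qed.

Lemma L12B f g : L12 f -> L12 g -> L12 (fun x => f x - g x).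
Proof. by move=> [h1 h2] [k1 k2]; split; [exact: L1B|exact: L2B]. Qed.

Lemma L12Z c f : L12 f -> L12 (fun x => c * f x).
Proof. by move=> [h1 h2]; split; [exact: L1Z|exact: L2Z]. Qed.

Lemma L12_ext f g : f =1 g -> L12 f -> L12 g.
Proof. by move=> /funext ->. Qed.

Lemma L12_0 : L12 (fun=> 0).
Proof. by split; [exact: L1_0|exact: L2_0]. Qed.

Lemma L12_gs_cos (s : R) x : 0 < s -> L12 (fun xi => gs s xi * cos (dp x xi)).
Proof.
move=> s0; apply: (@L12_ext (fun xi => cos (dp x xi) * gs s xi)) => [xi|]; first by rewrite mulrC.
exact (@L12_bM 1 _ _ (measurableT_comp measurable_cosR (measurable_dpr x)) (fun xi => cos_norm_le1 _) (L12_gs s0)).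
Qed.

Lemma L12_gs_sin (s : R) x : 0 < s -> L12 (fun xi => gs s xi * sin (dp x xi)).
Proof.
move=> s0; apply: (@L12_ext (fun xi => sin (dp x xi) * gs s xi)) => [xi|]; first by rewrite mulrC.
exact (@L12_bM 1 _ _ (measurableT_comp measurable_sinR (measurable_dpr x)) (fun xi => sin_norm_le1 _) (L12_gs s0)).
Qed.

Lemma heat_kernel_Rt (s : R) x y : 0 < s -> heat_kernel s (x - y) =
  c3^-1 * Rt (fun xi => gs s xi * cos (dp x xi)) (fun xi => - (gs s xi * sin (dp x xi))) y.
Proof.
move=> s0; rewrite heat_kernelE//; congr (_ * _).
have [Lc _] := L12_gs_cos x s0; have [Ls _] := L12_gs_sin x s0.
rewrite /Rt /Ct /St -(IntB (L1_cosdp y Lc) (L1_sindp y (L1N Ls))).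
by apply: Int_ext => xi; rewrite dpBl cosB; ring.
Qed.

(** The heat kernel centred at [x] is itself of the form [Rt] by [heat_kernel_Rt], so Parseval's
    identity gives the heat flow at every point and not merely almost everywhere. *)
Lemma heat_Rt (s : R) f a b x : 0 < s -> ft f a b ->
  Int mu (fun y => heat_kernel s (x - y) * f y) =
  c3^-1 * Rt (fun xi => gs s xi * a xi) (fun xi => gs s xi * b xi) x.
Proof.
move=> s0 hf; have hc := L12_gs_cos x s0; have hs := L12N (L12_gs_sin x s0).
have [Lf La Lb _] := hf.
have -> : (fun y => heat_kernel s (x - y) * f y) = (fun y => c3^-1 * (f y *
   Rt (fun xi => gs s xi * cos (dp x xi)) (fun xi => - (gs s xi * sin (dp x xi))) y)).
  by apply/funext => y; rewrite heat_kernel_Rt// mulrAC mulrA mulrAC.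
rewrite (IntZ _ (L2_mul Lf (L2_Rt hc hs))) (parseval_Rt hf hc hs); congr (_ * _).
have [ga _] := L12_gs_mul s0 La; have [gb _] := L12_gs_mul s0 Lb.
rewrite /Rt /Ct /St -(IntB (L1_cosdp x ga) (L1_sindp x gb)).
by apply: Int_ext => xi; ring.
Qed.

(** One factor 2 comes from replacing the transform of [f] by that of [g n], the other from
    replacing [g n] by [f], with Bessel's inequality in between. The remainders are collected in
    [e n], which tends to 0. *)
Lemma ft_bound f a b : ft f a b ->
  Int mu (fun x => a x ^+ 2 + b x ^+ 2) <= 4 * c3 * Int mu (fun x => f x ^+ 2).
Proof.
move=> [Lf La Lb [g [Lg gf ga gb]]].
have Cg n : L2 mu (Ct (g n)) by case: (bessel (Lg n).1 (Lg n).2).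
have Sg n : L2 mu (St (g n)) by case: (bessel (Lg n).1 (Lg n).2).
pose e n := 4 * c3 * Int mu (fun x => (g n x - f x) ^+ 2) + (2 * Int mu (fun x => (Ct (g n) x - a x) ^+ 2)
   + 2 * Int mu (fun x => (St (g n) x + b x) ^+ 2)).
have e0 : e n @[n --> \oo] --> (0 : R).
  have -> : (0 : R) = 4 * c3 * 0 + (2 * 0 + 2 * 0) by ring.
  by apply: cvgD; [apply: cvgMr|apply: cvgD; apply: cvgMr].
suff H n : Int mu (fun x => a x ^+ 2 + b x ^+ 2) - 4 * c3 * Int mu (fun x => f x ^+ 2) <= e n.
  by rewrite -subr_le0; apply: (cvg_ge_const e0 H).
have LCa := (L2B (Cg n) La).2; have LSb := (L2D (Sg n) Lb).2; have Lgf := (L2B (Lg n).2 Lf).2.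
have LA := L1D (L1Z 2 (Cg n).2) (L1Z 2 LCa); have LB := L1D (L1Z 2 (Sg n).2) (L1Z 2 LSb).
have h1 : Int mu (fun x => a x ^+ 2 + b x ^+ 2) <= Int mu (fun x =>
   (2 * Ct (g n) x ^+ 2 + 2 * (Ct (g n) x - a x) ^+ 2) + (2 * St (g n) x ^+ 2 + 2 * (St (g n) x + b x) ^+ 2)).
  apply: Int_le; [exact: L1D La.2 Lb.2|exact: L1D LA LB|].
  move=> x; rewrite -subr_ge0; set u := Ct _ x; set v := St _ x.
  have -> : 2 * u ^+ 2 + 2 * (u - a x) ^+ 2 + (2 * v ^+ 2 + 2 * (v + b x) ^+ 2) - (a x ^+ 2 + b x ^+ 2) =
    (2 * u - a x) ^+ 2 + (2 * v + b x) ^+ 2 by ring.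
  by rewrite addr_ge0// sqr_ge0.
rewrite (IntD LA LB) (IntD (L1Z 2 (Cg n).2) (L1Z 2 LCa)) (IntD (L1Z 2 (Sg n).2) (L1Z 2 LSb)) in h1.
rewrite (IntZ _ (Cg n).2) (IntZ _ LCa) (IntZ _ (Sg n).2) (IntZ _ LSb) in h1.
have h2 : Int mu (fun x => g n x ^+ 2) <= Int mu (fun x => 2 * f x ^+ 2 + 2 * (g n x - f x) ^+ 2).
  apply: Int_le; [exact: (Lg n).2.2|exact: L1D (L1Z 2 Lf.2) (L1Z 2 Lgf)|].
  move=> x; rewrite -subr_ge0.
  have -> : 2 * f x ^+ 2 + 2 * (g n x - f x) ^+ 2 - g n x ^+ 2 = (g n x - 2 * f x) ^+ 2 by ring.
  exact: sqr_ge0.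
rewrite (IntD (L1Z 2 Lf.2) (L1Z 2 Lgf)) (IntZ _ Lf.2) (IntZ _ Lgf) in h2.
have [_ _ h3] := bessel (Lg n).1 (Lg n).2; rewrite (IntD (Cg n).2 (Sg n).2) in h3.
have c30 := @c3_gt0 R; have h4 := ler_wpM2l (ltW c30) h2.
move: h1 h3 h4; rewrite /e; move: (Int _ _) (Int _ _) (Int _ _) (Int _ _) (Int _ _) (Int _ _) (Int _ _) => i1 i2 i3 i4 i5 i6 i7.
move: (c3 : R) => c; lra.
Qed.

End Transform.

(** * Approximate identity *)

Lemma cvg0_squeeze (R : realType) (u e : nat -> R) K : (forall n, 0 <= u n <= K * e n) ->
  e n @[n --> \oo] --> (0 : R) -> u n @[n --> \oo] --> (0 : R).
Proof.
move=> ue e0; apply: (@squeeze_cvgr _ _ _ _ (fun=> 0) (fun n => K * e n)); last 2 first.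
- exact: cvg_cst.
- by rewrite -(mulr0 K); exact: cvgMr.
- exact: nearW.
Qed.

Section ApproxIdentity.
Context {R : realType}.
Local Notation sp := (R * R * R)%type.
Local Notation mu := (@leb3s R).
Implicit Types (x y xi : sp) (a b f g p q w phi : sp -> R).

(** Near [x] continuity gives [eta]; once a coordinate differs by at least [dl], the oscillation
    [2 M] is at most [2 M / dl^2] times the squared distance. The approximate identity is thereby
    reduced to a second moment. *)
Lemma continuous_quadratic_bound phi M x eta : continuous phi -> (forall y, `|phi y| <= M) -> 0 < eta ->
  exists2 K, 0 <= K & forall y, `|phi y - phi x| <= eta + K * dp (x - y) (x - y).
Proof.
move=> cphi phiM eta0.
have M0 : 0 <= M by apply: le_trans (phiM x).
have /cvgrPdist_le /(_ _ eta0) := cphi x.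
move=> /nbhs_ballP[dl /= dl0 H].
have K0 : 0 <= 2 * M / dl ^+ 2.
  by apply: divr_ge0; [rewrite mulr_ge0|apply: exprn_ge0; exact: ltW].
exists (2 * M / dl ^+ 2) => //.
have far y t : dl <= `|t| -> t ^+ 2 <= dp (x - y) (x - y) ->
    `|phi y - phi x| <= eta + 2 * M / dl ^+ 2 * dp (x - y) (x - y).
  move=> dt tx; have h1 : `|phi y - phi x| <= 2 * M.
    by rewrite (le_trans (ler_normB _ _))// mulrDl mul1r lerD.
  have h2 : dl ^+ 2 <= dp (x - y) (x - y).
    apply: le_trans tx; rewrite -(real_normK (num_real t)) lerXn2r ?nnegrE//.
      exact: ltW.
  have h3 : 2 * M <= 2 * M / dl ^+ 2 * dp (x - y) (x - y).
    by rewrite mulrAC ler_pdivlMr ?exprn_gt0// ler_wpM2l// mulr_ge0.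
  by rewrite (le_trans h1)// (le_trans h3)// lerDr ltW.
have dE y : dp (x - y) (x - y) = (x.1.1 - y.1.1) ^+ 2 + (x.1.2 - y.1.2) ^+ 2 + (x.2 - y.2) ^+ 2.
  by rewrite /dp /= !expr2.
move=> y; have [h1|h1] := ltP `|x.1.1 - y.1.1| dl; last first.
  by apply: (far _ _ h1); rewrite dE -addrA lerDl addr_ge0// sqr_ge0.
have [h2|h2] := ltP `|x.1.2 - y.1.2| dl; last first.
  by apply: (far _ _ h2); rewrite dE addrAC lerDr addr_ge0// sqr_ge0.
have [h3|h3] := ltP `|x.2 - y.2| dl; last first.
  by apply: (far _ _ h3); rewrite dE lerDr addr_ge0// sqr_ge0.
have := H y; rewrite distrC => Hy; apply: (le_trans (Hy _)) => //.
by rewrite lerDl; apply: mulr_ge0 => //; exact: dp_ge0.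
Qed.

(** With [r = |x - y|^2], the inequality [r <= 8 s exp (r / (8 s))] trades [r] for half of the
    exponent and leaves the kernel at time [2 s]; [sqrt 2 ^+ 3] is the ratio of the normalizing
    factors. *)
Lemma heat_kernel_moment (s : R) x : 0 < s -> L1 mu (fun y => dp (x - y) (x - y) * heat_kernel s (x - y)) /\
  Int mu (fun y => dp (x - y) (x - y) * heat_kernel s (x - y)) <= 8 * s * Num.sqrt 2 ^+ 3.
Proof.
move=> s0; have s20 : 0 < 2 * s by rewrite mulr_gt0.
have [Lk Ik] := heat_kernel_Int x s20.
have mdp : measurable_fun setT (fun y => dp (x - y) (x - y)).
  have -> : (fun y => dp (x - y) (x - y)) = (fun y => dp x x - 2 * dp x y + dp y y).
    by apply/funext => y; rewrite dpBl [dp x _]dpC [dp y (x - y)]dpC !dpBl [dp y x]dpC; ring.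
  apply: measurable_funD; last exact: measurable_dp.
  by apply: measurable_funB => //; apply: measurable_funM => //; exact: measurable_dpr.
have B y : dp (x - y) (x - y) * heat_kernel s (x - y) <= 8 * s * Num.sqrt 2 ^+ 3 * heat_kernel (2 * s) (x - y).
  rewrite !heat_kernel_gs//; set r := dp _ _; have r0 : 0 <= r by exact: dp_ge0.
  have -> : 4 * pi * (2 * s) = 2 * (4 * pi * s) :> R by move: (pi : R) => u; ring.
  rewrite (@sqrtrM _ 2)//; set q := Num.sqrt (4 * pi * s).
  have q0 : 0 < q by rewrite sqrtr_gt0 !mulr_gt0// pi_gt0.
  have w0 : 0 < Num.sqrt (2 : R) by rewrite sqrtr_gt0.
  have -> : 8 * s * Num.sqrt 2 ^+ 3 * ((Num.sqrt 2 * q) ^- 3 * gs (4 * (2 * s))^-1 (x - y)) =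
     q ^- 3 * (8 * s * gs (4 * (2 * s))^-1 (x - y)).
    by move: (gs _ _) => G; field; rewrite !gt_eqF.
  rewrite mulrCA; apply: ler_wpM2l; first by rewrite invr_ge0 exprn_ge0// ltW.
  have -> : (4 * s)^-1 = (4 * (2 * s))^-1 + (4 * (2 * s))^-1 by field; rewrite gt_eqF.
  rewrite gsD [leLHS]mulrA; apply: ler_wpM2r; first exact: gs_ge0.
  rewrite /gs -/r expRN ler_pdivrMr ?expR_gt0//.
  have := expR_ge1Dx ((4 * (2 * s))^-1 * r); set E := expR _ => HE.
  have : (4 * (2 * s))^-1 * r <= E by rewrite (le_trans _ HE)// lerDr.
  by rewrite mulrC ler_pdivrMr ?mulr_gt0// => h; rewrite (le_trans h)// le_eqVlt; apply/orP; left; apply/eqP; ring.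
have Lm : L1 mu (fun y => dp (x - y) (x - y) * heat_kernel s (x - y)).
  apply: (L1_le _ (L1Z (8 * s * Num.sqrt 2 ^+ 3) Lk)).
    by apply: measurable_funM => //; apply: L1_meas; exact: (heat_kernel_Int x s0).1.
  by move=> y; rewrite ger0_norm// mulr_ge0// ?dp_ge0// heat_kernel_ge0.
split=> //.
have -> : 8 * s * Num.sqrt 2 ^+ 3 = Int mu (fun y => 8 * s * Num.sqrt 2 ^+ 3 * heat_kernel (2 * s) (x - y)).
  by rewrite (IntZ _ Lk) Ik mulr1.
apply: Int_le; [exact Lm|exact (L1Z (8 * s * Num.sqrt 2 ^+ 3) Lk)|exact: B].
Qed.

(** With [eta = eps / 2] in [continuous_quadratic_bound], what remains is [K] times the second
    moment, of order [1 / n]. *)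
Lemma heat_kernel_cvg phi M x : L1 mu phi -> continuous phi -> (forall y, `|phi y| <= M) ->
  Int mu (fun y => phi y * heat_kernel (n.+1%:R : R)^-1 (x - y)) @[n --> \oo] --> phi x.
Proof.
move=> mphi cphi phiM; apply/cvgrPdist_le => eps eps0.
have eps20 : 0 < eps / 2 by rewrite divr_gt0.
have [K K0 HK] := continuous_quadratic_bound x cphi phiM eps20.
have : (fun n => K * (8 * Num.sqrt 2 ^+ 3) * n.+1%:R^-1) @ \oo --> (0 : R).
  by rewrite -(mulr0 (K * (8 * Num.sqrt 2 ^+ 3))); apply: cvgMr; exact: inv_succ_cvg0.
move=> /cvgr0Pnorm_le /(_ _ eps20) [N _ HN].
exists N => // n Nn /=; have {HN} := HN n Nn => /= HN.
have e0 : 0 < (n.+1%:R : R)^-1 by rewrite invr_gt0.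
set s := n.+1%:R^-1 in HN e0 *.
have [Lk Ik] := heat_kernel_Int x e0; have [Lm Im] := heat_kernel_moment x e0.
have Lpk := @L1_bM _ _ _ mu M phi _ (L1_meas mphi) phiM Lk.
have -> : phi x - Int mu (fun y => phi y * heat_kernel s (x - y)) =
  - Int mu (fun y => (phi y - phi x) * heat_kernel s (x - y)).
  have -> : (fun y => (phi y - phi x) * heat_kernel s (x - y)) =
    (fun y => phi y * heat_kernel s (x - y) - phi x * heat_kernel s (x - y)).
    by apply/funext => y; rewrite mulrBl.
  by rewrite (IntB Lpk (L1Z _ Lk)) (IntZ _ Lk) Ik mulr1 opprB.
rewrite normrN.
have LB : L1 mu (fun y => (phi y - phi x) * heat_kernel s (x - y)).
  by apply: L1_ext (L1B Lpk (L1Z (phi x) Lk)) => y; rewrite mulrBl.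
apply: (le_trans (Int_norm LB)).
apply: (@le_trans _ _ (Int mu (fun y => eps / 2 * heat_kernel s (x - y) +
    K * (dp (x - y) (x - y) * heat_kernel s (x - y))))).
  apply: Int_le; [exact: L1_norm|exact: L1D (L1Z _ Lk) (L1Z _ Lm)|].
  move=> y; rewrite normrM (ger0_norm (heat_kernel_ge0 _ _)) (mulrA K) -mulrDl.
  by apply: ler_wpM2r; [exact: heat_kernel_ge0|exact: HK].
rewrite (IntD (L1Z _ Lk) (L1Z _ Lm)) (IntZ _ Lk) (IntZ _ Lm) Ik mulr1 [leRHS](splitr eps) lerD//.
apply: (le_trans (ler_wpM2l K0 Im)); apply: le_trans HN.
by rewrite (_ : K * (8 * s * Num.sqrt 2 ^+ 3) = K * (8 * Num.sqrt 2 ^+ 3) * s) ?ler_norm//; ring.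
Qed.

End ApproxIdentity.

(** * The inversion inequality *)

Section Inversion.
Context {R : realType}.
Local Notation sp := (R * R * R)%type.
Local Notation mu := (@leb3s R).
Local Notation msp := (measurableTypeR R * measurableTypeR R * measurableTypeR R)%type.
Implicit Types (x y xi : sp) (f g p q w phi : sp -> R).

Lemma CtB f g x : L1 mu f -> L1 mu g -> Ct (fun y => f y - g y) x = Ct f x - Ct g x.
Proof.
move=> Lf Lg; rewrite /Ct -(IntB (L1_cosdp x Lf) (L1_cosdp x Lg)).
by apply: Int_ext => y; rewrite mulrBl.
Qed.

Lemma StB f g x : L1 mu f -> L1 mu g -> St (fun y => f y - g y) x = St f x - St g x.
Proof.
move=> Lf Lg; rewrite /St -(IntB (L1_sindp x Lf) (L1_sindp x Lg)).
by apply: Int_ext => y; rewrite mulrBl.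
Qed.

Lemma CtD f g x : L1 mu f -> L1 mu g -> Ct (fun y => f y + g y) x = Ct f x + Ct g x.
Proof.
move=> Lf Lg; rewrite /Ct -(IntD (L1_cosdp x Lf) (L1_cosdp x Lg)).
by apply: Int_ext => y; rewrite mulrDl.
Qed.

Lemma StD f g x : L1 mu f -> L1 mu g -> St (fun y => f y + g y) x = St f x + St g x.
Proof.
move=> Lf Lg; rewrite /St -(IntD (L1_sindp x Lf) (L1_sindp x Lg)).
by apply: Int_ext => y; rewrite mulrDl.
Qed.

Lemma CtZ c f x : L1 mu f -> Ct (fun y => c * f y) x = c * Ct f x.
Proof.
by move=> Lf; rewrite /Ct -(IntZ _ (L1_cosdp x Lf)); apply: Int_ext => y; rewrite mulrA.
Qed.

Lemma StZ c f x : L1 mu f -> St (fun y => c * f y) x = c * St f x.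
Proof.
by move=> Lf; rewrite /St -(IntZ _ (L1_sindp x Lf)); apply: Int_ext => y; rewrite mulrA.
Qed.

Lemma L12_Ct f : L12 f -> L2 mu (Ct f).
Proof. by move=> [h1 h2]; case: (bessel h1 h2). Qed.

Lemma L12_St f : L12 f -> L2 mu (St f).
Proof. by move=> [h1 h2]; case: (bessel h1 h2). Qed.

(* Parseval's identity for the regularized test functions, by the approximate identity *)
Lemma parseval_continuous phi M g : L12 phi -> continuous phi -> (forall y, `|phi y| <= M) -> L12 g ->
  Int mu (fun x => phi x * g x) = c3^-1 * Int mu (fun x => Ct g x * Ct phi x + St g x * St phi x).
Proof.
move=> hphi cphi phiM hg.
have [[p1 p2] [g1 g2]] := (hphi, hg).
pose e (n : nat) : R := n.+1%:R^-1; have e0 n : 0 < e n by rewrite invr_gt0.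
have LCC := L1D (L2_mul (L12_Ct hg) (L12_Ct hphi)) (L2_mul (L12_St hg) (L12_St hphi)).
have H1 : Int mu (fun x => gs (e n) x * (Ct g x * Ct phi x + St g x * St phi x)) @[n --> \oo] -->
   Int mu (fun x => Ct g x * Ct phi x + St g x * St phi x).
  have [|||_ //] := @Int_dom _ _ _ mu
    (fun n x => gs (e n) x * (Ct g x * Ct phi x + St g x * St phi x))
    (fun x => Ct g x * Ct phi x + St g x * St phi x) (fun x => `|Ct g x * Ct phi x + St g x * St phi x|) _ (L1_norm LCC).
  - by move=> n; apply: measurable_funM; [exact: measurable_gs|exact (L1_meas LCC)].
  - move=> n x; rewrite normrM ler_piMl// ger0_norm ?gs_ge0// gs_le1// ltW//.
  - by move=> x; rewrite -[X in _ --> X]mul1r; apply: cvgMl; exact: gs_harmonic_cvg.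
(* [T n] is [phi] regularized by the heat flow at time [e n]. By [Phi_conv] its pairing with [g] is,
   up to [c3], the damped frequency integral, so the limits in [H1] and [H2] must match. *)
pose T n x := Int mu (fun y => phi y * heat_kernel (e n) (x - y)).
have mT n : measurable_fun setT (T n).
  have G1 z : `|gs (4 * e n)^-1 (z.1 - z.2 : sp)| <= 1.
    by rewrite ger0_norm ?gs_ge0// gs_le1// invr_ge0 mulr_ge0// ltW.
  have H := measurable_Int_param p1 (measurable_gs_sub (4 * e n)^-1) G1.
  have -> : T n = (fun x => Num.sqrt (4 * pi * e n) ^- 3 * Int mu (fun y => phi y * gs (4 * e n)^-1 (x - y))).
    apply/funext => x; rewrite -IntZ.
      by apply: Int_ext => y; rewrite heat_kernel_gs// mulrCA.
    apply: L1_ext (@L1_bM _ _ _ mu 1 (fun y => gs (4 * e n)^-1 (x - y)) phi _ _ p1) => [y||y].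
    - by rewrite mulrC.
    - by apply: L1_meas; apply: (gs_shift_Int x _).1; rewrite invr_gt0 mulr_gt0.
    - exact: (G1 (x, y)).
  by apply: measurable_funM.
have TM n x : `|T n x| <= M.
  have [Lk Ik] := heat_kernel_Int x (e0 n).
  have Lpk := @L1_bM _ _ _ mu M phi _ (L1_meas p1) phiM Lk.
  apply: (le_trans (Int_norm Lpk)).
  have -> : M = Int mu (fun y => M * heat_kernel (e n) (x - y)) by rewrite (IntZ _ Lk) Ik mulr1.
  apply: Int_le; [exact (L1_norm Lpk)|exact (L1Z M Lk)|].
  by move=> y; rewrite normrM (ger0_norm (heat_kernel_ge0 _ _)) ler_wpM2r ?heat_kernel_ge0.
have H2 : Int mu (fun x => T n x * g x) @[n --> \oo] --> Int mu (fun x => phi x * g x).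
  have [|||_ //] := @Int_dom _ _ _ mu (fun n x => T n x * g x) (fun x => phi x * g x)
      (fun x => M * `|g x|) _ (L1Z M (L1_norm g1)).
  - by move=> n; apply: measurable_funM; [exact (mT n)|exact (L1_meas g1)].
  - by move=> n x; rewrite normrM ler_wpM2r.
  - by move=> x; apply: cvgMl; exact: (@heat_kernel_cvg R phi M x p1 cphi phiM).
apply: (cvgR_unique H2); apply: cvgR_ext (@cvgMr _ _ _ _ _ c3^-1 _ H1) => n /=.
have HT x : Int mu (fun y => phi y * Ct (gs (e n)) (x - y)) = c3 * T n x.
  rewrite /T -IntZ; last by exact (@L1_bM _ _ _ mu M phi _ (L1_meas p1) phiM (heat_kernel_Int x (e0 n)).1).
  by apply: Int_ext => y; rewrite heat_kernelE// mulrCA (mulrA c3) mulfV ?mul1r// gt_eqF// c3_gt0.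
have LT := @L1_bM _ _ _ mu M (T n) g (mT n) (TM n) g1.
have c3n : c3 != 0 :> R by rewrite gt_eqF// c3_gt0.
rewrite (Phi_conv g1 p1 (L1_gs (e0 n))) -[LHS]mul1r -(mulVf c3n) -mulrA -(IntZ _ LT); congr (_ * _).
by apply: Int_ext => x; rewrite HT mulrA mulrC.
Qed.

Section Fixed.
Variables (f a b : sp -> R).
Hypothesis fab : ft f a b.

Let Lf : L2 mu f. Proof. by case: fab. Qed.
Let La : L2 mu a. Proof. by case: fab. Qed.
Let Lb : L2 mu b. Proof. by case: fab. Qed.

(** The functions for which Parseval's identity holds against the fixed [f] and its transform. The
    class contains the bounded continuous members of [L12], is linear and stable under [L2] limits;
    a monotone class argument extends it to all of [L12]. *)
Definition good phi := L12 phi /\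
  Int mu (fun x => phi x * f x) = c3^-1 * Int mu (fun x => Ct phi x * a x - St phi x * b x).

Lemma good_continuous phi M : L12 phi -> continuous phi -> (forall y, `|phi y| <= M) -> good phi.
Proof.
move=> hphi cphi phiM; split => //.
have [_ _ _ [g [hg gf ga gb]]] := fab.
have Cg n : L2 mu (Ct (g n)) := L12_Ct (hg n); have Sg n : L2 mu (St (g n)) := L12_St (hg n).
have H1 := L2cvg_Int (fun n => (hg n).2) Lf hphi.2 gf.
have H2 := L2cvg_Int Cg La (L12_Ct hphi) ga.
have H3 : Int mu (fun x => St (g n) x * St phi x) @[n --> \oo] --> Int mu (fun x => - b x * St phi x).
  apply: (L2cvg_Int Sg (L2N Lb) (L12_St hphi)); apply: cvgR_ext gb => n.
  by apply: Int_ext => x; rewrite opprK.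
have -> : Int mu (fun x => phi x * f x) = Int mu (fun x => f x * phi x).
  by apply: Int_ext => x; rewrite mulrC.
have -> : Int mu (fun x => Ct phi x * a x - St phi x * b x) =
    Int mu (fun x => a x * Ct phi x) + Int mu (fun x => - b x * St phi x).
  rewrite -(IntD (L2_mul La (L12_Ct hphi)) (L2_mul (L2N Lb) (L12_St hphi))).
  by apply: Int_ext => x; ring.
apply: (cvgR_unique H1).
have E n : Int mu (fun x => g n x * phi x) = c3^-1 *
    (Int mu (fun x => Ct (g n) x * Ct phi x) + Int mu (fun x => St (g n) x * St phi x)).
  rewrite -(IntD (L2_mul (Cg n) (L12_Ct hphi)) (L2_mul (Sg n) (L12_St hphi))).
  rewrite -(parseval_continuous hphi cphi phiM (hg n)).
  by apply: Int_ext => x; rewrite mulrC.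
by apply: (cvgR_ext E); apply: cvgMr; exact (cvgD H2 H3).
Qed.

(** Bessel's inequality carries the [L2] convergence over to the transforms. Integrability of the
    limit is a separate premise, since it does not survive [L2] limits. *)
Lemma good_lim (u : nat -> sp -> R) phi : (forall n, good (u n)) -> L12 phi ->
  Int mu (fun x => (u n x - phi x) ^+ 2) @[n --> \oo] --> (0 : R) -> good phi.
Proof.
move=> gu hphi uphi; split => //.
have hu n : L12 (u n) := (gu n).1.
have Cu : Int mu (fun x => (Ct (u n) x - Ct phi x) ^+ 2) @[n --> \oo] --> (0 : R).
  apply: (@cvg0_squeeze _ _ _ c3 _ uphi) => n; apply/andP; split; first by apply: Int_ge0 => x; exact: sqr_ge0.
  apply: le_trans (bessel_C (L12B (hu n) hphi)); rewrite le_eqVlt; apply/orP; left; apply/eqP.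
  by apply: Int_ext => x; rewrite CtB//; [exact: (hu n).1|exact: hphi.1].
have Su : Int mu (fun x => (St (u n) x - St phi x) ^+ 2) @[n --> \oo] --> (0 : R).
  apply: (@cvg0_squeeze _ _ _ c3 _ uphi) => n; apply/andP; split; first by apply: Int_ge0 => x; exact: sqr_ge0.
  apply: le_trans (bessel_S (L12B (hu n) hphi)); rewrite le_eqVlt; apply/orP; left; apply/eqP.
  by apply: Int_ext => x; rewrite StB//; [exact: (hu n).1|exact: hphi.1].
have H1 := L2cvg_Int (fun n => (hu n).2) hphi.2 Lf uphi.
have H2 := L2cvg_Int (fun n => L12_Ct (hu n)) (L12_Ct hphi) La Cu.
have H3 := L2cvg_Int (fun n => L12_St (hu n)) (L12_St hphi) Lb Su.
rewrite (IntB (L2_mul (L12_Ct hphi) La) (L2_mul (L12_St hphi) Lb)).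
apply: (cvgR_unique H1).
have E n : Int mu (fun x => u n x * f x) = c3^-1 *
    (Int mu (fun x => Ct (u n) x * a x) - Int mu (fun x => St (u n) x * b x)).
  by rewrite -(IntB (L2_mul (L12_Ct (hu n)) La) (L2_mul (L12_St (hu n)) Lb)) (gu n).2.
by apply: (cvgR_ext E); apply: cvgMr; exact (cvgB H2 H3).
Qed.

Lemma goodD p q : good p -> good q -> good (fun x => p x + q x).
Proof.
move=> [hp Ep] [hq Eq]; split; first exact: L12D.
have -> : Int mu (fun x => (p x + q x) * f x) = Int mu (fun x => p x * f x) + Int mu (fun x => q x * f x).
  by rewrite -(IntD (L2_mul hp.2 Lf) (L2_mul hq.2 Lf)); apply: Int_ext => x; rewrite mulrDl.
rewrite Ep Eq -mulrDr -(IntD (L1B (L2_mul (L12_Ct hp) La) (L2_mul (L12_St hp) Lb))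
  (L1B (L2_mul (L12_Ct hq) La) (L2_mul (L12_St hq) Lb))).
congr (_ * _); apply: Int_ext => x; rewrite (CtD _ hp.1 hq.1) (StD _ hp.1 hq.1); ring.
Qed.

Lemma goodZ c p : good p -> good (fun x => c * p x).
Proof.
move=> [hp Ep]; split; first exact: L12Z.
have -> : Int mu (fun x => c * p x * f x) = c * Int mu (fun x => p x * f x).
  by rewrite -(IntZ _ (L2_mul hp.2 Lf)); apply: Int_ext => x; rewrite mulrA.
rewrite Ep mulrCA -(IntZ _ (L1B (L2_mul (L12_Ct hp) La) (L2_mul (L12_St hp) Lb))).
congr (_ * _); apply: Int_ext => x; rewrite (CtZ _ _ hp.1) (StZ _ _ hp.1); ring.
Qed.

Lemma good_ext p q : p =1 q -> good p -> good q.
Proof. by move=> /funext ->. Qed.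

Lemma good0 : good (fun=> 0).
Proof.
split; first exact: L12_0.
have -> : (fun x => 0 * f x) = (fun=> 0) by apply/funext => x; rewrite mul0r.
have -> : (fun x => Ct (fun=> 0) x * a x - St (fun=> 0) x * b x) = (fun=> 0).
  apply/funext => x; rewrite /Ct /St.
  by under Int_ext do rewrite mul0r; rewrite Int_0 (@Int_ext _ _ _ mu _ (fun=> 0)) ?Int_0 ?mul0r ?subrr// => y; rewrite mul0r.
by rewrite !Int_0 mulr0.
Qed.

End Fixed.
End Inversion.

(** * Generation of the measurable sets by octants *)

Section Density.
Context {R : realType}.
Local Notation sp := (R * R * R)%type.
Local Notation mu := (@leb3s R).
Local Notation msp := (measurableTypeR R * measurableTypeR R * measurableTypeR R)%type.
Implicit Types (x y xi : sp) (g p q w phi : sp -> R) (A : set sp).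

Definition ramp (t : R) : R := Num.min 1 (Num.max 0 t).

Lemma ramp_ge0 t : 0 <= ramp t.
Proof. by rewrite /ramp le_min ler01 le_max lexx. Qed.

Lemma ramp_le1 t : ramp t <= 1.
Proof. by rewrite /ramp ge_min lexx. Qed.

Lemma continuous_ramp : continuous ramp.
Proof.
move=> t.
have c0 (c : R) : {for t, continuous (fun=> c : R^o)} by exact: cvg_cst.
have ci : {for t, continuous (id : R -> R^o)} by exact: cvg_id.
exact (continuous_min (c0 1) (continuous_max (c0 0) ci)).
Qed.

(** At [t = c] all terms are 0, so the limit is the indicator of the open half-line, in agreement
    with the strict inequalities of [octant]. *)
Lemma ramp_cvg (c t : R) : ramp (n%:R * (t - c)) @[n --> \oo] --> ((c < t)%R%:R : R).
Proof.
have [ct|tc] := ltP c t.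
  have [N HN] : exists N : nat, (t - c)^-1 <= N%:R.
    by exists (Num.truncn (t - c)^-1).+1; apply/ltW; rewrite truncnS_gt.
  apply: (@cvg_eventually _ _ (fun=> 1) N); last exact: cvg_cst.
  move=> n Nn; rewrite /ramp min_l// le_max; apply/orP; right.
  by rewrite -ler_pdivrMr ?subr_gt0// mul1r (le_trans HN)// ler_nat.
apply: (@cvgR_ext _ _ (fun=> 0)); last exact: cvg_cst.
by move=> n; rewrite /ramp max_l ?min_r// mulr_ge0_le0// subr_le0.
Qed.

Definition octant (c : sp) : set sp := [set x | [/\ c.1.1 < x.1.1, c.1.2 < x.1.2 & c.2 < x.2]].

Definition octants : set (set sp) := range octant.

Lemma octants_setI : setI_closed octants.
Proof.
move=> _ _ [c _ <-] [e _ <-]; exists (Num.max c.1.1 e.1.1, Num.max c.1.2 e.1.2, Num.max c.2 e.2) => //.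
rewrite /octant; apply/seteqP; split => x /=; rewrite !gt_max.
  by move=> [/andP[? ?] /andP[? ?] /andP[? ?]].
by move=> [[-> -> ->] [-> -> ->]].
Qed.

(** A half-space is the union of the octants whose other two corner coordinates are [- n]. *)
Lemma setT_octants (P : set sp) (c : R) (k : 'I_3) :
  P = [set x | c < nth 0 [:: x.1.1; x.1.2; x.2] k] -> <<s octants >> P.
Proof.
move=> ->; pose F (n : nat) : set sp := octant
  (if k == 0 :> nat then c else - n%:R, if k == 1%N :> nat then c else - n%:R, if k == 2%N :> nat then c else - n%:R).
have -> : [set x : sp | c < nth 0 [:: x.1.1; x.1.2; x.2] k] = \bigcup_n F n.
  apply/seteqP; split => x /=; last first.
    by case: k @F => -[|[|[|//]]] ik F [n _] [].
  pose M := `|x.1.1| + `|x.1.2| + `|x.2|.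
  move=> cx; exists (Num.truncn M).+1 => //.
  have HM : M < (Num.truncn M).+1%:R by rewrite truncnS_gt.
  have B t : `|t| <= M -> - (Num.truncn M).+1%:R < t.
    move=> tM; have : `|t| < (Num.truncn M).+1%:R by apply: le_lt_trans HM.
    by rewrite ltr_norml => /andP[].
  have B1 : - (Num.truncn M).+1%:R < x.1.1 by apply: B; rewrite /M -addrA lerDl addr_ge0.
  have B2 : - (Num.truncn M).+1%:R < x.1.2 by apply: B; rewrite /M addrAC lerDr addr_ge0.
  have B3 : - (Num.truncn M).+1%:R < x.2 by apply: B; rewrite /M lerDr addr_ge0.
  by move: cx; case: k @F => -[|[|[|//]]] ik F /= cx; split.
apply: sigma_algebra_bigcup => n; apply: sub_sigma_algebra; exact: imageT.
Qed.

(** The three coordinates are measurable for the sigma-algebra generated by the octants, hence so is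
    the identity into the product sigma-algebra. *)
Lemma measurable_octants A : @measurable _ msp A -> <<s octants >> A.
Proof.
move=> mA.
have H1 (pr : sp -> R) (k : 'I_3) : pr = (fun x => nth 0 [:: x.1.1; x.1.2; x.2] k) ->
    @measurable_fun _ _ (g_sigma_algebraType octants) (measurableTypeR R) setT pr.
  move=> prE; apply: (measurability (@RGenOInfty.G R)); first exact: RGenOInfty.measurableE.
  move=> _ [_ [c ->] <-]; rewrite setTI; apply: (setT_octants (c := c) (k := k)).
  by apply/seteqP; split => x /=; rewrite in_itv/= andbT prE.
have H : @measurable_fun _ _ (g_sigma_algebraType octants) msp setT id.
  apply/measurable_fun_pairP; split; first apply/measurable_fun_pairP; [split|].
  - exact: (H1 (fun x => x.1.1) ord0).
  - by apply: (H1 (fun x => x.1.2) (inord 1)); apply/funext => x; rewrite inordK.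
  - by apply: (H1 (fun x => x.2) (inord 2)); apply/funext => x; rewrite inordK.
by have := H measurableT A mA; rewrite setTI.
Qed.

End Density.

Import HBNNSimple.

(** * Parseval's identity for all integrable test functions, and inversion *)

Section InversionBound.
Context {R : realType}.
Local Notation sp := (R * R * R)%type.
Local Notation mu := (@leb3s R).
Local Notation msp := (measurableTypeR R * measurableTypeR R * measurableTypeR R)%type.
Implicit Types (x y xi : sp) (g p q w phi : sp -> R) (A : set sp).

Lemma indic01 A x : (\1_A x : R) = 0 \/ (\1_A x : R) = 1.
Proof. by rewrite indicE; case: (x \in A); [right|left]. Qed.

Lemma indic_norm_le1 A x : `|(\1_A x : R)| <= 1.
Proof. by case: (indic01 A x) => ->; rewrite ?normr0 ?normr1. Qed.

Lemma measurable_indic3 A : @measurable _ msp A -> measurable_fun setT (fun x => \1_A x : R).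
Proof. by move=> mA; exact (measurable_indic mA). Qed.

(** The Gaussian weight makes every indicator admissible, including that of the whole space, which
    stability under complements requires. *)
Lemma L12_gs_indic A : @measurable _ msp A -> L12 (fun x => \1_A x * gs 1 x : R).
Proof.
move=> mA; exact (@L12_bM R 1 _ _ (measurable_indic3 mA) (indic_norm_le1 A) (L12_gs ltr01)).
Qed.

Section Fixed.
Variables (f a b : sp -> R).
Hypothesis fab : ft f a b.
Local Notation good := (good f a b).

Lemma good_cvg_gs (u : nat -> sp -> R) (v : sp -> R) : (forall n, good (fun x => u n x * gs 1 x)) ->
  L12 (fun x => v x * gs 1 x) ->
  (forall n x, `|u n x - v x| <= 1) -> (forall x, u n x @[n --> \oo] --> v x) ->
  good (fun x => v x * gs 1 x).
Proof.
move=> gu hv uv ucv; apply: (good_lim fab gu hv).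
apply: (@L2cvg_dom _ _ _ mu (fun n x => u n x * gs 1 x) (fun x => v x * gs 1 x) (gs 1)).
- by move=> n; case: (gu n) => -[_ []].
- exact: L2_gs.
- by case: hv => _ [].
- by move=> n x; rewrite -mulrBl normrM (ger0_norm (gs_ge0 _ _)) ler_piMl// gs_ge0.
- by move=> x; apply: cvgMl; exact: ucv.
Qed.

Lemma continuous_fst1 : continuous (fun x => x.1.1).
Proof. by move=> x; apply: (@cvg_comp _ _ _ fst fst); [exact: cvg_fst|exact: cvg_fst]. Qed.

Lemma continuous_fst2 : continuous (fun x => x.1.2).
Proof. by move=> x; apply: (@cvg_comp _ _ _ fst snd); [exact: cvg_fst|exact: cvg_snd]. Qed.

Lemma continuous_snd3 : continuous (fun x => x.2).
Proof. by move=> x; exact: cvg_snd. Qed.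

Lemma continuous_gs3 (s : R) : continuous (gs s).
Proof.
move=> x; have -> : gs s = (fun x => expR (- (s * dp x x))) by [].
apply: (@continuous_cvg _ _ _ _ _ (fun x => - (s * dp x x)) expR); first exact: continuous_expR.
apply: cvgN; apply: cvgMr; apply: cvgD; first apply: cvgD; apply: cvgM;
  first [exact: continuous_fst1|exact: continuous_fst2|exact: continuous_snd3].
Qed.

(** Products of ramps in the three coordinates are continuous and tend pointwise to the
    indicator. *)
Lemma good_octant (c : sp) : good (fun x => \1_(octant c) x * gs 1 x).
Proof.
pose r (n : nat) (e t : R) := ramp (n%:R * (t - e)).
have r0 n e t : 0 <= r n e t by exact: ramp_ge0.
have r1 n e t : r n e t <= 1 by exact: ramp_le1.
have cr n e : continuous (r n e).
  move=> t; apply: (@continuous_cvg _ _ _ _ _ (fun t => n%:R * (t - e)) ramp); first exact: continuous_ramp.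
  by apply: cvgMr; apply: cvgB; [exact: cvg_id|exact: cvg_cst].
have mr n e : measurable_fun setT (r n e) by apply: continuous_measurable; exact: cr.
pose u n x := r n c.1.1 x.1.1 * r n c.1.2 x.1.2 * r n c.2 x.2.
have u0 n x : 0 <= u n x by rewrite !mulr_ge0.
have u1 n x : u n x <= 1 by rewrite mulr_ile1// ?mulr_ge0// mulr_ile1.
have indE x : \1_(octant c) x = ((c.1.1 < x.1.1)%R%:R * (c.1.2 < x.1.2)%R%:R * (c.2 < x.2)%R%:R : R).
  rewrite indicE; case: (boolP (x \in octant c)) => [|/negP h].
    by rewrite inE => -[-> -> ->]; rewrite !mulr1.
  case: (boolP (c.1.1 < x.1.1)) => h1; last by rewrite !mul0r.
  case: (boolP (c.1.2 < x.1.2)) => h2; last by rewrite mulr0 mul0r.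
  case: (boolP (c.2 < x.2)) => h3; last by rewrite mulr0.
  by exfalso; apply: h; rewrite inE; split.
have mu_ n : measurable_fun setT (u n).
  apply: measurable_funM; first apply: measurable_funM.
  - exact: (measurableT_comp (mr n c.1.1) measurable_p1).
  - exact: (measurableT_comp (mr n c.1.2) measurable_p2).
  - exact: (measurableT_comp (mr n c.2) measurable_p3).
have un n x : `|u n x| <= 1 by rewrite ger0_norm.
have uc x : u n x @[n --> \oo] --> (\1_(octant c) x : R).
  by rewrite indE; apply: cvgM; first apply: cvgM; exact: ramp_cvg.
have i0 x : 0 <= (\1_(octant c) x : R) by apply: (cvg_ge_const (uc x)) => n.
have i1 x : (\1_(octant c) x : R) <= 1 by apply: (cvg_le_const (uc x)) => n.
have hu n : L12 (fun x => u n x * gs 1 x) by exact (@L12_bM R 1 _ _ (mu_ n) (un n) (L12_gs ltr01)).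
apply: (good_cvg_gs (u := u)) => //.
- move=> n; apply: (good_continuous fab (M := 1) (hu n)).
    move=> x; apply: cvgM; last exact: continuous_gs3.
    apply: cvgM; first apply: cvgM.
    + by apply: (@continuous_cvg _ _ _ _ _ (fun x : sp => x.1.1) (r n c.1.1)); [exact: cr|exact: continuous_fst1].
    + by apply: (@continuous_cvg _ _ _ _ _ (fun x : sp => x.1.2) (r n c.1.2)); [exact: cr|exact: continuous_fst2].
    + by apply: (@continuous_cvg _ _ _ _ _ (fun x : sp => x.2) (r n c.2)); [exact: cr|exact: continuous_snd3].
  by move=> x; rewrite normrM mulr_ile1// ger0_norm ?gs_ge0// gs_le1.
- have mi : measurable_fun setT (fun x => \1_(octant c) x : R).
    exact (measurable_fun_cvg mu_ (fun x _ => uc x)).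
  by exact (@L12_bM R 1 _ _ mi (indic_norm_le1 (octant c)) (L12_gs ltr01)).
- move=> n x; have := u0 n x; have := u1 n x; have := i0 x; have := i1 x.
  by rewrite ler_norml; move: (u n x) (\1_(octant c) x) => s t; lra.
Qed.

(** Dynkin's pi-lambda theorem: the octants are stable under intersection and generate the
    measurable sets, and the sets with good weighted indicator form a Dynkin class. *)
Lemma good_indic A : @measurable _ msp A -> good (fun x => \1_A x * gs 1 x).
Proof.
move=> mA0.
pose H : set (set sp) := [set A | @measurable _ msp A /\ good (fun x => \1_A x * gs 1 x)].
suff HD : dynkin H.
  have : (<<s @octants R >> `<=` H)%classic.
    rewrite -(setI_closed_g_dynkin_g_sigma_algebra (@octants_setI R)); apply: smallest_sub => //.
    move=> _ [c _ <-]; split; last exact: good_octant.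
    have -> : octant c = [set x : sp | c.1.1 < x.1.1] `&` [set x : sp | c.1.2 < x.1.2] `&` [set x : sp | c.2 < x.2].
      by apply/seteqP; split => x /=; [move=> [h1 h2 h3]|move=> [[h1 h2] h3]].
    have M (pr : sp -> R) (e : R) : measurable_fun setT pr -> @measurable _ msp [set x | e < pr x].
      move=> mp; have := mp measurableT `]e, +oo[%classic (measurable_itv _).
      rewrite setTI; congr measurable.
      by apply/seteqP; split => x /=; rewrite in_itv/= andbT.
    apply: measurableI; first apply: measurableI.
    - exact: M measurable_p1.
    - exact: M measurable_p2.
    - exact: M measurable_p3.
  by move=> /(_ A (measurable_octants mA0)) [].
split.
- split; first exact: measurableT.
  apply: (@good_ext _ _ _ _ (gs 1)) => [x|]; first by rewrite indicE in_setT mul1r.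
  apply: (good_continuous fab (M := 1)) => [|x|x]; [exact: L12_gs|exact: continuous_gs3|].
  by rewrite ger0_norm ?gs_ge0// gs_le1.
- move=> B [mB gB]; split; first exact: measurableC.
  have gT : good (gs 1).
    apply: (good_continuous fab (M := 1)) => [|x|x]; [exact: L12_gs|exact: continuous_gs3|].
    by rewrite ger0_norm ?gs_ge0// gs_le1.
  apply: good_ext (goodD fab gT (goodZ fab (-1) gB)) => x.
  by rewrite !indicE in_setC; case: (x \in B) => /=; ring.
- move=> F tF HF; pose B n := \big[setU/set0]_(k < n) F k.
  have mF k : @measurable _ msp (F k) by case: (HF k).
  have mB n : @measurable _ msp (B n) by apply: bigsetU_measurable => k _.
  have gB n : good (fun x => \1_(B n) x * gs 1 x).
    elim: n => [|n IH].
      apply: (@good_ext _ _ _ _ (fun=> 0) _ _ (good0 f a b)) => x.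
      by rewrite /B big_ord0 indicE in_set0 mul0r.
    apply: good_ext (goodD fab IH (HF n).2) => x.
    rewrite -mulrDl; congr (_ * _); rewrite {2}/B big_ord_recr /= -/(B n) !indicE in_setU.
    case: (boolP (x \in F n)) => hF; last by rewrite orbF addr0.
    (* Disjointness of the family excludes a point common to [B n] and [F n], so their indicators
       add up. *)
    suff -> : x \in B n = false by rewrite add0r.
    apply/negP; rewrite inE /B -bigcup_mkord => -[k /= kn Fk].
    have := tF k n I I; rewrite inE in hF => /(_ (ex_intro _ x (conj Fk hF))) kE.
    by rewrite kE ltnn in kn.
  have mU : @measurable _ msp (\bigcup_k F k) by exact: bigcup_measurable.
  split=> //; apply: (good_cvg_gs gB (L12_gs_indic mU)).
    move=> n x; case: (indic01 (B n) x) => ->; case: (indic01 (\bigcup_k F k) x) => ->;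
      by rewrite ?subrr ?sub0r ?subr0 ?normrN ?normr0 ?normr1.
  move=> x; rewrite indicE; case: (boolP (x \in \bigcup_k F k)) => hx.
    rewrite inE in hx; case: hx => k _ Fk.
    apply: (@cvg_eventually _ _ (fun=> 1) k.+1); last exact: cvg_cst.
    move=> n kn; rewrite indicE mem_set// /B -bigcup_mkord; by exists k.
  apply: (@cvgR_ext _ _ (fun=> 0)); last exact: cvg_cst.
  move=> n; rewrite indicE memNset// /B -bigcup_mkord => -[k /= kn Fk].
  by move/negP: hx; apply; rewrite inE; exists k.
Qed.

(** The weight is divided out first: simple functions increasing to [phi / gs 1], multiplied by
    [gs 1], are combinations of weighted indicators and increase to [phi], which dominates the
    error. *)
Lemma good_ge0 phi : L12 phi -> (forall x, 0 <= phi x) -> good phi.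
Proof.
move=> hphi phi0; pose psi x := phi x / gs 1 x.
have mpsi : @measurable_fun _ _ msp _ setT (fun x => (psi x)%:E).
  apply/measurable_EFinP; apply: measurable_funM; first exact (L1_meas hphi.1).
  have -> : (fun x => (gs 1 x)^-1) = (fun x : sp => expR (1 * dp x x)).
    by apply/funext => x; rewrite /gs expRN invrK.
  apply: (measurableT_comp (@measurable_expR R)).
  by apply: measurable_funM => //; exact: measurable_dp.
have psi0 x : 0 <= psi x by rewrite divr_ge0 ?gs_ge0.
pose S n := nnsfun_approx (@measurableT _ msp) mpsi n; pose s n (x : sp) : R := S n x.
have sc x : s n x @[n --> \oo] --> psi x.
  have := cvg_nnsfun_approx (@measurableT _ msp) mpsi (fun x _ => psi0 x) (x := x) I.
  by move=> /fine_cvg.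
have s_le n x : s n x <= psi x.
  apply: (@cvg_ge_const _ (fun m => s (n + m)%N x)).
    by have := sc x; rewrite -(cvg_shiftn n); apply: cvg_trans; apply: near_eq_cvg; near=> m; rewrite addnC.
  move=> m; have /lefP := nd_nnsfun_approx (@measurableT _ msp) mpsi (leq_addr m n).
  exact.
have s0 n x : 0 <= s n x by rewrite /s; exact: fun_ge0.
have gsn n : good (fun x => s n x * gs 1 x).
  have -> : (fun x => s n x * gs 1 x) = (fun x => \sum_(y <- finmap.enum_fset (fset_set (range (s n))))
     (y * (\1_((s n) @^-1` [set y]) x * gs 1 x))).
    apply/funext => x; rewrite {1}/s fimfunE fsbig_finite//= mulr_suml.
    by apply: eq_bigr => y _; rewrite mulrA.
  move: (finmap.enum_fset _) => ys; elim: ys => [|y l IH].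
    by apply: good_ext (good0 f a b) => x; rewrite big_nil.
  have gy : good (fun x => \1_((s n) @^-1` [set y]) x * gs 1 x).
    by apply: good_indic; exact (measurable_sfunP (S n) (measurable_set1 y)).
  by apply: good_ext (goodD fab (goodZ fab y gy) IH) => x; rewrite big_cons.
apply: (good_lim fab gsn hphi).
have phiE x : phi x = psi x * gs 1 x by rewrite /psi divfK// gt_eqF// gs_gt0.
apply: (@L2cvg_dom _ _ _ mu (fun n x => s n x * gs 1 x) phi phi).
- by move=> n; case: (gsn n) => -[_ []].
- exact: hphi.2.
- exact: hphi.2.1.
- move=> n x; rewrite distrC ger0_norm; last first.
    by rewrite phiE -mulrBl mulr_ge0 ?gs_ge0// subr_ge0.
  by rewrite lerBlDr lerDl mulr_ge0 ?gs_ge0.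
- by move=> x; rewrite phiE; apply: cvgMl; exact: sc.
Unshelve. all: by end_near. Qed.

Lemma good_all phi : L12 phi -> good phi.
Proof.
move=> hphi; have [p1 [mp _]] := hphi.
have H (t : sp -> R) : measurable_fun setT t -> (forall x, `|t x| <= `|phi x|) -> L12 t.
  move=> mt tp; split; first exact: (@L1_le _ _ _ mu t _ mt (L1_norm p1) tp).
  exact: (@L2_le _ _ _ mu t _ mt hphi.2 tp).
have m0 : measurable_fun setT (fun x => Num.max (phi x) 0) by exact: (@measurable_maxr _ msp).
have m1 : measurable_fun setT (fun x => Num.max (- phi x) 0).
  by apply: (@measurable_maxr _ msp) => //; exact: measurableT_comp.
have g0 : good (fun x => Num.max (phi x) 0).
  apply: good_ge0 => [|x]; last by rewrite le_max lexx orbT.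
  apply: H => // x; rewrite ger0_norm ?le_max ?lexx ?orbT//.
  by rewrite ge_max ler_norm normr_ge0.
have g1 : good (fun x => Num.max (- phi x) 0).
  apply: good_ge0 => [|x]; last by rewrite le_max lexx orbT.
  apply: H => // x; rewrite ger0_norm ?le_max ?lexx ?orbT//.
  by rewrite ge_max -normrN ler_norm normr_ge0.
apply: good_ext (goodD fab g0 (goodZ fab (-1) g1)) => x.
case: (boolP (0 <= phi x)) => h.
  by rewrite max_l// max_r ?oppr_le0// mulr0 addr0.
rewrite -ltNge in h; rewrite max_r ?ltW// max_l ?oppr_ge0 ?ltW//; ring.
Qed.

(** Duality: the difference [h] is tested against its own damping [phi]. With [m] the damped energy,
    Parseval, Young and Bessel give [c3 m <= (D + c3 m) / 2], hence [m <= D / c3] uniformly in the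
    damping. *)
Lemma inversion p q : L12 p -> L12 q ->
  Int mu (fun x => (f x - c3^-1 * Rt p q x) ^+ 2) <=
  c3^-1 * Int mu (fun x => (a x - p x) ^+ 2 + (b x - q x) ^+ 2).
Proof.
move=> hp hq; have [Lf La Lb _] := fab.
pose h x := f x - c3^-1 * Rt p q x.
have Lr := L2_Rt hp hq.
have Lh : L2 mu h by exact: L2B Lf (L2Z _ Lr).
have Lap := L2B La hp.2; have Lbq := L2B Lb hq.2.
set D := Int mu (fun x => _ + _).
pose e (n : nat) : R := n.+1%:R^-1; have e0 n : 0 < e n by rewrite invr_gt0.
have c30 := @c3_gt0 R.
suff Hm n : Int mu (fun x => gs (e n) x * h x ^+ 2) <= c3^-1 * D.
  have [||| _ //] := @Int_fatou _ _ _ mu (fun n x => gs (e n) x * h x ^+ 2) (fun x => h x ^+ 2) (c3^-1 * D) _ _ _ Hm.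
  - move=> n; apply: L1_ext (L2_mul (L12_gs_mul (e0 n) Lh).2 Lh) => x.
    by rewrite expr2 mulrA.
  - by move=> n x; rewrite mulr_ge0 ?gs_ge0// sqr_ge0.
  - by move=> x; rewrite -[X in _ --> X]mul1r; apply: cvgMl; exact: gs_harmonic_cvg.
pose phi x := gs (e n) x * h x.
have hphi : L12 phi := L12_gs_mul (e0 n) Lh.
have LCp := L12_Ct hphi; have LSp := L12_St hphi.
have -> : Int mu (fun x => gs (e n) x * h x ^+ 2) = Int mu (fun x => phi x * h x).
  by apply: Int_ext => x; rewrite /phi -mulrA expr2.
set m := Int mu _.
have mE : m = c3^-1 * Int mu (fun x => (a x - p x) * Ct phi x - (b x - q x) * St phi x).
  have -> : m = Int mu (fun x => phi x * f x) - c3^-1 * Int mu (fun x => phi x * Rt p q x).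
    rewrite -(IntZ _ (L2_mul hphi.2 Lr)) -(IntB (L2_mul hphi.2 Lf) (L1Z _ (L2_mul hphi.2 Lr))).
    by apply: Int_ext => x; rewrite /h mulrBr mulrCA.
  rewrite (good_all hphi).2 (Int_Rt hphi.1 hp hq) -mulrBr; congr (_ * _).
  rewrite -IntB; last 2 first.
  - exact: L1B (L2_mul LCp La) (L2_mul LSp Lb).
  - exact: L1B (L2_mul hp.2 LCp) (L2_mul hq.2 LSp).
  by apply: Int_ext => x; ring.
have LCS := L1D LCp.2 LSp.2; have LD := L1D Lap.2 Lbq.2.
have h1 : Int mu (fun x => (a x - p x) * Ct phi x - (b x - q x) * St phi x) <=
   2^-1 * (D + Int mu (fun x => Ct phi x ^+ 2 + St phi x ^+ 2)).
  rewrite -(IntD LD LCS) -(IntZ _ (L1D LD LCS)).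
  apply: Int_le; [exact: L1B (L2_mul Lap LCp) (L2_mul Lbq LSp)|exact: L1Z (L1D LD LCS)|].
  move=> x; rewrite -subr_ge0; set u := a x - p x; set v := b x - q x; set y := Ct phi x; set z := St phi x.
  have -> : 2^-1 * (u ^+ 2 + v ^+ 2 + (y ^+ 2 + z ^+ 2)) - (u * y - v * z) = 2^-1 * ((u - y) ^+ 2 + (v + z) ^+ 2).
    by field.
  by rewrite mulr_ge0// addr_ge0// sqr_ge0.
have [_ _ h2] := bessel hphi.1 hphi.2.
(* As [gs <= 1], the energy of [phi] is bounded by [m] itself, which closes the estimate. *)
have h3 : Int mu (fun x => phi x ^+ 2) <= m.
  apply: Int_le; [exact: hphi.2.2|exact: L2_mul hphi.2 Lh|].
  move=> x; rewrite -subr_ge0 /phi; have G0 := gs_ge0 (e n) x.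
  have G1 : 0 <= 1 - gs (e n) x by rewrite subr_ge0 gs_le1// ltW.
  move: (gs _ _) (h x) G0 G1 => G t G0 G1.
  have -> : G * t * t - (G * t) ^+ 2 = G * (1 - G) * t ^+ 2 by ring.
  by apply: mulr_ge0; [exact: mulr_ge0|exact: sqr_ge0].
have h4 := ler_wpM2l (ltW c30) h3.
have mE' : c3 * m = Int mu (fun x => (a x - p x) * Ct phi x - (b x - q x) * St phi x).
  by rewrite mE mulrA mulfV ?mul1r// gt_eqF.
rewrite ler_pdivlMl//; lra.
Qed.

End Fixed.
End InversionBound.

(** * From library norms and [is_fourier2] to real integrals *)

Section NormBridge.
Context {R : realType}.
Local Notation sp := (R * R * R)%type.
Local Notation mu := (@leb3s R).

Lemma Lnorm2E (f : sp -> R) : L2 mu f ->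
  Lnorm mu 2%:E (fun x => (f x)%:E) = (Num.sqrt (Int mu (fun x => f x ^+ 2)))%:E.
Proof.
move=> [mf Lf]; rewrite unlock /=.
have -> : (\int[mu]_x (`|(f x)%:E| `^ 2%R))%E = (Int mu (fun x => f x ^+ 2))%:E.
  rewrite -(Int_EFin Lf); apply: eq_integral => x _ /=.
  by rewrite powR_mulrn// real_normK// num_real.
by rewrite /= -powR12_sqrt ?Int_ge0// => x; exact: sqr_ge0.
Qed.

Lemma Lfun_L2 (f : sp -> R) : f \in Lfun (leb3 R) 2%:E -> L2 mu f.
Proof.
move=> hf; split; last exact (Lfun2_integrable_sqr hf).
by have /sub_Lfun_mfun := hf; rewrite inE.
Qed.

Lemma Lfun_L1 (f : sp -> R) : f \in Lfun (leb3 R) 1%:E -> L1 mu f.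
Proof. by move=> /Lfun1_integrable. Qed.

Lemma L2_Lfun (f : sp -> R) : L2 mu f -> f \in Lfun (leb3 R) 2%:E.
Proof.
move=> Lf; rewrite inE; apply/andP; split; rewrite inE /=.
  exact Lf.1.
have := Lnorm2E Lf; rewrite /mu /finite_norm => H; move: (ltry (Num.sqrt (Int mu (fun x => f x ^+ 2)))).
by rewrite -H.
Qed.

Lemma cvg_Lnorm2 (u : nat -> sp -> R) : (forall n, L2 mu (u n)) ->
  Lnorm (leb3 R) 2%:E (fun x => (u n x)%:E) @[n --> \oo] --> 0%E ->
  Int mu (fun x => u n x ^+ 2) @[n --> \oo] --> (0 : R).
Proof.
move=> Lu H.
have H2 : Num.sqrt (Int mu (fun x => u n x ^+ 2)) @[n --> \oo] --> (0 : R).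
  have E : (fun n => Lnorm (leb3 R) 2%:E (fun x => (u n x)%:E)) =
      (fun n => (Num.sqrt (Int mu (fun x => u n x ^+ 2)))%:E).
    by apply/funext => n; exact (Lnorm2E (Lu n)).
  by move: H; rewrite E => /fine_cvg.
have H3 : Num.sqrt (Int mu (fun x => u n x ^+ 2)) * Num.sqrt (Int mu (fun x => u n x ^+ 2))
    @[n --> \oo] --> (0 * 0 : R) by exact: (cvgM H2 H2).
rewrite mulr0 in H3; apply: cvgR_ext H3 => n.
by rewrite -expr2 sqr_sqrtr// Int_ge0// => x; exact: sqr_ge0.
Qed.

(** The imaginary part of [fourier1] is [- St], whence the sign in [ft]; each component of the
    difference is dominated by the modulus [N n]. *)
Lemma is_fourier2_ft (f : sp -> R) (F : sp -> R[i]) : is_fourier2 f F ->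
  ft f (fun x => complex.Re (F x)) (fun x => complex.Im (F x)).
Proof.
move=> [/Lfun_L2 Lf /Lfun_L2 La /Lfun_L2 Lb [g [hg gf gF]]].
have {}hg n : L1 mu (g n) /\ L2 mu (g n) by have [/Lfun_L1 ? /Lfun_L2 ?] := hg n.
split=> //; exists g.
have Cg n : L2 mu (Ct (g n)) := L12_Ct (hg n); have Sg n : L2 mu (St (g n)) := L12_St (hg n).
have L2a n := L2B (Cg n) La; have L2b n := L2D (Sg n) Lb.
have gf' := cvg_Lnorm2 (fun n => L2B (hg n).2 Lf) gf.
pose N n x := Num.sqrt ((Ct (g n) x - complex.Re (F x)) ^+ 2 + (St (g n) x + complex.Im (F x)) ^+ 2).
have N2 n x : N n x ^+ 2 = (Ct (g n) x - complex.Re (F x)) ^+ 2 + (St (g n) x + complex.Im (F x)) ^+ 2.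
  by rewrite sqr_sqrtr// addr_ge0// sqr_ge0.
have LN n : L2 mu (N n).
  split; last by apply: L1_ext (L1D (L2a n).2 (L2b n).2) => x; rewrite N2.
  apply: (measurableT_comp (continuous_measurable (@sqrt_continuous R))).
  exact (L1_meas (L1D (L2a n).2 (L2b n).2)).
have NE n x : ComplexField.Normc.normc (fourier1 (g n) x - F x) = N n x.
  have -> : fourier1 (g n) x = Complex (Ct (g n) x) (- St (g n) x).
    have EC : (fun y => g n y * cos (dot (coords x) (coords y))) = (fun y => g n y * cos (dp x y)).
      by apply/funext => y; rewrite dotE.
    have ES : (fun y => g n y * sin (dot (coords x) (coords y))) = (fun y => g n y * sin (dp x y)).
      by apply/funext => y; rewrite dotE.
    by rewrite /fourier1 EC ES.
  rewrite /N; move: (Ct (g n) x) (St (g n) x) => A B; case: (F x) => s t /=.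
  by rewrite -opprD sqrrN.
have gF' : Int mu (fun x => N n x ^+ 2) @[n --> \oo] --> (0 : R).
  have E : (fun n => Lnorm (leb3 R) 2%:E (fun xi => (ComplexField.Normc.normc (fourier1 (g n) xi - F xi))%:E)) =
      (fun n => Lnorm (leb3 R) 2%:E (fun x => (N n x)%:E)).
    by apply/funext => n; apply: eq_Lnorm => x; rewrite NE.
  by apply: (cvg_Lnorm2 LN); rewrite -E.
split=> //.
- apply: (@cvg0_squeeze _ _ _ 1 _ gF') => n; rewrite mul1r Int_ge0//=; last by move=> x; exact: sqr_ge0.
  apply: Int_le; [exact: (L2a n).2|exact: (LN n).2|] => x.
  by rewrite N2 lerDl sqr_ge0.
- apply: (@cvg0_squeeze _ _ _ 1 _ gF') => n; rewrite mul1r Int_ge0//=; last by move=> x; exact: sqr_ge0.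
  apply: Int_le; [exact: (L2b n).2|exact: (LN n).2|] => x.
  by rewrite N2 lerDr sqr_ge0.
Qed.

Lemma L2norm_E (u : field3 R) : (forall i, L2 mu (fun x => u x 0 i)) ->
  L2norm u = (Num.sqrt (\sum_i Int mu (fun x => u x 0 i ^+ 2)))%:E.
Proof.
move=> Lu; rewrite /L2norm.
have dE x : dot (u x) (u x) = \sum_i u x 0 i ^+ 2 by apply: eq_bigr => i _; rewrite expr2.
have d0 x : 0 <= dot (u x) (u x) by rewrite dE sumr_ge0// => i _; exact: sqr_ge0.
have L : L1 mu (fun x => \sum_i u x 0 i ^+ 2) by apply: L1_sum => i; exact: (Lu i).2.
have LD : L1 mu (fun x => dot (u x) (u x)) by apply: L1_ext L => x; rewrite dE.
have LS : L2 mu (fun x => Num.sqrt (dot (u x) (u x))).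
  split; first exact: (measurableT_comp (continuous_measurable (@sqrt_continuous R)) (L1_meas LD)).
  by apply: L1_ext LD => x; rewrite sqr_sqrtr.
rewrite (Lnorm2E LS); congr (Num.sqrt _)%:E.
rewrite -Int_sum; last by move=> i; exact: (Lu i).2.
by apply: Int_ext => x; rewrite sqr_sqrtr// dE.
Qed.

End NormBridge.

(** * Differentiation of inverse transforms *)

Section Differentiation.
Context {R : realType}.
Local Notation sp := (R * R * R)%type.
Local Notation mu := (@leb3s R).
Implicit Types (x y xi : sp) (a b f g p q w : sp -> R) (i j : 'I_3).

Definition cd x i : R := coords x 0 i.

Lemma cdE x i : cd x i = nth 0 [:: x.1.1; x.1.2; x.2] i.
Proof. by rewrite /cd mxE. Qed.

Lemma ord3P (P : 'I_3 -> Prop) : P 0 -> P 1 -> P 2 -> forall i, P i.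
Proof.
move=> h0 h1 h2 [[|[|[|//]]] ik].
- by have -> : Ordinal ik = 0 by exact: val_inj.
- by have -> : Ordinal ik = 1 by exact: val_inj.
- by have -> : Ordinal ik = 2 by exact: val_inj.
Qed.

Lemma sum3E (V : nmodType) (F : 'I_3 -> V) : \sum_i F i = F 0 + F 1 + F 2.
Proof.
rewrite !big_ord_recl big_ord0 addr0 addrA; congr (F _ + F _ + F _); exact: val_inj.
Qed.

Lemma dp_sum x y : dp x y = \sum_i cd x i * cd y i.
Proof. by rewrite sum3E !cdE. Qed.

Lemma dp_basis i x : dp (basis3 i) x = cd x i.
Proof.
by rewrite cdE; move: i; apply: ord3P; rewrite /dp /basis3 /= ?mul1r ?mul0r ?addr0 ?add0r.
Qed.

Lemma dp_line (t : R) i x xi : dp (t *: basis3 i + x) xi = cd xi i * t + dp x xi.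
Proof.
rewrite dpDl; congr (_ + _); rewrite -dp_basis /dp /= /GRing.scale /=; ring.
Qed.

Lemma measurable_cd i : measurable_fun setT (fun x => cd x i).
Proof.
move: i; apply: ord3P.
- have -> : (fun x => cd x 0) = (fun x => x.1.1) by apply/funext => x; rewrite cdE.
  exact: measurable_p1.
- have -> : (fun x => cd x 1) = (fun x => x.1.2) by apply/funext => x; rewrite cdE.
  exact: measurable_p2.
- have -> : (fun x => cd x 2) = (fun x => x.2) by apply/funext => x; rewrite cdE.
  exact: measurable_p3.
Qed.

Lemma cd_sqr_le x i : cd x i ^+ 2 <= dp x x.
Proof.
rewrite cdE; move: i; apply: ord3P; rewrite /dp /= -!expr2.
- by rewrite -addrA lerDl addr_ge0 ?sqr_ge0.
- by rewrite addrAC lerDr addr_ge0 ?sqr_ge0.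
- by rewrite lerDr addr_ge0 ?sqr_ge0.
Qed.

(** A bound free of square roots: each coordinate costs one power of [1 + |xi|^2] in [rapid]. *)
Lemma cd_norm_le x i : `|cd x i| <= 1 + dp x x.
Proof.
have h := cd_sqr_le x i; have h2 := sqr_ge0 (`|cd x i| - 1); rewrite -(real_normK (num_real (cd x i))) in h.
move: (`|cd x i|) (dp x x) h h2 (normr_ge0 (cd x i)) => u d; nra.
Qed.

Lemma is_derive_Ct a i x : L1 mu a -> L1 mu (fun xi => cd xi i * a xi) ->
  is_derive x (basis3 i) (Ct a) (- St (fun xi => cd xi i * a xi) x).
Proof.
move=> La Lia; apply/is_derive_lineP.
have := @is_derive_Int _ _ _ mu (fun t xi => a xi * cos (cd xi i * t + dp x xi))
  (fun t xi => - (cd xi i * a xi * sin (cd xi i * t + dp x xi))) (fun xi => `|cd xi i * a xi|) _ _ (L1_norm Lia) _ 0.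
have -> : (fun t => Ct a (t *: basis3 i + x)) = (fun t => Int mu (fun xi => a xi * cos (cd xi i * t + dp x xi))).
  by apply/funext => t; apply: Int_ext => xi; rewrite dp_line.
have -> : - St (fun xi => cd xi i * a xi) x = Int mu (fun xi => - (cd xi i * a xi * sin (cd xi i * 0 + dp x xi))).
  by rewrite /St -(IntN (L1_sindp x Lia)); apply: Int_ext => xi; rewrite mulr0 add0r.
apply.
- move=> t xi; apply: (is_derive_eq (is_derive_scale (a xi) (is_derive_cosMD (cd xi i) (dp x xi) t))); ring.
- move=> t; apply: L1_ext (L1_cosdp (t *: basis3 i + x) La) => xi; by rewrite dp_line.
- by move=> t xi; rewrite normrN normrM ler_piMr// sin_norm_le1.
Qed.

Lemma is_derive_St a i x : L1 mu a -> L1 mu (fun xi => cd xi i * a xi) ->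
  is_derive x (basis3 i) (St a) (Ct (fun xi => cd xi i * a xi) x).
Proof.
move=> La Lia; apply/is_derive_lineP.
have := @is_derive_Int _ _ _ mu (fun t xi => a xi * sin (cd xi i * t + dp x xi))
  (fun t xi => cd xi i * a xi * cos (cd xi i * t + dp x xi)) (fun xi => `|cd xi i * a xi|) _ _ (L1_norm Lia) _ 0.
have -> : (fun t => St a (t *: basis3 i + x)) = (fun t => Int mu (fun xi => a xi * sin (cd xi i * t + dp x xi))).
  by apply/funext => t; apply: Int_ext => xi; rewrite dp_line.
have -> : Ct (fun xi => cd xi i * a xi) x = Int mu (fun xi => cd xi i * a xi * cos (cd xi i * 0 + dp x xi)).
  by apply: Int_ext => xi; rewrite mulr0 add0r.
apply.
- move=> t xi; apply: (is_derive_eq (is_derive_scale (a xi) (is_derive_sinMD (cd xi i) (dp x xi) t))); ring.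
- move=> t; apply: L1_ext (L1_sindp (t *: basis3 i + x) La) => xi; by rewrite dp_line.
- by move=> t xi; rewrite normrM ler_piMr// cos_norm_le1.
Qed.

(** Decay faster than any power, in the integrated sense. Multiplication by coordinates preserves
    it, so inverse transforms can be differentiated to any order. *)
Definition rapid a := forall n : nat, L12 (fun xi => (1 + dp xi xi) ^+ n * a xi).

Lemma rapid_L12 a : rapid a -> L12 a.
Proof. by move=> /(_ 0%N); apply: L12_ext => x; rewrite expr0 mul1r. Qed.

Lemma dp1_ge1 x : 1 <= 1 + dp x x.
Proof. by rewrite lerDl dp_ge0. Qed.

Lemma dp1_gt0 x : 0 < 1 + dp x x.
Proof. exact: lt_le_trans ltr01 (dp1_ge1 x). Qed.

Lemma measurable_dp1 n : measurable_fun setT (fun x => (1 + dp x x) ^+ n).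
Proof. by apply: measurable_funX; apply: measurable_funD => //; exact: measurable_dp. Qed.

Lemma rapid_bM c (k : nat) (h a : sp -> R) : measurable_fun setT h ->
  (forall x, `|h x| <= c * (1 + dp x x) ^+ k) -> rapid a -> rapid (fun x => h x * a x).
Proof.
move=> mh hc ra n.
have d0 x : 0 < (1 + dp x x) ^+ k by rewrite exprn_gt0// dp1_gt0.
have m : measurable_fun setT (fun x => h x / (1 + dp x x) ^+ k).
  (* The quotient is rewritten through [expR] and [ln], whose measurability is known. *)
  have -> : (fun x => h x / (1 + dp x x) ^+ k) = (fun x => h x * expR (- (k%:R * ln (1 + dp x x)))).
    apply/funext => x; congr (_ * _); rewrite expRN; congr (_^-1).
    by rewrite -{1}(lnK (dp1_gt0 x)) -expRM_natl.
  apply: measurable_funM => //; apply: (measurableT_comp (@measurable_expR R)).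
  apply: measurableT_comp => //; apply: measurable_funM => //.
  apply: (measurableT_comp (@measurable_ln R)); apply: measurable_funD => //; exact: measurable_dp.
have B x : `|h x / (1 + dp x x) ^+ k| <= c.
  by rewrite normrM normfV (ger0_norm (ltW (d0 x))) ler_pdivrMr.
apply: L12_ext (L12_bM m B (ra (n + k)%N)) => x.
by rewrite exprD; move: (d0 x); set u := _ ^+ k; set v := _ ^+ n => u0; field; rewrite gt_eqF.
Qed.

Lemma rapid_cd i a : rapid a -> rapid (fun x => cd x i * a x).
Proof.
move=> ra; apply: (rapid_bM (c := 1) (k := 1) (measurable_cd i)) => // x.
by rewrite mul1r expr1 cd_norm_le.
Qed.

Lemma rapidZ c a : rapid a -> rapid (fun x => c * a x).
Proof.
by move=> ra n; apply: L12_ext (L12Z c (ra n)) => x; rewrite mulrCA.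
Qed.

Lemma rapidN a : rapid a -> rapid (fun x => - a x).
Proof. by move=> ra n; apply: L12_ext (L12N (ra n)) => x; rewrite mulrN. Qed.

Lemma rapidD a b : rapid a -> rapid b -> rapid (fun x => a x + b x).
Proof. by move=> ra rb n; apply: L12_ext (L12D (ra n) (rb n)) => x; rewrite mulrDr. Qed.

Lemma rapidB a b : rapid a -> rapid b -> rapid (fun x => a x - b x).
Proof. by move=> ra rb n; apply: L12_ext (L12B (ra n) (rb n)) => x; rewrite mulrBr. Qed.

Lemma rapid_ext a b : a =1 b -> rapid a -> rapid b.
Proof. by move=> /funext ->. Qed.

Lemma gs_dominates (s : R) n : 0 < s ->
  exists2 C, 0 <= C & forall x, (1 + dp x x) ^+ n * gs s x <= C * gs (s / 2) x.
Proof.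
move=> s0; have s20 : 0 < s / 2 by rewrite divr_gt0.
have [C [C0 HC]] := exp_dominates n s20.
exists (C * expR (s / 2)); first by rewrite mulr_ge0 ?expR_ge0// ltW.
move=> x; have -> : gs s x = gs (s / 2) x * gs (s / 2) x by rewrite -gsD -splitr.
rewrite mulrA ler_wpM2r ?gs_ge0//.
have := HC (1 + dp x x) (ltW (dp1_gt0 x)).
have -> : expR (- (s / 2 * (1 + dp x x))) = gs (s / 2) x / expR (s / 2).
  by rewrite /gs -expRN -expRD; congr expR; ring.
by rewrite mulrA ler_pdivrMr ?expR_gt0.
Qed.

(** Half of the Gaussian absorbs the polynomial weight, the other half makes an [L2] function
    integrable. This is why the heat profiles are differentiable under the integral. *)
Lemma rapid_gs (s : R) f : 0 < s -> L2 mu f -> rapid (fun x => gs s x * f x).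
Proof.
move=> s0 Lf n; have [C C0 HC] := gs_dominates n s0; have s20 : 0 < s / 2 by rewrite divr_gt0.
have m : measurable_fun setT (fun x => (1 + dp x x) ^+ n * gs (s / 2) x).
  by apply: measurable_funM; [exact: measurable_dp1|exact: measurable_gs].
have B x : `|(1 + dp x x) ^+ n * gs (s / 2) x| <= C.
  rewrite ger0_norm; last by rewrite mulr_ge0 ?gs_ge0// exprn_ge0// ltW// dp1_gt0.
  rewrite -(ler_pM2r (gs_gt0 (s / 2) x)) -mulrA -gsD; apply: le_trans (HC x).
  by rewrite -splitr.
apply: L12_ext (L12_bM m B (L12_gs_mul s20 Lf)) => x.
have -> : gs s x = gs (s / 2) x * gs (s / 2) x by rewrite -gsD -splitr.
ring.
Qed.

Lemma is_derive_Rt a b i x : rapid a -> rapid b -> is_derive x (basis3 i) (Rt a b)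
  (Rt (fun xi => - (cd xi i * b xi)) (fun xi => cd xi i * a xi) x).
Proof.
move=> ra rb; have [La _] := rapid_L12 ra; have [Lb _] := rapid_L12 rb.
have [Lia _] := rapid_L12 (rapid_cd i ra); have [Lib _] := rapid_L12 (rapid_cd i rb).
apply: (is_derive_eq (is_derive_sub (is_derive_Ct x La Lia) (is_derive_St x Lb Lib))).
rewrite /Rt; have -> : Ct (fun xi => - (cd xi i * b xi)) x = - Ct (fun xi => cd xi i * b xi) x.
  by rewrite /Ct -(IntN (L1_cosdp x Lib)); apply: Int_ext => xi; rewrite mulNr.
by rewrite addrC.
Qed.

End Differentiation.

(** * Test functions *)

Section Bump.
Context {R : realType}.
Implicit Types (P : {poly R}) (t : R).

(** Carrying the polynomial makes the family closed under differentiation: [P] becomes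
    [X^2 (P - P')]. *)
Definition bump P t : R := if 0 < t then P.[t^-1] * expR (- t^-1) else 0.

Lemma poly_exp_bound P : forall n, exists2 C, 0 <= C &
  forall s : R, 0 <= s -> `|P.[s]| * s ^+ n * expR (- s) <= C.
Proof.
elim/poly_ind: P => [|P c IH] n.
  by exists 0 => // s s0; rewrite horner0 normr0 !mul0r.
have [C C0 HC] := IH n.+1; have [D [D0 HD]] := exp_dominates n (ltr01 : 0 < 1 :> R).
exists (C + `|c| * D); first by rewrite addr_ge0 ?mulr_ge0// ltW.
move=> s s0; rewrite hornerMXaddC.
have h : `|P.[s] * s + c| <= `|P.[s]| * s + `|c|.
  by rewrite (le_trans (ler_normD _ _))// normrM (ger0_norm s0).
have e0 : 0 <= s ^+ n * expR (- s) by rewrite mulr_ge0 ?expR_ge0// exprn_ge0.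
rewrite -mulrA; apply: (le_trans (ler_wpM2r e0 h)); rewrite mulrDl; apply: lerD.
  by rewrite -mulrA [s * _]mulrA -exprS mulrA; exact: HC.
by apply: ler_wpM2l => //; have := HD s s0; rewrite mul1r.
Qed.

Lemma bump_bounded P : exists2 C, 0 <= C & forall t, `|bump P t| <= C.
Proof.
have [C C0 HC] := poly_exp_bound P 0.
exists C => // t; rewrite /bump; case: ifP => t0; last by rewrite normr0.
rewrite normrM (ger0_norm (expR_ge0 _)).
by have := HC t^-1; rewrite expr0 mulr1; apply; rewrite invr_ge0 ltW.
Qed.

(** The extracted factor [t] gives the limit at 0 and, at that point, the difference quotient in
    Caratheodory's form. *)
Lemma bump_mulX P t : bump P t = bump (P * 'X) t * t.
Proof.
rewrite /bump; case: ifP => t0; last by rewrite mul0r.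
by rewrite hornerMX mulrAC mulfVK// gt_eqF.
Qed.

Lemma bump0 P : bump P 0 = 0.
Proof. by rewrite /bump ltxx. Qed.

Lemma bump_cvg0 P : bump P z @[z --> (0 : R)] --> (0 : R).
Proof.
have [C C0 HC] := bump_bounded (P * 'X).
apply/cvgr0Pnorm_le => e e0; near=> z.
rewrite bump_mulX normrM; apply: (le_trans (ler_wpM2r (normr_ge0 _) (HC z))).
have : `|z| <= e / (C + 1).
  near: z; apply/nbhs_ballP; exists (e / (C + 1)) => /=; first by rewrite divr_gt0// ltr_wpDl.
  by move=> z /=; rewrite /ball /= sub0r normrN => /ltW.
rewrite ler_pdivlMr ?ltr_wpDl// => h; apply: le_trans h.
by rewrite mulrC ler_wpM2l// lerDl.
Unshelve. all: by end_near. Qed.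

Lemma is_derive_bump P t : is_derive t (1 : R) (bump P) (bump ('X^2 * (P - P^`())) t).
Proof.
have [t0|t0|<-] := ltgtP 0 t.
- have D : is_derive t (1 : R) (fun u => P.[u^-1] * expR (- u^-1)) (bump ('X^2 * (P - P^`())) t).
    have Di : is_derive t (1 : R) (fun u : R => u^-1) (- t ^- 2).
      have tn : (id t : R) != 0 by rewrite gt_eqF.
      have H := @is_deriveV R id t 1 1 tn (is_derive_id t (1 : R)).
      by apply: (is_derive_eq H); rewrite /GRing.scale /= mulr1.
    apply: (is_derive_eq (is_derive_mul (is_derive_chain (is_derive_poly P t^-1) Di) (is_derive_exp (is_derive_opp Di)))).
    rewrite /bump t0 hornerM hornerXn hornerD hornerN -exprVn; ring.
  apply: near_eq_is_derive D; near=> u; rewrite /bump ifT//.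
  by near: u; exact: lt_nbhsr.
- have -> : bump ('X^2 * (P - P^`())) t = 0 by rewrite /bump ltNge (ltW t0).
  apply: (near_eq_is_derive _ (is_derive_const 0 t (1 : R))); near=> u.
  rewrite /bump ifF//; apply/negbTE; rewrite -leNgt; apply/ltW.
  by near: u; exact: lt_nbhsl.
- rewrite bump0; apply/is_derive1_caratheodory.
  exists (bump (P * 'X)); split; last exact: bump0.
  + by move=> z; rewrite bump0 !subr0; exact: bump_mulX.
  + have H : bump (P * 'X) z @[z --> (0 : R)] --> bump (P * 'X) 0 by rewrite bump0; exact: bump_cvg0.
    exact: H.
Unshelve. all: by end_near. Qed.

Lemma continuous_bump P : continuous (bump P).
Proof. exact: is_derive_continuous (is_derive_bump P). Qed.

Lemma lipschitz1 (f f' : R -> R) : (forall x, is_derive x (1 : R) f (f' x)) ->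
  (forall x, `|f' x| <= 1) -> forall u v, `|f u - f v| <= `|u - v|.
Proof.
move=> Df f1 u v; wlog uv : u v / v <= u.
  by move=> H; have [/H//|/ltW /H] := leP v u; rewrite distrC [`|v - u|]distrC.
have [c _ ->] := MVT_segment uv (fun x _ => Df x) (continuous_subspaceT (is_derive_continuous Df)).
by rewrite normrM ler_piMl.
Qed.

End Bump.

(** * A class of smooth functions closed under differentiation *)

Section SmoothClass.
Context {R : realType}.
Local Notation sp := (R * R * R)%type.
Local Notation mu := (@leb3s R).
Implicit Types (x y xi : sp) (a b f g p q w : sp -> R) (i j : 'I_3).

Lemma dp_norm_bound (h xi : sp) : `|dp h xi| <= (`|h.1.1| + `|h.1.2| + `|h.2|) * (1 + dp xi xi).
Proof.
rewrite {1}/dp !mulrDl.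
have B (u : R) i : `|u * cd xi i| <= `|u| * (1 + dp xi xi).
  by rewrite normrM ler_wpM2l// cd_norm_le.
have := B h.1.1 0; have := B h.1.2 1; have := B h.2 2; rewrite !cdE /= => b3 b2 b1.
apply: (le_trans (ler_normD _ _)); apply: lerD => //.
by apply: (le_trans (ler_normD _ _)); apply: lerD.
Qed.

Lemma cvg_norm1_sub x : (`|(y - x).1.1| + `|(y - x).1.2| + `|(y - x).2|) @[y --> x] --> (0 : R).
Proof.
have -> : (0 : R) = `|x.1.1 - x.1.1| + `|x.1.2 - x.1.2| + `|x.2 - x.2| by rewrite !subrr normr0 !addr0.
apply: cvgD; first apply: cvgD; apply: cvg_norm; apply: cvgB; try exact: cvg_cst.
- exact: continuous_fst1.
- exact: continuous_fst2.
- exact: continuous_snd3.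
Qed.

Lemma continuous_lip f K : (forall x y, `|f y - f x| <= (`|(y - x).1.1| + `|(y - x).1.2| + `|(y - x).2|) * K) ->
  continuous f.
Proof.
move=> H x; apply/cvgrPdist_le => e e0.
have HK : (`|(y - x).1.1| + `|(y - x).1.2| + `|(y - x).2|) * K @[y --> x] --> (0 : R).
  by rewrite -(mul0r K); apply: cvgMl; exact: cvg_norm1_sub.
move/cvgr0Pnorm_le : HK => /(_ e e0); apply: filterS => y hy.
by rewrite distrC (le_trans (H x y))// (le_trans (ler_norm _)).
Qed.

(** The bound on [h'] makes the transform Lipschitz, at the cost of one weight [1 + |xi|^2] under
    the integral. *)
Lemma continuous_trig_transform a (h h' : R -> R) : rapid a ->
  (forall t, is_derive t (1 : R) h (h' t)) -> (forall t, `|h' t| <= 1) ->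
  (forall x, L1 mu (fun xi => a xi * h (dp x xi))) ->
  continuous (fun x => Int mu (fun xi => a xi * h (dp x xi))).
Proof.
move=> ra Dh h1 Lh; have [La _] := ra 1%N.
apply: (continuous_lip (K := Int mu (fun xi => `|(1 + dp xi xi) ^+ 1 * a xi|))) => x y.
rewrite -(IntB (Lh y) (Lh x)); apply: (le_trans (Int_norm (L1B (Lh y) (Lh x)))).
rewrite -(IntZ _ (L1_norm La)); apply: Int_le; [exact: L1_norm (L1B (Lh y) (Lh x))|exact: L1Z (L1_norm La)|].
move=> xi; rewrite -mulrBr !normrM expr1 mulrC mulrA; apply: ler_wpM2r => //.
apply: (le_trans (lipschitz1 Dh h1 _ _)); rewrite -dpBl (ger0_norm (ltW (dp1_gt0 xi))).
exact: dp_norm_bound.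
Qed.

Lemma continuous_Rt a b : rapid a -> rapid b -> continuous (Rt a b).
Proof.
move=> ra rb x; have [La _] := rapid_L12 ra; have [Lb _] := rapid_L12 rb.
apply: cvgB.
  apply: (continuous_trig_transform ra (@is_derive_cos R)) => [t|y]; last exact: L1_cosdp.
  by rewrite normrN sin_norm_le1.
apply: (continuous_trig_transform rb (@is_derive_sin R)) => [t|y]; last exact: L1_sindp.
exact: cos_norm_le1.
Qed.

(** A syntactic class stable under partial derivatives: smoothness to all orders then follows by
    induction from first derivatives alone. *)
Inductive sm : (sp -> R) -> Prop :=
| sm_Rt a b of rapid a & rapid b : sm (Rt a b)
| sm_bump P c : sm (fun x => bump P (1 - c * dp x x))
| sm_coord i : sm (fun x => cd x i)
| sm_const c : sm (fun=> c)
| sm_mul f g of sm f & sm g : sm (fun x => f x * g x)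
| sm_add f g of sm f & sm g : sm (fun x => f x + g x).

Lemma continuous_cd i : continuous (fun x => cd x i).
Proof.
move: i; apply: ord3P.
- have -> : (fun x => cd x 0) = (fun x => x.1.1) by apply/funext => x; rewrite cdE.
  exact: continuous_fst1.
- have -> : (fun x => cd x 1) = (fun x => x.1.2) by apply/funext => x; rewrite cdE.
  exact: continuous_fst2.
- have -> : (fun x => cd x 2) = (fun x => x.2) by apply/funext => x; rewrite cdE.
  exact: continuous_snd3.
Qed.

Lemma continuous_dp : continuous (fun x => dp x x).
Proof.
move=> x; apply: cvgD; first apply: cvgD; apply: cvgM;
  first [exact: continuous_fst1|exact: continuous_fst2|exact: continuous_snd3].
Qed.

Lemma sm_continuous f : sm f -> continuous f.
Proof.
elim=> [a b ra rb|P c|i|c|g h _ cg _ ch|g h _ cg _ ch].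
- exact: continuous_Rt.
- move=> x; apply: (@continuous_cvg _ _ _ _ _ (fun x => 1 - c * dp x x) (bump P)); first exact: continuous_bump.
  by apply: cvgB; [exact: cvg_cst|apply: cvgMr; exact: continuous_dp].
- exact: continuous_cd.
- by move=> x; exact: cvg_cst.
- by move=> x; apply: cvgM; [exact: cg|exact: ch].
- by move=> x; apply: cvgD; [exact: cg|exact: ch].
Qed.

Lemma is_derive_cd i j x : is_derive x (basis3 i) (fun x => cd x j) ((i == j)%:R).
Proof.
apply/is_derive_lineP.
have -> : (fun t => cd (t *: basis3 i + x) j) = (fun t : R => (i == j)%:R * t + cd x j).
  apply/funext => t; rewrite -!(dp_basis j) [dp _ (_ + _)]dpC dp_line [dp x _]dpC; congr (_ * _ + _).
  by rewrite cdE; move: j i; apply: ord3P; apply: ord3P.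
apply: (is_derive_eq (is_derive_add (is_derive_scale _ (is_derive_id (0 : R) (1 : R))) (is_derive_const (cd x j) (0:R) (1:R)))).
by rewrite mulr1 addr0.
Qed.

Lemma is_derive_dp i x : is_derive x (basis3 i) (fun x => dp x x) (2 * cd x i).
Proof.
have -> : (fun x => dp x x) = (fun x => cd x 0 * cd x 0 + cd x 1 * cd x 1 + cd x 2 * cd x 2).
  by apply/funext => y; rewrite dp_sum sum3E.
have D j := is_derive_mul (is_derive_cd i j x) (is_derive_cd i j x).
apply: (is_derive_eq (is_derive_add (is_derive_add (D 0) (D 1)) (D 2))).
move: i D; apply: ord3P => _ /=; rewrite /= ?eqxx /=; ring.
Qed.

Lemma is_derive_bump_dp P c i x : is_derive x (basis3 i) (fun x => bump P (1 - c * dp x x))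
  (bump ('X^2 * (P - P^`())) (1 - c * dp x x) * (- (2 * c) * cd x i)).
Proof.
apply: (is_derive_eq (is_derive_chain (is_derive_bump P _)
  (is_derive_sub (is_derive_const 1 x _) (is_derive_scale c (is_derive_dp i x))))).
by congr (_ * _); ring.
Qed.

Lemma sm_is_derive f : sm f -> forall i, exists2 g, sm g & forall x, is_derive x (basis3 i) f (g x).
Proof.
elim=> [a b ra rb|P c|j|c|g h sg Hg sh Hh|g h sg Hg sh Hh] i.
- exists (Rt (fun xi => - (cd xi i * b xi)) (fun xi => cd xi i * a xi)).
    by apply: sm_Rt; [apply: rapidN|]; exact: rapid_cd.
  by move=> x; exact: is_derive_Rt.
- eexists; last by move=> x; exact: is_derive_bump_dp.
  by apply: sm_mul; [exact: sm_bump|apply: sm_mul; [exact: sm_const|exact: sm_coord]].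
- by eexists; last (by move=> x; exact: is_derive_cd); exact: sm_const.
- by eexists; last (by move=> x; exact: is_derive_const); exact: sm_const.
- have [g' sg' Dg] := Hg i; have [h' sh' Dh] := Hh i.
  exists (fun x => g' x * h x + g x * h' x); first by apply: sm_add; apply: sm_mul.
  by move=> x; exact: is_derive_mul.
- have [g' sg' Dg] := Hg i; have [h' sh' Dh] := Hh i.
  exists (fun x => g' x + h' x); first exact: sm_add.
  by move=> x; exact: is_derive_add.
Qed.

Lemma sm_smooth f : sm f -> smooth f.
Proof.
move=> sf s; have H : sm (foldr partial f s).
  elim: s => [//|i s IH] /=; have [g sg Dg] := sm_is_derive IH i.
  by have -> : partial i (foldr partial f s) = g by apply/funext => x; exact: is_derive_E (Dg x).
split; first exact: sm_continuous.
by move=> i x; have [g sg Dg] := sm_is_derive H i; case: (Dg x).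
Qed.

Lemma bounded_support_compact f M : (forall x, f x != 0 -> dp x x <= M) ->
  compact (closure [set x | f x != 0]).
Proof.
move=> H; pose N := 1 + M.
pose B : set sp := (`[- N, N]%classic `*` `[- N, N]%classic) `*` `[- N, N]%classic.
have cB : compact B by apply: compact_setX; [apply: compact_setX|]; exact: segment_compact.
have clB : closed B by apply: compact_closed => //; exact: norm_hausdorff.
apply: (subclosed_compact _ cB); first exact: closed_closure.
rewrite (closure_id B).1//; apply: closure_subset => x /= fx.
have I i : cd x i \in `[- N, N].
  by rewrite in_itv/= -ler_norml (le_trans (cd_norm_le x i))// lerD2l H.
by split; first split => /=; [have := I 0|have := I 1|have := I 2]; rewrite cdE.
Qed.

End SmoothClass.

(** * Solenoidal fields *)

Section DivFree.
Context {R : realType}.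
Local Notation sp := (R * R * R)%type.
Local Notation mu := (@leb3s R).
Implicit Types (x y xi : sp) (a b f g p q w : sp -> R) (i j : 'I_3).

(* A gradient with merely square-integrable, non compactly supported potential is an admissible
   test field, by cutting off with [bump 1 (1 - |x|^2 / (n+1)^2)]. *)
Lemma div_free_Rt (v : field3 R) a b : (forall i, L2 mu (fun x => v x 0 i)) -> weakly_div_free v ->
  rapid a -> rapid b ->
  Int mu (fun x => \sum_i v x 0 i * Rt (fun xi => - (cd xi i * b xi)) (fun xi => cd xi i * a xi) x) = 0.
Proof.
move=> Lv divv ra rb; pose g := Rt a b.
pose dg i := Rt (fun xi => - (cd xi i * b xi)) (fun xi => cd xi i * a xi).
have Lg : L2 mu g := L2_Rt (rapid_L12 ra) (rapid_L12 rb).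
have Ldg i : L2 mu (dg i) := L2_Rt (rapid_L12 (rapidN (rapid_cd i rb))) (rapid_L12 (rapid_cd i ra)).
pose e (n : nat) : R := n.+1%:R^-1.
have e0 n : 0 < e n by rewrite invr_gt0.
have e1 n : e n <= 1 by rewrite invf_le1// ler1n.
pose Q : {poly R} := 'X^2 * (1 - 1^`()).
have [C C0 HC] := bump_bounded Q; have [D D0 HD] := bump_bounded (1 : {poly R}).
pose phi n x := bump 1 (1 - e n * dp x x).
pose dphi n i x := bump Q (1 - e n * dp x x) * (- (2 * e n) * cd x i).
(* Where the cutoff is nonzero, [e n |x|^2 <= 1]; with [e n <= 1] this gives [e n |x_i| <= 1], so
   its gradient is bounded uniformly in [n]. *)
have dphiB n i x : `|dphi n i x| <= 2 * C.
  rewrite /dphi /bump; case: ifP => h; last by rewrite mul0r normr0 mulr_ge0.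
  have := HC (1 - e n * dp x x); rewrite /bump h => H.
  rewrite normrM [2 * C]mulrC; apply: ler_pM => //.
  rewrite normrM normrN normrM (ger0_norm (ltW (e0 n))) (ger0_norm (ler0n R 2)) -mulrA.
  rewrite -[leRHS]mulr1 ler_pM2l//.
  have h2 : e n * dp x x <= 1 by apply/ltW; rewrite -subr_gt0.
  have h3 : e n * cd x i ^+ 2 <= 1.
    by apply: le_trans h2; rewrite ler_pM2l// cd_sqr_le.
  have : (e n * `|cd x i|) ^+ 2 <= 1.
    rewrite exprMn real_normK ?num_real// expr2 -mulrA mulr_ile1//; first exact: ltW.
    by rewrite mulr_ge0 ?sqr_ge0// ltW.
  by rewrite expr_le1// mulr_ge0// ltW.
have E n : Int mu (fun x => \sum_i v x 0 i * (dphi n i x * g x + phi n x * dg i x)) = 0.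
  have sf : sm (fun x => phi n x * g x) by apply: sm_mul; [exact: sm_bump|exact: sm_Rt].
  have tf : test_function (fun x => phi n x * g x).
    split; first exact: sm_smooth.
    apply: (@bounded_support_compact _ _ (e n)^-1) => x.
    rewrite mulf_eq0 negb_or => /andP[+ _]; rewrite /phi /bump.
    case: ifP => [h _|_]; last by rewrite eqxx.
    by rewrite -[leRHS]mulr1 ler_pdivlMl//; apply/ltW; rewrite -subr_gt0.
  rewrite -[RHS](divv _ tf); apply: Int_ext => x; apply: eq_bigr => i _; congr (_ * _).
  apply/esym; apply: is_derive_E; apply: is_derive_mul; first exact: is_derive_bump_dp.
  exact: is_derive_Rt.
have Lvg i : L1 mu (fun x => v x 0 i * g x) := L2_mul (Lv i) Lg.
have Lvd i : L1 mu (fun x => v x 0 i * dg i x) := L2_mul (Lv i) (Ldg i).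
have ecv x : e n * dp x x @[n --> \oo] --> (0 : R).
  by rewrite -(mul0r (dp x x)); apply: cvgMl; exact: inv_succ_cvg0.
have argcv x : (1 - e n * dp x x) @[n --> \oo] --> (1 : R).
  by rewrite -[X in _ --> X]subr0; apply: cvgB; [exact: cvg_cst|exact: ecv].
have phicv x : phi n x @[n --> \oo] --> bump 1 (1 : R).
  by apply: (@continuous_cvg _ _ _ _ _ (fun n => 1 - e n * dp x x) (bump 1)) => //; exact: continuous_bump.
have dphicv i x : dphi n i x @[n --> \oo] --> (0 : R).
  have -> : (0 : R) = bump Q 1 * (- (2 * 0) * cd x i) by rewrite mulr0 oppr0 mul0r mulr0.
  apply: cvgM.
    by apply: (@continuous_cvg _ _ _ _ _ (fun n => 1 - e n * dp x x) (bump Q)) => //; exact: continuous_bump.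
  by apply: cvgMl; apply: cvgN; apply: cvgMr; exact: inv_succ_cvg0.
have mb (P : {poly R}) n : measurable_fun setT (fun x : sp => bump P (1 - e n * dp x x)).
  apply: (measurableT_comp (continuous_measurable (@continuous_bump R P))).
  by apply: measurable_funB => //; apply: measurable_funM => //; exact: measurable_dp.
pose G x := \sum_i (2 * C * `|v x 0 i * g x| + D * `|v x 0 i * dg i x|).
have LG : L1 mu G.
  by apply: L1_sum => i; exact: L1D (L1Z _ (L1_norm (Lvg i))) (L1Z _ (L1_norm (Lvd i))).
pose L x := \sum_i v x 0 i * (0 * g x + bump 1 1 * dg i x).
have [||| _ HI] := @Int_dom _ _ _ mu (fun n x => \sum_i v x 0 i * (dphi n i x * g x + phi n x * dg i x)) L G _ LG.
- move=> n; apply: (@measurable_sum _ _ _ _ _ _ (fun i x => v x 0 i * (dphi n i x * g x + phi n x * dg i x))) => i.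
  apply: measurable_funM; first by case: (Lv i).
  apply: measurable_funD; apply: measurable_funM; try by [case: Lg|case: (Ldg i)|exact: mb].
  by apply: measurable_funM; [exact: mb|apply: measurable_funM => //; exact: measurable_cd].
- move=> n x; apply: (le_trans (ler_norm_sum _ _ _)); apply: ler_sum => i _.
  rewrite mulrDr; apply: (le_trans (ler_normD _ _)); apply: lerD.
    by rewrite mulrCA normrM; apply: ler_wpM2r => //; exact: dphiB.
  by rewrite mulrCA normrM; apply: ler_wpM2r => //; exact: HD.
- move=> x; rewrite /L sum3E.
  have T i : v x 0 i * (dphi n i x * g x + phi n x * dg i x) @[n --> \oo] -->
      v x 0 i * (0 * g x + bump 1 1 * dg i x).
    apply: cvgMr; apply: cvgD; apply: cvgMl; [exact: dphicv|exact: phicv].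
  by apply: (cvgR_ext (fun n => sum3E _)); apply: cvgD; [apply: cvgD|]; exact: T.
(* The cutoff tends to [bump 1 1 = exp (- 1)] rather than to 1; the limit identity carries this
   nonzero factor, which is divided out. *)
have b1 : bump 1 (1 : R) != 0.
  by rewrite /bump ltr01 hornerC mul1r gt_eqF// expR_gt0.
have LE : L1 mu (fun x => \sum_i v x 0 i * dg i x) by apply: L1_sum.
have : bump 1 1 * Int mu (fun x => \sum_i v x 0 i * dg i x) = 0.
  rewrite -(IntZ _ LE).
  have -> : (fun x => bump 1 1 * (\sum_i v x 0 i * dg i x)) = L.
    apply/funext => x; rewrite /L mulr_sumr; apply: eq_bigr => i _.
    by rewrite mul0r add0r mulrCA.
  by apply: (cvgR_unique HI); apply: (cvgR_ext E); exact: cvg_cst.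
by move/eqP; rewrite mulf_eq0 (negbTE b1) /= => /eqP.
Qed.

(* A continuous function is the pointwise limit of its values on the grids [Z^3 / (n+1)]. *)
Lemma continuous_measurable3 f : continuous f -> measurable_fun setT f.
Proof.
move=> cf.
pose N (n : nat) : R := n.+1%:R; have N0 n : 0 < N n by rewrite ltr0n.
pose fl n (t : R) : int := Num.floor (N n * t).
pose gr n x : int * int * int := (fl n x.1.1, fl n x.1.2, fl n x.2).
pose pt n (k : int * int * int) : sp := (k.1.1%:~R / N n, k.1.2%:~R / N n, k.2%:~R / N n).
have mfl n (pr : sp -> R) (k : int) : measurable_fun setT pr -> measurable [set x : sp | fl n (pr x) = k].
  move=> mp; have mq : measurable_fun setT (fun x => N n * pr x) by apply: measurable_funM.
  have := mq measurableT `[k%:~R, (k + 1)%:~R[%classic (measurable_itv _).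
  rewrite setTI; congr measurable.
  apply/seteqP; split => x /=; rewrite in_itv/= /fl.
    by move=> /floor_def.
  by move=> <-; rewrite floor_le_tmp floorD1_gt.
have mg n : measurable_fun setT (fun x => f (pt n (gr n x))).
  move=> _ Y mY; rewrite setTI.
  (* [gr n] takes values in the countable type of integer triples, so the preimage is a countable
     union of grid boxes and empty sets. *)
  have -> : (fun x => f (pt n (gr n x))) @^-1` Y =
     \bigcup_(m : nat) [set x | exists2 k, unpickle m = Some k & f (pt n k) \in Y /\ gr n x = k].
    apply/seteqP; split => x /=.
      move=> H; exists (pickle (gr n x)) => //=; exists (gr n x); first exact: pickleK.
      by split=> //; exact: mem_set.
    by move=> [m _ /= [k _ [/set_mem H ->]]].
  apply: bigcup_measurable => m _; case mk : (unpickle m) => [k|]; last first.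
    by rewrite (_ : mkset _ = set0)//; apply/seteqP; split => x //= -[].
  have [h|h] := boolP (f (pt n k) \in Y); last first.
    rewrite (_ : mkset _ = set0)//; apply/seteqP; split => x //= -[k' [<-] [h' _]].
    by rewrite h' in h.
  rewrite (_ : mkset _ = [set x : sp | fl n x.1.1 = k.1.1] `&` [set x : sp | fl n x.1.2 = k.1.2] `&`
     [set x : sp | fl n x.2 = k.2]).
    by apply: measurableI; [apply: measurableI|]; apply: mfl;
       [exact: measurable_p1|exact: measurable_p2|exact: measurable_p3].
  apply/seteqP; split => x /=.
    by move=> [k' [kk] [_ gk]]; have -> : k = gr n x by rewrite gk kk.
  move=> [[h1 h2] h3]; exists k => //; split => //.
  by rewrite /gr h1 h2 h3; case: k {mk h h1 h2 h3} => [[]].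
have Bd n (t : R) : `|t - (fl n t)%:~R / N n| <= (N n)^-1.
  have h1 : (fl n t)%:~R <= N n * t by exact: floor_le_tmp.
  have h2 : N n * t < (fl n t + 1)%:~R by exact: floorD1_gt.
  rewrite intrD in h2.
  have -> : t - (fl n t)%:~R / N n = (N n * t - (fl n t)%:~R) / N n by field; rewrite gt_eqF.
  rewrite normrM normfV (ger0_norm (ltW (N0 n))) ler_pdivrMr// mulVf ?gt_eqF//.
  by rewrite ger0_norm ?subr_ge0// lerBlDl ltW.
have cvt (t : R) : (fl n t)%:~R / N n @[n --> \oo] --> t.
  apply/cvgrPdist_le => e e0.
  have := @inv_succ_cvg0 R; move/cvgr0Pnorm_le => /(_ e e0); apply: filterS => n hn.
  by apply: (le_trans (Bd n t)); apply: le_trans hn; rewrite ler_norm.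
apply: (measurable_fun_cvg mg) => x _.
apply: (@continuous_cvg _ _ _ _ _ (fun n => pt n (gr n x)) f); first exact: cf.
case: x => -[x1 x2] x3.
have C12 : ((fl n x1)%:~R / N n, (fl n x2)%:~R / N n) @[n --> \oo] --> ((x1, x2) : R * R).
  exact (cvg_pair (cvt x1) (cvt x2)).
exact (cvg_pair C12 (cvt x3)).
Qed.

End DivFree.

Lemma cvg0_norm (R : realType) (u : nat -> R) : `|u n| @[n --> \oo] --> (0 : R) -> u n @[n --> \oo] --> (0 : R).
Proof.
move=> H; apply/cvgr0Pnorm_le => e e0; move/cvgr0Pnorm_le : H => /(_ e e0).
by apply: filterS => n; rewrite normr_id.
Qed.

Lemma line0 (R : realType) (t a b c : R) : t *: basis3 0 + (a, b, c) = (t + a, b, c).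
Proof.
have -> : t *: basis3 0 + (a, b, c) = (t * 1 + a, t * 0 + b, t * 0 + c) by [].
by rewrite mulr1 mulr0 !add0r.
Qed.

Lemma line1 (R : realType) (t a b c : R) : t *: basis3 1 + (a, b, c) = (a, t + b, c).
Proof.
have -> : t *: basis3 1 + (a, b, c) = (t * 0 + a, t * 1 + b, t * 0 + c) by [].
by rewrite mulr1 mulr0 !add0r.
Qed.

Lemma line2 (R : realType) (t a b c : R) : t *: basis3 2 + (a, b, c) = (a, b, t + c).
Proof.
have -> : t *: basis3 2 + (a, b, c) = (t * 0 + a, t * 0 + b, t * 1 + c) by [].
by rewrite mulr1 mulr0 !add0r.
Qed.

(** * Transforms of compactly supported test functions *)

Section TestFunctions.
Context {R : realType}.
Local Notation sp := (R * R * R)%type.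
Local Notation mu := (@leb3s R).
Local Notation leb := (@lebesgue_measure R).
Implicit Types (x y xi : sp) (a b f g p q w : sp -> R) (i j : 'I_3).

Lemma bounded_on_compact (K : set sp) (h : sp -> R) : continuous h -> compact K ->
  exists2 M, 0 <= M & forall x, K x -> `|h x| <= M.
Proof.
move=> ch cK.
have : compact (h @` K) by apply: continuous_compact => //; exact: continuous_subspaceT.
move=> /compact_bounded [M [_ HM]].
exists (`|M| + 1); first by rewrite addr_ge0.
move=> x Kx; apply: HM; last by exists x.
by rewrite (le_lt_trans (ler_norm _))// ltrDl.
Qed.

(** Compact support is weakened to a Gaussian bound, which survives multiplication by plane waves
    and restriction to lines and suits Fubini. *)
Lemma test_function_bound f : test_function f -> exists M, forall x,
  `|f x| <= M * gs 1 x /\ forall i, `|partial i f x| <= M * gs 1 x.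
Proof.
move=> [sf cK]; set K := closure _ in cK.
have cf : continuous f := (sf [::]).1.
have cpf i : continuous (partial i f) := (sf [:: i]).1.
have [D D0 HD] := bounded_on_compact continuous_dp cK.
(* Off the closed support the function vanishes in a neighbourhood, hence so do its partial
   derivatives. *)
have out x : ~ K x -> f x = 0 /\ forall i, partial i f x = 0.
  move=> nK; have : nbhs x (~` K) by apply: open_nbhs_nbhs; split=> //; apply: closed_openC; exact: closed_closure.
  move=> nx; have near0 : \forall y \near x, (cst 0 : sp -> R) y = f y.
    apply: filterS nx => y nKy; apply/esym/eqP; apply: contra_notT nKy => fy.
    exact: subset_closure.
  split; first by rewrite -(nbhs_singleton near0).
  by move=> i; apply: is_derive_E; apply: near_eq_is_derive near0 _; exact: is_derive_const.
have B (h : sp -> R) : continuous h -> (forall x, ~ K x -> h x = 0) -> exists2 M, 0 <= M & forall x, `|h x| <= M * gs 1 x.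
  move=> ch h0; have [M M0 HM] := bounded_on_compact ch cK.
  exists (M * expR D); first by rewrite mulr_ge0 ?expR_ge0.
  move=> x; case: (pselect (K x)) => Kx; last first.
    by rewrite h0// normr0 !mulr_ge0 ?expR_ge0.
  apply: (le_trans (HM x Kx)); rewrite -mulrA -[leLHS]mulr1 ler_wpM2l//.
  rewrite /gs -expRD mul1r -[leLHS]expR0 ler_expR subr_ge0.
  by have := HD x Kx; rewrite ger0_norm ?dp_ge0.
have [M0 h0 H0] := B f cf (fun x nK => (out x nK).1).
have [M1 h1 H1] := B _ (cpf 0) (fun x nK => (out x nK).2 0).
have [M2 h2 H2] := B _ (cpf 1) (fun x nK => (out x nK).2 1).
have [M3 h3 H3] := B _ (cpf 2) (fun x nK => (out x nK).2 2).
have W (u t : R) x : u <= t * gs 1 x -> t <= M0 + M1 + M2 + M3 -> u <= (M0 + M1 + M2 + M3) * gs 1 x.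
  by move=> ut tM; apply: (le_trans ut); rewrite ler_wpM2r ?gs_ge0.
exists (M0 + M1 + M2 + M3) => x; split; first by apply: (W _ _ _ (H0 x)); lra.
by apply: ord3P; [apply: (W _ _ _ (H1 x))|apply: (W _ _ _ (H2 x))|apply: (W _ _ _ (H3 x))]; lra.
Qed.

Lemma is_derive_along f df v y : (forall x, is_derive x v f (df x)) ->
  forall t : R, is_derive t (1 : R) (fun t : R => f (t *: v + y)) (df (t *: v + y)).
Proof.
move=> Df t; apply/is_derive_lineP.
have /is_derive_lineP := Df (t *: v + y).
have -> : (fun s : R => f (s *: v + (t *: v + y))) = (fun s : R => f ((s *: (1 : R) + t) *: v + y)).
  by apply/funext => s; rewrite addrA -scalerDl /GRing.scale /= mulr1.
by [].
Qed.

Lemma gs_line_le i y (t : R) : cd y i = 0 -> gs 1 (t *: basis3 i + y) <= expR (- (1 * t ^+ 2)).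
Proof.
move=> y0; rewrite /gs ler_expR lerN2 !mul1r.
have := cd_sqr_le (t *: basis3 i + y) i.
have -> : cd (t *: basis3 i + y) i = t; last by [].
rewrite -(dp_basis i) dpC dp_line [dp y _]dpC dp_basis y0 addr0.
by rewrite cdE; move: i y0; apply: ord3P => _; rewrite /basis3 /= mul1r.
Qed.

(** The base point has zero [i]-th coordinate, so the Gaussian on space is bounded by that of the
    line parameter. *)
Lemma Int_line0 f df M i y : continuous f -> continuous df ->
  (forall x, is_derive x (basis3 i) f (df x)) ->
  (forall x, `|f x| <= M * gs 1 x) -> (forall x, `|df x| <= M * gs 1 x) -> cd y i = 0 ->
  Int leb (fun t => df (t *: basis3 i + y)) = 0.
Proof.
move=> cf cdf Df fM dfM y0.
have M0 : 0 <= M by have := fM y; rewrite -(pmulr_lge0 _ (gs_gt0 1 y)); apply: le_trans.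
have cl : continuous (fun t : R => t *: basis3 i + y).
  by move=> t; apply: cvgD; [apply: cvgZl|exact: cvg_cst].
have B (h : sp -> R) : (forall x, `|h x| <= M * gs 1 x) -> forall t, `|h (t *: basis3 i + y)| <= M * expR (- (1 * t ^+ 2)).
  by move=> hM t; apply: (le_trans (hM _)); rewrite ler_wpM2l// gs_line_le.
have Z (e : R) : `|e| = 1 -> f ((e * n%:R) *: basis3 i + y) @[n --> \oo] --> (0 : R).
  move=> e1; apply: cvg0_norm.
  have n1 (t : R) : `|1 : R| <= 1 by rewrite normr1.
  have G := @gauss_n_cvg0 _ 1 (fun=> 1) e ltr01 n1 e1.
  apply: (cvg0_squeeze (K := M) _ G) => n.
  by rewrite normr_ge0 mulr1; exact: B.
apply: (Int_derive0 (is_derive_along y Df)).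
- by move=> t; apply: (@continuous_cvg _ _ _ _ _ (fun t : R => t *: basis3 i + y) df); [exact: cdf|exact: cl].
- apply: (L1_le _ (L1Z M (gauss_Int ltr01).1)); last exact: B.
  apply: continuous_measurable => t.
  by apply: (@continuous_cvg _ _ _ _ _ (fun t : R => t *: basis3 i + y) df); [exact: cdf|exact: cl].
- by have := Z 1 (normr1 _); under eq_fun do rewrite mul1r.
- have := Z (-1); rewrite normrN1 => /(_ erefl).
  by under eq_fun do rewrite mulN1r.
Qed.

Lemma gs1_pair (u v t : R) : gs 1 (u, v, t) <= expR (- (1 * u ^+ 2)) * expR (- (1 * v ^+ 2)).
Proof.
by rewrite gsE /= ler_piMr ?mulr_ge0 ?expR_ge0// mul1r -[leRHS]expR0 ler_expR oppr_le0 sqr_ge0.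
Qed.

(** Fubini in an order that integrates along direction [i] first; each line integral is 0 by
    [Int_line0]. *)
Lemma Int3_derive0 f df M i : continuous f -> continuous df ->
  (forall x, is_derive x (basis3 i) f (df x)) ->
  (forall x, `|f x| <= M * gs 1 x) -> (forall x, `|df x| <= M * gs 1 x) ->
  Int mu df = 0.
Proof.
move=> cf cdf Df fM dfM.
have mdf := continuous_measurable3 cdf.
have Ldf : L1 mu df by apply: (@L1_le _ _ _ mu df _ mdf (L1Z M (L1_gs ltr01)) dfM).
have H y : cd y i = 0 -> Int leb (fun t => df (t *: basis3 i + y)) = 0.
  exact: (Int_line0 cf cdf Df fM dfM).
have L2d (t : R) : L1 (leb \x leb)%E (fun z => df (z, t)).
  have [Le _] := gauss_Int (ltr01 : 0 < 1 :> R).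
  apply: (L1_le _ (L1Z M (L1_tensor Le Le))) => [|[u v] /=].
    by apply: (measurableT_comp mdf); exact: pair2_measurable.
  have M0 : 0 <= M by have := fM (u,v,t); rewrite -(pmulr_lge0 _ (gs_gt0 1 (u,v,t))); apply: le_trans.
  by apply: (le_trans (dfM _)); rewrite ler_wpM2l// gs1_pair.
have F1 := @Int_fub1 _ _ _ _ _ (@leb2s R) leb df Ldf.
have F2 := @Int_fub2 _ _ _ _ _ (@leb2s R) leb df Ldf.
have Z0 (h : R -> R) : (forall t, h t = 0) -> Int leb h = 0.
  by move=> h0; rewrite -[RHS](@Int_0 _ _ _ leb); exact: Int_ext.
move: i Df H; apply: ord3P => Df H.
- rewrite /leb3s -F2; apply: (Z0 _) => t.
  rewrite -[LHS](Int_fub2 (L2d t)); apply: (Z0 _) => v.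
  rewrite -[RHS](H (0, v, t)); last by rewrite cdE.
  by apply: Int_ext => u; rewrite line0 addr0.
- rewrite /leb3s -F2; apply: (Z0 _) => t.
  rewrite -[LHS](Int_fub1 (L2d t)); apply: (Z0 _) => u.
  rewrite -[RHS](H (u, 0, t)); last by rewrite cdE.
  by apply: Int_ext => v; rewrite line1 addr0.
- rewrite /leb3s -F1 -[RHS](@Int_0 _ _ _ (@leb2s R)); apply: Int_ext => -[u v].
  rewrite -[RHS](H (u, v, 0)); last by rewrite cdE.
  by apply: Int_ext => t; rewrite line2 addr0.
Qed.

Lemma test_function_L1 f : test_function f -> L1 mu f /\ forall i, L1 mu (partial i f).
Proof.
move=> tf; have [M HM] := test_function_bound tf.
have L (h : sp -> R) : continuous h -> (forall x, `|h x| <= M * gs 1 x) -> L1 mu h.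
  by move=> ch hM; exact: (@L1_le _ _ _ mu h _ (continuous_measurable3 ch) (L1Z M (L1_gs ltr01)) hM).
split; first by apply: L => [|x]; [exact: (tf.1 [::]).1|exact: (HM x).1].
by move=> i; apply: L => [|x]; [exact: (tf.1 [:: i]).1|exact: (HM x).2].
Qed.

(** Integration by parts against a plane wave: the integrand is the partial derivative of
    [f * h (xi.x)]. It is used with [h] the cosine and the sine. *)
Lemma transform_partial f (h h' : R -> R) i xi : test_function f ->
  (forall t, is_derive t (1 : R) h (h' t)) -> continuous h' ->
  (forall t, `|h t| <= 1) -> (forall t, `|h' t| <= 1) ->
  Int mu (fun x => partial i f x * h (dp xi x) + f x * (h' (dp xi x) * cd xi i)) = 0.
Proof.
move=> tf Dh ch' h1 h1'; have [M HM] := test_function_bound tf.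
have cdpx : continuous (fun x => dp xi x).
  move=> x; apply: cvgD; first apply: cvgD; apply: cvgM; try exact: cvg_cst;
    first [exact: continuous_fst1|exact: continuous_fst2|exact: continuous_snd3].
have ch := is_derive_continuous Dh.
have c1 : continuous (fun x => h (dp xi x)).
  by move=> x; apply: (@continuous_cvg _ _ _ _ _ (fun x => dp xi x) h); [exact: ch|exact: cdpx].
have c2 : continuous (fun x => h' (dp xi x)).
  by move=> x; apply: (@continuous_cvg _ _ _ _ _ (fun x => dp xi x) h'); [exact: ch'|exact: cdpx].
have cf := (tf.1 [::]).1; have cpf := (tf.1 [:: i]).1.
have G0 x := gs_ge0 1 x.
have M0 x : 0 <= M * gs 1 x by apply: le_trans (HM x).1.
apply: (@Int3_derive0 (fun x => f x * h (dp xi x)) _ (M * (1 + `|cd xi i|)) i).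
- by move=> x; apply: cvgM; [exact: cf|exact: c1].
- move=> x; apply: cvgD; apply: cvgM; [exact: cpf|exact: c1|exact: cf|].
  by apply: cvgMl; exact: c2.
- move=> x; apply: is_derive_mul.
    by have := (tf.1 [::]).2 i x; rewrite /partial => /derivableP.
  apply: is_derive_chain => //; apply/is_derive_lineP.
  have -> : (fun t => dp xi (t *: basis3 i + x)) = (fun t : R => cd xi i * t + dp xi x).
    by apply/funext => t; rewrite dpC dp_line dpC.
  apply: (is_derive_eq (is_derive_add (is_derive_scale (cd xi i) (is_derive_id (0 : R) (1 : R)))
     (is_derive_const (dp xi x) (0 : R) (1 : R)))).
  by rewrite mulr1 addr0.
- move=> x; rewrite normrM mulrDr mulr1 mulrDl.
  apply: (@le_trans _ _ (M * gs 1 x)); last first.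
    by rewrite lerDl mulrAC mulr_ge0.
  by rewrite -[leRHS]mulr1 ler_pM//; exact: (HM x).1.
- move=> x; rewrite mulrDr mulr1 mulrDl; apply: (le_trans (ler_normD _ _)); apply: lerD.
    by rewrite normrM -[leRHS]mulr1 ler_pM//; exact: (HM x).2.
  rewrite !normrM mulrA [leRHS]mulrAC ler_wpM2r//.
  by rewrite -[leRHS]mulr1 ler_pM//; exact: (HM x).1.
Qed.

Lemma Ct_partial f i xi : test_function f -> Ct (partial i f) xi = cd xi i * St f xi.
Proof.
move=> tf; have [Lf Lpf] := test_function_L1 tf.
have := transform_partial i xi tf (@is_derive_cos R) _ (@cos_norm_le1 R) _.
have -> : (fun x => partial i f x * cos (dp xi x) + f x * (- sin (dp xi x) * cd xi i)) =
   (fun x => partial i f x * cos (dp xi x) - cd xi i * (f x * sin (dp xi x))).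
  by apply/funext => x; ring.
rewrite (IntB (L1_cosdp xi (Lpf i)) (L1Z _ (L1_sindp xi Lf))) (IntZ _ (L1_sindp xi Lf)).
move=> H; apply/eqP; rewrite -subr_eq0; apply/eqP; apply: H.
  by move=> t; apply: cvgN; exact: continuous_sin.
by move=> t; rewrite normrN sin_norm_le1.
Qed.

Lemma St_partial f i xi : test_function f -> St (partial i f) xi = - (cd xi i * Ct f xi).
Proof.
move=> tf; have [Lf Lpf] := test_function_L1 tf.
have := transform_partial i xi tf (@is_derive_sin R) (@continuous_cos R) (@sin_norm_le1 R) (@cos_norm_le1 R).
have -> : (fun x => partial i f x * sin (dp xi x) + f x * (cos (dp xi x) * cd xi i)) =
   (fun x => partial i f x * sin (dp xi x) + cd xi i * (f x * cos (dp xi x))).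
  by apply/funext => x; ring.
rewrite (IntD (L1_sindp xi (Lpf i)) (L1Z _ (L1_cosdp xi Lf))) (IntZ _ (L1_cosdp xi Lf)).
by move=> /eqP; rewrite addr_eq0 => /eqP.
Qed.

(** Supplies the solenoidal test fields. The transform of a partial derivative is a coordinate times
    a transform, so the weak divergence becomes an integral of the two vanishing sums. *)
Lemma L2sigma_Rt (p q : 'I_3 -> sp -> R) : (forall i, L12 (p i)) -> (forall i, L12 (q i)) ->
  (forall xi, \sum_i cd xi i * p i xi = 0) -> (forall xi, \sum_i cd xi i * q i xi = 0) ->
  L2sigma (fun x => \row_i Rt (p i) (q i) x).
Proof.
move=> hp hq p0 q0.
have E i : (fun x => (\row_i Rt (p i) (q i) x) 0 i) = Rt (p i) (q i).
  by apply/funext => x; rewrite mxE.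
split; first by move=> i; rewrite E; apply: L2_Lfun; exact: L2_Rt.
move=> f tf; have [Lf Lpf] := test_function_L1 tf.
have LC i : L1 mu (fun x => p i x * Ct (partial i f) x) := L1_mulCt (hp i).1 (Lpf i).
have LS i : L1 mu (fun x => q i x * St (partial i f) x) := L1_mulSt (hq i).1 (Lpf i).
have LR i : L1 mu (fun x => partial i f x * Rt (p i) (q i) x).
  apply: L1_ext (L1B (L1_mulCt (Lpf i) (hp i).1) (L1_mulSt (Lpf i) (hq i).1)) => x.
  by rewrite /Rt mulrBr.
transitivity (Int mu (fun x => \sum_i partial i f x * Rt (p i) (q i) x)).
  by apply: Int_ext => x; apply: eq_bigr => i _; rewrite mxE mulrC.
rewrite (Int_sum _ LR).
transitivity (\sum_i Int mu (fun x => p i x * Ct (partial i f) x - q i x * St (partial i f) x)).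
  by apply: eq_bigr => i _; exact: (Int_Rt (Lpf i) (hp i) (hq i)).
rewrite -Int_sum; last by move=> i; exact: L1B (LC i) (LS i).
rewrite -[RHS](@Int_0 _ _ _ mu); apply: Int_ext => xi.
transitivity (St f xi * (\sum_i cd xi i * p i xi) + Ct f xi * (\sum_i cd xi i * q i xi)).
  rewrite !mulr_sumr -big_split; apply: eq_bigr => i _ /=.
  by rewrite Ct_partial// St_partial//; ring.
by rewrite p0 q0 !mulr0 addr0.
Qed.

End TestFunctions.

(** * The Leray projection *)

Section Leray.
Context {R : realType}.
Local Notation sp := (R * R * R)%type.
Local Notation mu := (@leb3s R).
Implicit Types (x y xi : sp) (a b f g p q w : sp -> R) (i j : 'I_3).

(* The symbol [xi_i xi_j / |xi|^2] of the gradient part; it is [0] at [xi = 0]. *)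
Definition gradproj i j xi : R := cd xi i * cd xi j / dp xi xi.

Lemma cd_dp0 xi i : dp xi xi = 0 -> cd xi i = 0.
Proof.
move=> d0; have := cd_sqr_le xi i; rewrite d0 => h.
by apply/eqP; rewrite -sqrf_eq0 eq_le h sqr_ge0.
Qed.

Lemma measurable_gradproj i j : measurable_fun setT (gradproj i j).
Proof.
have -> : gradproj i j = (fun xi => cd xi i * cd xi j * expR (- ln (dp xi xi))).
  apply/funext => xi; rewrite /gradproj; have [d0|d0] := eqVneq (dp xi xi) 0.
    by rewrite (cd_dp0 i d0) !mul0r.
  by rewrite expRN lnK// posrE lt_def d0 dp_ge0.
apply: measurable_funM; first by apply: measurable_funM; exact: measurable_cd.
apply: (measurableT_comp (@measurable_expR R)); apply: measurableT_comp => //.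
by apply: (measurableT_comp (@measurable_ln R)); exact: measurable_dp.
Qed.

Lemma cdM_le i j xi : `|cd xi i * cd xi j| <= dp xi xi.
Proof.
have hi := cd_sqr_le xi i; have hj := cd_sqr_le xi j.
rewrite normrM; have h := sqr_ge0 (`|cd xi i| - `|cd xi j|).
rewrite -(real_normK (num_real (cd xi i))) in hi; rewrite -(real_normK (num_real (cd xi j))) in hj.
move: (`|cd xi i|) (`|cd xi j|) (dp xi xi) hi hj h => u v d; nra.
Qed.

Lemma gradproj_le1 i j xi : `|gradproj i j xi| <= 1.
Proof.
rewrite /gradproj; have [d0|d0] := eqVneq (dp xi xi) 0.
  by rewrite (cd_dp0 i d0) !mul0r normr0.
have dp0 : 0 < dp xi xi by rewrite lt_def d0 dp_ge0.
by rewrite normrM normfV (gtr0_norm dp0) ler_pdivrMr// mul1r cdM_le.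
Qed.

Lemma gradproj_sym i j xi : gradproj i j xi = gradproj j i xi.
Proof. by rewrite /gradproj [cd xi i * _]mulrC. Qed.

Lemma gradproj_div i xi : \sum_j cd xi j * gradproj i j xi = cd xi i.
Proof.
have [d0|d0] := eqVneq (dp xi xi) 0.
  by rewrite (cd_dp0 i d0) big1// => j _; rewrite (cd_dp0 j d0) mul0r.
transitivity (cd xi i * (\sum_j cd xi j * cd xi j) / dp xi xi).
  rewrite mulr_sumr mulr_suml; apply: eq_bigr => j _; rewrite /gradproj; ring.
by rewrite -dp_sum mulfK.
Qed.

(* [solproj A] is the Fourier side of the Leray projection *)
Definition solproj (A : 'I_3 -> sp -> R) i xi : R := A i xi - \sum_j gradproj i j xi * A j xi.

Lemma solproj_div A xi : \sum_i cd xi i * solproj A i xi = 0.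
Proof.
rewrite /solproj; under eq_bigr do rewrite mulrBr mulr_sumr.
rewrite sumrB exchange_big /=; apply/eqP; rewrite subr_eq0; apply/eqP; apply: eq_bigr => j _.
transitivity ((\sum_i cd xi i * gradproj j i xi) * A j xi); first by rewrite gradproj_div.
by rewrite mulr_suml; apply: eq_bigr => i _; rewrite (gradproj_sym j i) -mulrA.
Qed.

(** [A - solproj A] is parallel to [xi], and [solproj B] is orthogonal to it. *)
Lemma solproj_dot A B xi : \sum_i solproj A i xi * solproj B i xi = \sum_i A i xi * solproj B i xi.
Proof.
apply/eqP; rewrite -subr_eq0 -sumrB; apply/eqP.
transitivity (\sum_i \sum_j - (gradproj i j xi * A j xi) * solproj B i xi).
  apply: eq_bigr => i _; rewrite -mulr_suml sumrN {1}/solproj; ring.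
rewrite exchange_big /= big1// => j _.
transitivity (- (cd xi j / dp xi xi * A j xi) * (\sum_i cd xi i * solproj B i xi)).
  rewrite mulr_sumr; apply: eq_bigr => i _; rewrite /gradproj; ring.
by rewrite solproj_div mulr0.
Qed.

Lemma L2_gradprojM i j a : L2 mu a -> L2 mu (fun xi => gradproj i j xi * a xi).
Proof. by move=> La; exact (@L2_bM _ _ _ mu 1 _ a (measurable_gradproj i j) (gradproj_le1 i j) La). Qed.

Lemma L12_gradprojM i j a : L12 a -> L12 (fun xi => gradproj i j xi * a xi).
Proof. by move=> La; exact (@L12_bM R 1 _ a (measurable_gradproj i j) (gradproj_le1 i j) La). Qed.

Lemma L2_solproj A i : (forall j, L2 mu (A j)) -> L2 mu (solproj A i).
Proof. by move=> LA; apply: L2B => //; apply: L2_sum => j; exact: L2_gradprojM. Qed.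

Section Projection.
Variables (w0 v : field3 R) (A B : 'I_3 -> sp -> R).
Hypothesis Fw : forall i, ft (fun x => w0 x 0 i) (A i) (B i).
Hypothesis Lw : forall i, L2 mu (fun x => w0 x 0 i).
Hypothesis vproj : is_leray_proj w0 v.

Let LA i : L2 mu (A i). Proof. by case: (Fw i). Qed.
Let LB i : L2 mu (B i). Proof. by case: (Fw i). Qed.

Lemma leray_L2 i : L2 mu (fun x => v x 0 i).
Proof. by case: vproj => -[h _] _; apply: Lfun_L2; exact: h. Qed.

Let Lv := leray_L2.

(** Against solenoidal fields the variational definition replaces [v] by [w0], and only [w0] is then
    transformed; no transform of [v] is introduced. *)
Lemma leray_test (p q : 'I_3 -> sp -> R) : (forall i, L12 (p i)) -> (forall i, L12 (q i)) ->
  (forall xi, \sum_i cd xi i * p i xi = 0) -> (forall xi, \sum_i cd xi i * q i xi = 0) ->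
  \sum_i Int mu (fun x => v x 0 i * Rt (p i) (q i) x) =
  \sum_i Int mu (fun xi => A i xi * p i xi + B i xi * q i xi).
Proof.
move=> hp hq p0 q0.
have := vproj.2 _ (L2sigma_Rt hp hq p0 q0).
have LR i := L2_Rt (hp i) (hq i).
have Lwr i := L2_mul (Lw i) (LR i); have Lvr i := L2_mul (Lv i) (LR i).
have E : Int mu (fun x => dot ((w0 - v) x) (\row_i Rt (p i) (q i) x)) =
   \sum_i Int mu (fun x => w0 x 0 i * Rt (p i) (q i) x) - \sum_i Int mu (fun x => v x 0 i * Rt (p i) (q i) x).
  have Ew : Int mu (fun x => \sum_i w0 x 0 i * Rt (p i) (q i) x) =
    \sum_i Int mu (fun x => w0 x 0 i * Rt (p i) (q i) x) := Int_sum _ Lwr.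
  have Ev : Int mu (fun x => \sum_i v x 0 i * Rt (p i) (q i) x) =
    \sum_i Int mu (fun x => v x 0 i * Rt (p i) (q i) x) := Int_sum _ Lvr.
  rewrite -Ew -Ev -(IntB (L1_sum _ Lwr) (L1_sum _ Lvr)).
  apply: Int_ext => x; rewrite -sumrB /dot; apply: eq_bigr => i _.
  by rewrite !mxE mulrBl.
have -> : L2inner (w0 - v) (fun x => \row_i Rt (p i) (q i) x) =
  Int mu (fun x => dot ((w0 - v) x) (\row_i Rt (p i) (q i) x)) by [].
rewrite E => /eqP; rewrite subr_eq0 => /eqP <-.
by apply: eq_bigr => i _; exact: (parseval_Rt (Fw i) (hp i) (hq i)).
Qed.

(** Duality again: [v] is tested against the damped projected symbol. With [m] the damped energy
    this gives [m <= 2 c3 V + m / 4], which implies the bound with room to spare. *)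
Lemma leray_bound : Int mu (fun xi => \sum_i (solproj A i xi ^+ 2 + solproj B i xi ^+ 2)) <=
  4 * c3 * \sum_i Int mu (fun x => v x 0 i ^+ 2).
Proof.
have LPA i := L2_solproj i LA; have LPB i := L2_solproj i LB.
pose S xi := \sum_i (solproj A i xi ^+ 2 + solproj B i xi ^+ 2).
have LS : L1 mu S by apply: L1_sum => i; exact: L1D (LPA i).2 (LPB i).2.
have S0 xi : 0 <= S xi by apply: sumr_ge0 => i _; rewrite addr_ge0// sqr_ge0.
set V := \sum_i _; have c0 := @c3_gt0 R.
pose e (n : nat) : R := n.+1%:R^-1; have e0 n : 0 < e n by rewrite invr_gt0.
suff Hm n : Int mu (fun xi => gs (e n) xi * S xi) <= 4 * c3 * V.
  have [||| _ //] := @Int_fatou _ _ _ mu (fun n x => gs (e n) x * S x) S (4 * c3 * V) _ _ _ Hm.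
  - move=> n; apply: (@L1_bM _ _ _ mu 1 (gs (e n)) S) => // [|x]; first exact: measurable_gs.
    by rewrite ger0_norm ?gs_ge0// gs_le1// ltW.
  - by move=> n x; rewrite mulr_ge0 ?gs_ge0.
  - by move=> x; rewrite -[X in _ --> X]mul1r; apply: cvgMl; exact: gs_harmonic_cvg.
pose p i xi := gs (e n) xi * solproj A i xi; pose q i xi := gs (e n) xi * solproj B i xi.
have hp i : L12 (p i) := L12_gs_mul (e0 n) (LPA i).
have hq i : L12 (q i) := L12_gs_mul (e0 n) (LPB i).
have p0 xi : \sum_i cd xi i * p i xi = 0.
  by rewrite /p; under eq_bigr do rewrite mulrCA; rewrite -mulr_sumr solproj_div mulr0.
have q0 xi : \sum_i cd xi i * q i xi = 0.
  by rewrite /q; under eq_bigr do rewrite mulrCA; rewrite -mulr_sumr solproj_div mulr0.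
have T := leray_test hp hq p0 q0.
have L1AB i : L1 mu (fun xi => A i xi * p i xi + B i xi * q i xi).
  exact: L1D (L2_mul (LA i) (hp i).2) (L2_mul (LB i) (hq i).2).
have mE : Int mu (fun xi => gs (e n) xi * S xi) = \sum_i Int mu (fun x => v x 0 i * Rt (p i) (q i) x).
  rewrite T -Int_sum//; apply: Int_ext => xi.
  transitivity (gs (e n) xi * (\sum_i A i xi * solproj A i xi + \sum_i B i xi * solproj B i xi)).
    rewrite -(solproj_dot A A) -(solproj_dot B B) /S -big_split /=; congr (_ * _); apply: eq_bigr => i _; by rewrite !expr2.
  rewrite -big_split /= mulr_sumr; apply: eq_bigr => i _; rewrite /p /q; ring.
set m := Int mu _ in mE *.
have LR i := L2_Rt (hp i) (hq i).
(* The weights in Young's inequality are such that, after [Rt_bound] with its factor [2 c3], the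
   second term returns at most [m / 4]. *)
have h1 i : Int mu (fun x => v x 0 i * Rt (p i) (q i) x) <=
    2 * c3 * Int mu (fun x => v x 0 i ^+ 2) + (8 * c3)^-1 * Int mu (fun x => Rt (p i) (q i) x ^+ 2).
  have LX := L1Z (2 * c3) (Lv i).2; have LY := L1Z (8 * c3)^-1 (LR i).2.
  rewrite -(IntZ _ (Lv i).2) -(IntZ _ (LR i).2) -(IntD LX LY).
  apply: Int_le; [exact: L2_mul (Lv i) (LR i)|exact: L1D LX LY|] => x.
  rewrite -subr_ge0; move: (v x 0 i) (Rt _ _ x) (c3 : R) c0 => s t c cp.
  have -> : 2 * c * s ^+ 2 + (8 * c)^-1 * t ^+ 2 - s * t = (8 * c)^-1 * (4 * c * s - t) ^+ 2.
    by field; rewrite gt_eqF.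
  by rewrite mulr_ge0 ?sqr_ge0// invr_ge0 mulr_ge0// ltW.
have h2 i : Int mu (fun x => Rt (p i) (q i) x ^+ 2) <= 2 * c3 * Int mu (fun x => p i x ^+ 2 + q i x ^+ 2).
  exact: Rt_bound.
have h3 : \sum_i Int mu (fun x => p i x ^+ 2 + q i x ^+ 2) <= m.
  rewrite -Int_sum; last by move=> i; exact: L1D (hp i).2.2 (hq i).2.2.
  apply: Int_le.
  - by apply: L1_sum => i; exact: L1D (hp i).2.2 (hq i).2.2.
  - apply: (@L1_bM _ _ _ mu 1 (gs (e n)) S) => // [|x]; first exact: measurable_gs.
    by rewrite ger0_norm ?gs_ge0// gs_le1// ltW.
  - move=> x; rewrite /S mulr_sumr; apply: ler_sum => i _; rewrite /p /q !exprMn -mulrDr.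
    apply: ler_wpM2r; first by rewrite addr_ge0// sqr_ge0.
    by rewrite expr2 ler_piMr ?gs_ge0// gs_le1// ltW.
have h4 : m <= 2 * c3 * V + 4^-1 * m.
  rewrite {1}mE; apply: (le_trans (ler_sum _ (fun i _ => h1 i))).
  rewrite big_split /= -mulr_sumr lerD2l -mulr_sumr.
  apply: (@le_trans _ _ ((8 * c3)^-1 * (2 * c3 * m))); last first.
    by move: (c3 : R) c0 => c cp; rewrite le_eqVlt; apply/orP; left; apply/eqP; field; rewrite gt_eqF.
  apply: ler_wpM2l; first by rewrite invr_ge0 mulr_ge0// ltW.
  apply: (le_trans (ler_sum _ (fun i _ => h2 i))); rewrite -mulr_sumr.
  by apply: ler_wpM2l => //; rewrite mulr_ge0// ltW.
have V0 : 0 <= c3 * V.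
  by rewrite mulr_ge0 ?(ltW c0)// sumr_ge0// => i _; apply: Int_ge0 => x; exact: sqr_ge0.
rewrite -mulrA in h4 *; lra.
Qed.

(** The heat kernel in component [i] splits on the frequency side into row [i] of the solenoidal
    projection, handled by [leray_test], and a gradient, against which [v] integrates to 0. *)
Lemma leray_heat (s : R) x i : 0 < s -> Int mu (fun y => heat_kernel s (x - y) * v y 0 i) =
  c3^-1 * Rt (fun xi => gs s xi * solproj A i xi) (fun xi => gs s xi * solproj B i xi) x.
Proof.
move=> s0.
pose p xi := gs s xi * cos (dp x xi); pose q xi := - (gs s xi * sin (dp x xi)).
have hp : L12 p := L12_gs_cos x s0; have hq : L12 q := L12N (L12_gs_sin x s0).
have s20 : 0 < s / 2 by rewrite divr_gt0.
have gE xi : gs s xi = gs (s / 2) xi * gs (s / 2) xi by rewrite -gsD -splitr.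
have rp : rapid p.
  apply: rapid_ext (rapid_gs s20 (L12_gs_cos x s20).2) => xi; rewrite /p gE; ring.
have rq : rapid q.
  apply: rapidN; apply: rapid_ext (rapid_gs s20 (L12_gs_sin x s20).2) => xi; rewrite gE; ring.
have hkp j := L12_gradprojM i j hp; have hkq j := L12_gradprojM i j hq.
(* the gradient part, regularized at [xi = 0] *)
have G0 : \sum_j Int mu (fun y => v y 0 j * Rt (fun xi => gradproj i j xi * p xi) (fun xi => gradproj i j xi * q xi) y) = 0.
  pose e (n : nat) : R := n.+1%:R^-1; have e0 n : 0 < e n by rewrite invr_gt0.
  have d0 n xi : 0 < dp xi xi + e n by rewrite ltr_wpDl ?dp_ge0.
  (* The potential of the gradient part would be [xi_i / |xi|^2], singular at the origin; [e n] in
     the denominator keeps the symbols rapid, and the limit is taken in [L2]. *)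
  pose r n xi := cd xi i / (dp xi xi + e n).
  have mr n : measurable_fun setT (r n).
    have -> : r n = (fun xi => cd xi i * expR (- ln (dp xi xi + e n))).
      by apply/funext => xi; rewrite /r expRN lnK// posrE.
    apply: measurable_funM; first exact: measurable_cd.
    apply: (measurableT_comp (@measurable_expR R)); apply: measurableT_comp => //.
    apply: (measurableT_comp (@measurable_ln R)); apply: measurable_funD => //; exact: measurable_dp.
  have rB n xi : `|r n xi| <= (e n)^-1 * (1 + dp xi xi) ^+ 1.
    rewrite normrM normfV (gtr0_norm (d0 n xi)) mulrC expr1; apply: ler_pM => //; last exact: cd_norm_le.
      by rewrite invr_ge0 ltW.
    by rewrite lef_pV2 ?posrE// lerDr dp_ge0.
  (* The potential has symbol [r (q - i p)]; multiplied by [i xi_j] it becomes [xi_j r (p + i q)],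
     whose parts are [P n j] and [Q n j]. *)
  have ra n : rapid (fun xi => r n xi * q xi) by exact: rapid_bM (mr n) (rB n) rq.
  have rb n : rapid (fun xi => - (r n xi * p xi)) by apply: rapidN; exact: rapid_bM (mr n) (rB n) rp.
  have D n := div_free_Rt Lv vproj.1.2 (ra n) (rb n).
  pose P n j xi := - (cd xi j * - (r n xi * p xi)); pose Q n j xi := cd xi j * (r n xi * q xi).
  have hP n j : L12 (P n j) := rapid_L12 (rapidN (rapid_cd j (rb n))).
  have hQ n j : L12 (Q n j) := rapid_L12 (rapid_cd j (ra n)).
  have kcv n j xi : `|cd xi j * r n xi - gradproj i j xi| <= 1.
    rewrite /r /gradproj; have [z|z] := eqVneq (dp xi xi) 0.
      by rewrite (cd_dp0 i z) !mul0r mulr0 subr0 normr0.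
    have z0 : 0 < dp xi xi by rewrite lt_def z dp_ge0.
    have -> : cd xi j * (cd xi i / (dp xi xi + e n)) - cd xi i * cd xi j / dp xi xi =
        - (cd xi i * cd xi j / dp xi xi) * (e n / (dp xi xi + e n)).
      by field; rewrite z gt_eqF.
    rewrite normrM normrN mulr_ile1//; first exact: (gradproj_le1 i j xi).
    have h : 0 <= e n / (dp xi xi + e n) by apply: divr_ge0; exact: ltW.
    by rewrite (ger0_norm h) ler_pdivrMr// mul1r lerDr dp_ge0.
  have kcv2 j xi : cd xi j * r n xi @[n --> \oo] --> gradproj i j xi.
    rewrite /gradproj; have [z|z] := eqVneq (dp xi xi) 0.
      rewrite (cd_dp0 i z) !mul0r; apply: (@cvgR_ext _ _ (fun=> 0)) => [n|]; last exact: cvg_cst.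
      by rewrite /r (cd_dp0 i z) mul0r mulr0.
    rewrite mulrAC mulrC; apply: cvgMr; apply: cvgMr; apply: cvgV => //.
    rewrite -[X in _ --> X]addr0; apply: cvgD; [exact: cvg_cst|exact: inv_succ_cvg0].
  have cvP (h : sp -> R) (K : nat -> 'I_3 -> sp -> R) j : L12 h -> (forall n, L12 (K n j)) ->
      (forall n xi, K n j xi = cd xi j * r n xi * h xi) ->
      Int mu (fun xi => (K n j xi - gradproj i j xi * h xi) ^+ 2) @[n --> \oo] --> (0 : R).
    move=> hh hK KE; have mh : measurable_fun setT (fun xi => `|h xi|) by apply: measurableT_comp => //; exact hh.2.1.
    apply: (@L2cvg_dom _ _ _ mu (fun n => K n j) (fun xi => gradproj i j xi * h xi) (fun xi => `|h xi|)).
    - by move=> n; exact (hK n).2.1.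
    - by apply: (@L2_le _ _ _ mu (fun xi => `|h xi|) h mh hh.2) => xi; rewrite normr_id.
    - exact (L12_gradprojM i j hh).2.1.
    - by move=> n xi; rewrite KE -mulrBl normrM ler_piMl.
    - by move=> xi; apply: (cvgR_ext (fun n => KE n xi)); apply: cvgMl; exact: kcv2.
  have limj j : Int mu (fun y => Rt (P n j) (Q n j) y * v y 0 j) @[n --> \oo] -->
      Int mu (fun y => Rt (fun xi => gradproj i j xi * p xi) (fun xi => gradproj i j xi * q xi) y * v y 0 j).
    have cP := cvP p P j hp (hP ^~ j) (fun n xi => ltac:(by rewrite /P mulrN opprK mulrA)).
    have cQ := cvP q Q j hq (hQ ^~ j) (fun n xi => ltac:(by rewrite /Q mulrA)).
    apply: (@L2cvg_Int _ _ _ mu (fun n => Rt (P n j) (Q n j))) => //.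
    - by move=> n; exact: L2_Rt.
    - exact: L2_Rt (hkp j) (hkq j).
    have cPQ : Int mu (fun xi => (P n j xi - gradproj i j xi * p xi) ^+ 2) +
        Int mu (fun xi => (Q n j xi - gradproj i j xi * q xi) ^+ 2) @[n --> \oo] --> (0 : R).
      by rewrite -[X in _ --> X]addr0; exact (cvgD cP cQ).
    apply: (@cvg0_squeeze _ _ _ (2 * c3) _ cPQ) => n; apply/andP; split.
      by apply: Int_ge0 => y; exact: sqr_ge0.
    have hPk := L12B (hP n j) (hkp j); have hQk := L12B (hQ n j) (hkq j).
    have := Rt_bound hPk hQk; rewrite (IntD hPk.2.2 hQk.2.2); apply: le_trans.
    rewrite le_eqVlt; apply/orP; left; apply/eqP; apply: Int_ext => y.
    rewrite /Rt (CtB _ (hP n j).1 (hkp j).1) (StB _ (hQ n j).1 (hkq j).1); congr (_ ^+ 2); ring.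
  have LvR n j : L1 mu (fun y => v y 0 j * Rt (P n j) (Q n j) y) := L2_mul (Lv j) (L2_Rt (hP n j) (hQ n j)).
  have DE n : \sum_j Int mu (fun y => Rt (P n j) (Q n j) y * v y 0 j) = 0.
    rewrite -[RHS](D n) (Int_sum _ (LvR n)); apply: eq_bigr => j _; apply: Int_ext => y; exact: mulrC.
  have lim0 : \sum_j Int mu (fun y => Rt (P n j) (Q n j) y * v y 0 j) @[n --> \oo] -->
     \sum_j Int mu (fun y => Rt (fun xi => gradproj i j xi * p xi) (fun xi => gradproj i j xi * q xi) y * v y 0 j).
    rewrite [X in _ --> X]sum3E.
    apply: (cvgR_ext (fun n => sum3E (fun j => Int mu (fun y => Rt (P n j) (Q n j) y * v y 0 j)))).
    exact (cvgD (cvgD (limj 0) (limj 1)) (limj 2)).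
  rewrite -[RHS](cvgR_unique lim0 (cvgR_ext DE (cvg_cst _))).
  by apply: eq_bigr => j _; apply: Int_ext => y; exact: mulrC.
pose P j xi := ((i == j)%:R - gradproj i j xi) * p xi; pose Q j xi := ((i == j)%:R - gradproj i j xi) * q xi.
have hP j : L12 (P j).
  by apply: L12_ext (L12B (L12Z (i == j)%:R hp) (hkp j)) => xi; rewrite /P mulrBl.
have hQ j : L12 (Q j).
  by apply: L12_ext (L12B (L12Z (i == j)%:R hq) (hkq j)) => xi; rewrite /Q mulrBl.
have sumd (F : 'I_3 -> R) : \sum_j (i == j)%:R * F j = F i.
  rewrite (bigD1 i)//= eqxx mul1r big1 ?addr0// => j; rewrite eq_sym => /negbTE ->; exact: mul0r.
have Z (h : sp -> R) xi : \sum_j cd xi j * (((i == j)%:R - gradproj i j xi) * h xi) = 0.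
  transitivity ((\sum_j (i == j)%:R * cd xi j - \sum_j cd xi j * gradproj i j xi) * h xi).
    rewrite -sumrB mulr_suml; apply: eq_bigr => j _; ring.
  by rewrite sumd gradproj_div subrr mul0r.
have T := leray_test hP hQ (Z p) (Z q).
pose f1 j y := v y 0 j * Rt (P j) (Q j) y.
pose f2 j y := v y 0 j * Rt (fun xi => gradproj i j xi * p xi) (fun xi => gradproj i j xi * q xi) y.
have Lf1 j : L1 mu (f1 j) := L2_mul (Lv j) (L2_Rt (hP j) (hQ j)).
have Lf2 j : L1 mu (f2 j) := L2_mul (Lv j) (L2_Rt (hkp j) (hkq j)).
have LPA := L2_solproj i LA; have LPB := L2_solproj i LB.
pose S1 := \sum_j Int mu (f1 j); pose S2 := \sum_j Int mu (f2 j).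
transitivity (c3^-1 * (S1 + S2)).
  have E12 : Int mu (fun y => \sum_j f1 j y + \sum_j f2 j y) = S1 + S2 :=
    etrans (IntD (L1_sum _ Lf1) (L1_sum _ Lf2)) (congr2 _ (Int_sum _ Lf1) (Int_sum _ Lf2)).
  rewrite -E12 -(IntZ _ (L1D (L1_sum _ Lf1) (L1_sum _ Lf2))); apply: Int_ext => y; rewrite /f1 /f2.
  rewrite heat_kernel_Rt// -/p -/q -mulrA; congr (_ * _).
  rewrite -big_split /= -[LHS]mulrC -(sumd (fun j => v y 0 j * Rt p q y)); apply: eq_bigr => j _.
  rewrite -mulrDr mulrCA; congr (_ * _); rewrite /Rt.
  have -> : Ct (P j) y = (i == j)%:R * Ct p y - Ct (fun xi => gradproj i j xi * p xi) y.
    rewrite -(CtZ _ _ hp.1) -(CtB _ (L1Z _ hp.1) (hkp j).1).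
    by apply: Int_ext => xi; rewrite /P mulrBl.
  have -> : St (Q j) y = (i == j)%:R * St q y - St (fun xi => gradproj i j xi * q xi) y.
    rewrite -(StZ _ _ hq.1) -(StB _ (L1Z _ hq.1) (hkq j).1).
    by apply: Int_ext => xi; rewrite /Q mulrBl.
  ring.
have -> : S2 = 0 := G0.
have -> : S1 = _ := T.
rewrite addr0; congr (_ * _).
have L1s j : L1 mu (fun xi => A j xi * P j xi + B j xi * Q j xi).
  exact: L1D (L2_mul (LA j) (hP j).2) (L2_mul (LB j) (hQ j).2).
rewrite -Int_sum// /Rt /Ct /St.
rewrite -(IntB (L1_cosdp x (L12_gs_mul s0 LPA).1) (L1_sindp x (L12_gs_mul s0 LPB).1)).
apply: Int_ext => xi.
transitivity ((\sum_j (i == j)%:R * A j xi - \sum_j gradproj i j xi * A j xi) * p xi +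
   (\sum_j (i == j)%:R * B j xi - \sum_j gradproj i j xi * B j xi) * q xi).
  rewrite -!sumrB !mulr_suml -big_split; apply: eq_bigr => j _ /=; rewrite /P /Q; ring.
by rewrite !sumd /p /q /solproj; ring.
Qed.

End Projection.
End Leray.

(** * Scalar multiplier estimates *)

Section Multipliers.
Context {R : realType}.
Implicit Types (x t rho : R).

Lemma normM_le (u v U V : R) : `|u| <= U -> `|v| <= V -> `|u * v| <= U * V.
Proof. by move=> hu hv; rewrite normrM ler_pM. Qed.

Lemma normD_le (u v U V : R) : `|u| <= U -> `|v| <= V -> `|u + v| <= U + V.
Proof. by move=> hu hv; apply: (le_trans (ler_normD _ _)); exact: lerD. Qed.

Lemma normB_le (u v U V : R) : `|u| <= U -> `|v| <= V -> `|u - v| <= U + V.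
Proof. by move=> hu hv; apply: (le_trans (ler_normB _ _)); exact: lerD. Qed.

Lemma expR_sub_le (u v E : R) : expR u <= E -> expR v <= E -> `|expR u - expR v| <= `|u - v| * E.
Proof.
wlog uv : u v / v <= u.
  by move=> H hu hv; have [/H|/ltW /H] := leP v u; [|rewrite distrC [`|u - v|]distrC]; apply.
move=> hu hv; rewrite !ger0_norm ?subr_ge0 ?ler_expR//.
have := expR_ge1Dx (v - u); rewrite expRD expRN => h.
have u0 := expR_gt0 u.
have h2 : (1 + (v - u)) * expR u <= expR v.
  by rewrite -ler_pdivlMr.
have h3 : (u - v) * expR u <= (u - v) * E by rewrite ler_wpM2l// subr_ge0.
by apply: le_trans h3; move: h2; rewrite mulrDl mul1r mulrBl => h2; lra.
Qed.

(** * Low frequencies *)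

Section LowFrequency.
Variables (K c L C0 k rho t e0 e1 e2 E F : R).
Hypotheses (k0 : 0 <= k) (kK : k <= K) (kc : `|k - 2^-1| <= c * rho) (c0 : 0 <= c) (L0 : 0 <= L).
Hypotheses (rho0 : 0 <= rho) (rho1 : rho <= 1) (t0 : 0 <= t).
Hypotheses (e00 : `|e0| <= E) (e20 : `|e2| <= F) (e10 : `|e1 - e0| <= L * rho ^+ 2 * t * E).
Hypothesis powE : forall j : nat, (j <= 5)%N -> (rho * t) ^+ j * E <= C0.
Hypothesis powF : forall j : nat, (j <= 5)%N -> t ^+ j * F <= C0.
Let N := 1 + rho * k ^+ 2.
Let i := N^-1.

Let N1 : 1 <= N.
Proof. by rewrite lerDl; apply: mulr_ge0 => //; exact: sqr_ge0. Qed.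
Let i1 : `|i| <= 1.
Proof.
have N0 : 0 < N by exact: lt_le_trans N1.
by rewrite /i normfV (gtr0_norm N0) invf_le1.
Qed.
(** An exact first-order expansion of [1 / N]: the normalization contributes an error with one
    factor [rho]. *)
Let Ni : i = 1 - rho * k ^+ 2 * i.
Proof. by have N0 : N != 0 by [rewrite gt_eqF// (lt_le_trans _ N1)]; rewrite /i /N; field. Qed.
Let K0 : 0 <= K. Proof. exact: le_trans kK. Qed.
Let kn : `|k| <= K. Proof. by rewrite ger0_norm. Qed.
Let kn2 : `|k ^+ 2| <= K ^+ 2. Proof. by rewrite normrX lerXn2r ?nnegrE. Qed.
Let rn : `|rho| <= rho. Proof. by rewrite ger0_norm. Qed.
Let rn1 : `|rho| <= 1. Proof. by rewrite ger0_norm. Qed.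
Let E0 : 0 <= E. Proof. exact: le_trans e00. Qed.
Let F0 : 0 <= F. Proof. exact: le_trans e20. Qed.

(** Here [e0], [e1], [e2] stand for the heat, slow and fast exponentials, [E] and [F] for
    [exp (- a rho t)] and [exp (- a t)]. The errors are slow against heat, normalization, and fast
    mode; [powE] lets each factor [rho] absorb a factor [t]. *)
Lemma low_coefA : `|(e1 + k ^+ 2 * rho * e2) / N - e0| * t <= (L + K ^+ 2 + K ^+ 2) * C0.
Proof.
have -> : (e1 + k ^+ 2 * rho * e2) / N - e0 = (e1 - e0) * i - e0 * (rho * k ^+ 2 * i) + k ^+ 2 * rho * e2 * i.
  rewrite -/i; apply/eqP; rewrite -subr_eq0; apply/eqP.
  transitivity (e0 * (i - (1 - rho * k ^+ 2 * i))); first by ring.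
  by rewrite -Ni subrr mulr0.
apply: (@le_trans _ _ ((L * rho ^+ 2 * t * E * 1 + E * (rho * K ^+ 2 * 1) + K ^+ 2 * 1 * F * 1) * t)).
  rewrite ler_wpM2r//; apply: normD_le; last by do ?apply: normM_le.
  by apply: normB_le; do ?apply: normM_le.
have p2 := @powE 2 isT; have p1 := @powE 1 isT; have q1 := @powF 1 isT.
have -> : (L * rho ^+ 2 * t * E * 1 + E * (rho * K ^+ 2 * 1) + K ^+ 2 * 1 * F * 1) * t =
  L * ((rho * t) ^+ 2 * E) + K ^+ 2 * ((rho * t) ^+ 1 * E) + K ^+ 2 * (t ^+ 1 * F) by ring.
by rewrite !mulrDl !lerD// ler_wpM2l// exprn_ge0.
Qed.

(** The weight [t (1 + rho t)] stands in for [sqrt rho * t^(3/2)], since [rho t <= (1 + rho t)^2];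
    this keeps square roots of [rho] out of the estimate. *)
Lemma low_coefB : `|k * (e1 - e2) / N - 2^-1 * e0| * t * (1 + rho * t) <= (K * L + c + K ^+ 3 + K) * (C0 + C0).
Proof.
have -> : k * (e1 - e2) / N - 2^-1 * e0 = k * (e1 - e0) * i + e0 * (k - 2^-1 - k * (rho * k ^+ 2 * i)) - k * e2 * i.
  rewrite -/i; have -> : k - 2^-1 - k * (rho * k ^+ 2 * i) = k * (1 - rho * k ^+ 2 * i) - 2^-1 by ring.
  by rewrite -Ni; ring.
apply: (@le_trans _ _ ((K * (L * rho ^+ 2 * t * E) * 1 + E * (c * rho + K * (rho * K ^+ 2 * 1)) + K * F * 1) * t * (1 + rho * t))).
  rewrite ler_wpM2r ?addr_ge0 ?mulr_ge0// ler_wpM2r//; apply: normB_le; last by do ?apply: normM_le.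
  apply: normD_le; first by do ?apply: normM_le.
  by apply: normM_le => //; apply: normB_le => //; do ?apply: normM_le.
have p3 := @powE 3 isT; have p2 := @powE 2 isT; have p1 := @powE 1 isT; have q1 := @powF 1 isT; have q2 := @powF 2 isT.
have -> : (K * (L * rho ^+ 2 * t * E) * 1 + E * (c * rho + K * (rho * K ^+ 2 * 1)) + K * F * 1) * t * (1 + rho * t) =
  K * L * ((rho * t) ^+ 2 * E + (rho * t) ^+ 3 * E) + c * ((rho * t) ^+ 1 * E + (rho * t) ^+ 2 * E)
  + K ^+ 3 * ((rho * t) ^+ 1 * E + (rho * t) ^+ 2 * E) + K * (t ^+ 1 * F + rho * (t ^+ 2 * F)) by ring.
have K3 : 0 <= K ^+ 3 by rewrite exprn_ge0.
have q2' : rho * (t ^+ 2 * F) <= C0.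
  by apply: le_trans q2; rewrite ler_piMl// mulr_ge0// exprn_ge0.
by rewrite !mulrDl !mulrDr !lerD// ler_wpM2l// mulr_ge0.
Qed.

(** The coefficient [1/4] is [k^2] at [k = 1/2]; the factorization [k^2 - 1/4 = (k - 1/2) (k + 1/2)]
    gains a second factor [rho]. *)
Lemma low_coefD : `|(k ^+ 2 * rho * e1 + e2) / N - 4^-1 * rho * e0| * t ^+ 2 <= (K ^+ 2 * L + c * (K + 2^-1) + K ^+ 4 + 1) * C0.
Proof.
have -> : (k ^+ 2 * rho * e1 + e2) / N - 4^-1 * rho * e0 =
   k ^+ 2 * rho * (e1 - e0) * i + rho * e0 * ((k - 2^-1) * (k + 2^-1) - k ^+ 2 * (rho * k ^+ 2 * i)) + e2 * i.
  rewrite -/i; have -> : (k - 2^-1) * (k + 2^-1) - k ^+ 2 * (rho * k ^+ 2 * i) = k ^+ 2 * (1 - rho * k ^+ 2 * i) - 4^-1 by field.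
  by rewrite -Ni; ring.
apply: (@le_trans _ _ ((K ^+ 2 * rho * (L * rho ^+ 2 * t * E) * 1 + rho * E * (c * rho * (K + 2^-1) + K ^+ 2 * (rho * K ^+ 2 * 1)) + F * 1) * t ^+ 2)).
  rewrite ler_wpM2r ?exprn_ge0//; apply: normD_le; last by do ?apply: normM_le.
  apply: normD_le; first by do ?apply: normM_le.
  apply: normM_le; first exact: normM_le.
  apply: normB_le; last by do ?apply: normM_le.
  by apply: normM_le => //; apply: normD_le => //; rewrite ger0_norm// invr_ge0.
have p3 := @powE 3 isT; have p2 := @powE 2 isT; have q2 := @powF 2 isT.
have -> : (K ^+ 2 * rho * (L * rho ^+ 2 * t * E) * 1 + rho * E * (c * rho * (K + 2^-1) + K ^+ 2 * (rho * K ^+ 2 * 1)) + F * 1) * t ^+ 2 =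
  K ^+ 2 * L * ((rho * t) ^+ 3 * E) + c * (K + 2^-1) * ((rho * t) ^+ 2 * E) + K ^+ 4 * ((rho * t) ^+ 2 * E) + t ^+ 2 * F by ring.
have K3 : 0 <= K + 2^-1 by rewrite addr_ge0// invr_ge0.
have K4 : 0 <= K ^+ 4 by rewrite exprn_ge0.
have K2 : 0 <= K ^+ 2 by rewrite exprn_ge0.
by rewrite !(mulrDl _ _ C0) mul1r !lerD// ler_wpM2l// mulr_ge0.
Qed.
End LowFrequency.

(** * High frequencies *)

Section HighFrequency.
Variables (C0 k rho t e0 e1 e2 E F : R).
Hypotheses (k0 : 0 <= k) (rho1 : 1 <= rho) (t1 : 1 <= t).
Hypotheses (e00 : 0 <= e0) (e0E : e0 <= E) (e01 : e0 <= 1) (e10 : 0 <= e1) (e20 : 0 <= e2) (e1F : e1 <= F) (e2F : e2 <= F) (F1 : F <= 1).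
Hypothesis powE : forall j : nat, (j <= 5)%N -> (rho * t) ^+ j * E <= C0.
Hypothesis powF : forall j : nat, (j <= 5)%N -> t ^+ j * F <= C0.
Let N := 1 + rho * k ^+ 2.

Let rk0 : 0 <= rho * k ^+ 2.
Proof. by apply: mulr_ge0; [exact: le_trans rho1|exact: sqr_ge0]. Qed.
Let N0 : 0 < N. Proof. by apply: (lt_le_trans ltr01); rewrite lerDl. Qed.
Let t0 : 0 <= t. Proof. exact: le_trans t1. Qed.
Let F0 : 0 <= F. Proof. exact: le_trans e1F. Qed.
Let x1 : t <= rho * t. Proof. by rewrite ler_peMl. Qed.
Let r0 : 0 <= rho. Proof. exact: le_trans rho1. Qed.

(** The quotient is a convex combination of the two modes, hence at most [F], and the heat term is
    small by itself because [rho >= 1]; no cancellation is involved. *)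
Lemma high_coefA : `|(e1 + k ^+ 2 * rho * e2) / N - e0| * t <= 3 * C0.
Proof.
have E0 : 0 <= E by exact: le_trans e0E.
have q1 := @powF 1 isT; have p1 := @powE 1 isT.
have h1 : `|(e1 + k ^+ 2 * rho * e2) / N| <= F.
  rewrite ger0_norm; last first.
    by apply: divr_ge0; [apply: addr_ge0 => //; apply: mulr_ge0 => //; rewrite mulrC|exact: ltW].
  rewrite ler_pdivrMr// /N mulrDr mulr1 lerD// [k ^+ 2 * _]mulrC [leRHS]mulrC ler_wpM2l//.
have h2 : `|e0| <= E by rewrite ger0_norm.
apply: (@le_trans _ _ ((F + E) * t)); first by rewrite ler_wpM2r//; exact: normB_le.
have h3 : t * E <= rho * t * E by rewrite ler_wpM2r.
by move: q1 p1; rewrite !expr1 => q1 p1; have C00 : 0 <= C0 by [apply: le_trans q1; exact: mulr_ge0]; lra.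
Qed.

Lemma high_coefD : `|(k ^+ 2 * rho * e1 + e2) / N - 4^-1 * rho * e0| * t ^+ 2 <= 3 * C0.
Proof.
have E0 : 0 <= E by exact: le_trans e0E.
have q2 := @powF 2 isT; have p2 := @powE 2 isT.
have h1 : `|(k ^+ 2 * rho * e1 + e2) / N| <= F.
  rewrite ger0_norm; last first.
    by apply: divr_ge0; [apply: addr_ge0 => //; apply: mulr_ge0 => //; rewrite mulrC|exact: ltW].
  by rewrite ler_pdivrMr// /N mulrDr mulr1 addrC lerD// [k ^+ 2 * _]mulrC [leRHS]mulrC ler_wpM2l.
have h2 : `|4^-1 * rho * e0| <= rho ^+ 2 * E.
  rewrite ger0_norm; last by rewrite !mulr_ge0// invr_ge0.
  apply: ler_pM => //; first by rewrite mulr_ge0// invr_ge0.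
  rewrite expr2; apply: ler_pM => //; rewrite ?invr_ge0//; apply: le_trans rho1.
  by rewrite invf_le1// ler1n.
apply: (@le_trans _ _ ((F + rho ^+ 2 * E) * t ^+ 2)); first by rewrite ler_wpM2r ?exprn_ge0//; exact: normB_le.
have -> : (F + rho ^+ 2 * E) * t ^+ 2 = t ^+ 2 * F + (rho * t) ^+ 2 * E by ring.
have C00 : 0 <= C0 by apply: le_trans q2; rewrite mulr_ge0// exprn_ge0.
lra.
Qed.

(** The factor [rho] is unbounded here. The eigenvector absorbs it: [rho k^2 <= (1 + rho k^2)^2]
    bounds [(k / N)^2 rho] by 1. *)
Lemma high_coefB : (k * (e1 - e2) / N - 2^-1 * e0) ^+ 2 * rho * t ^+ 3 <= 8 * C0.
Proof.
have E0 : 0 <= E by exact: le_trans e0E.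
have q3 := @powF 3 isT; have p3 := @powE 3 isT.
have C00 : 0 <= C0 by apply: le_trans q3; rewrite mulr_ge0// exprn_ge0.
have h1 : (k / N) ^+ 2 * rho <= 1.
  have -> : (k / N) ^+ 2 * rho = (rho * k ^+ 2) / N ^+ 2 by field; rewrite gt_eqF.
  rewrite ler_pdivrMr ?exprn_gt0// mul1r /N; move: (rho * k ^+ 2) rk0 => q q0.
  have -> : (1 + q) ^+ 2 = q + (1 + q + q * q) by ring.
  by rewrite lerDl !addr_ge0// mulr_ge0.
have h2 : (e1 - e2) ^+ 2 <= F.
  apply: (@le_trans _ _ (F ^+ 2)); last by rewrite expr2 ler_piMl.
  rewrite -[leLHS]real_normK ?num_real// lerXn2r ?nnegrE//.
  by have H1 := e10; have H2 := e20; have H3 := e1F; have H4 := e2F; rewrite ler_norml; apply/andP; split; lra.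
have h3 : (2^-1 * e0) ^+ 2 <= E.
  apply: (@le_trans _ _ (e0 ^+ 2)); last by rewrite expr2; apply: le_trans e0E; rewrite ler_piMl.
  by rewrite lerXn2r ?nnegrE ?mulr_ge0 ?invr_ge0// ler_piMl// invf_le1 ?ler1n.
apply: (@le_trans _ _ (2 * ((k / N * (e1 - e2)) ^+ 2 + (2^-1 * e0) ^+ 2) * rho * t ^+ 3)).
  rewrite ler_wpM2r ?exprn_ge0// ler_wpM2r// mulrAC.
  move: (k / N * _) (2^-1 * e0) => a b; rewrite -subr_ge0.
  by have -> : 2 * (a ^+ 2 + b ^+ 2) - (a - b) ^+ 2 = (a + b) ^+ 2 by [ring]; exact: sqr_ge0.
have -> : 2 * ((k / N * (e1 - e2)) ^+ 2 + (2^-1 * e0) ^+ 2) * rho * t ^+ 3 =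
  2 * (((k / N) ^+ 2 * rho) * (e1 - e2) ^+ 2 * t ^+ 3 + rho * t ^+ 3 * (2^-1 * e0) ^+ 2) by ring.
have s1 : ((k / N) ^+ 2 * rho) * (e1 - e2) ^+ 2 * t ^+ 3 <= t ^+ 3 * F.
  rewrite [leRHS]mulrC ler_wpM2r ?exprn_ge0//; apply: le_trans h2.
  by rewrite ler_piMl// sqr_ge0.
have s2 : rho * t ^+ 3 * (2^-1 * e0) ^+ 2 <= (rho * t) ^+ 3 * E.
  apply: ler_pM => //; [by rewrite mulr_ge0// exprn_ge0|exact: sqr_ge0|].
  rewrite exprMn ler_wpM2r ?exprn_ge0//; rewrite exprS ler_peMr//.
  by rewrite exprn_ege1.
lra.
Qed.
End HighFrequency.

Variables (m ch ga : R).
Hypotheses (m0 : 0 < m) (ch0 : 0 < ch) (ga0 : 0 <= ga).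

(* Slope of the slow eigenvector (1, k) of the system for (U, D x W), where |xi|^2 = rho. *)
Definition slope rho : R :=
  let b := 4 * ch - (m + ch - ga) * rho in
  (4 * ch) / (b + Num.sqrt (b ^+ 2 + 16 * ch ^+ 2 * rho)).

(** [slow] and [fast] are the eigenvalues of the matrix with rows [- (m + ch) rho, 2 ch] and
    [2 ch rho, - (ga rho + 4 ch)] acting on [(U, D x W)]. *)
Definition slow rho : R := - (m + ch) * rho + 2 * ch * rho * slope rho.
Definition fast rho : R := - (ga * rho + 4 * ch) - 2 * ch * rho * slope rho.
Definition nrm rho : R := 1 + rho * slope rho ^+ 2.

(** Entries of the propagator of [(U, D x W)] minus those of the profile. The fourth entry is [rho]
    times [coefB], so three functions suffice. *)
Definition coefA rho t : R :=
  (expR (slow rho * t) + slope rho ^+ 2 * rho * expR (fast rho * t)) / nrm rho - expR (- m * rho * t).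
Definition coefB rho t : R :=
  slope rho * (expR (slow rho * t) - expR (fast rho * t)) / nrm rho - 2^-1 * expR (- m * rho * t).
Definition coefD rho t : R :=
  (slope rho ^+ 2 * rho * expR (slow rho * t) + expR (fast rho * t)) / nrm rho - 4^-1 * rho * expR (- m * rho * t).

Section FixRho.
Variable rho : R.
Hypothesis rho0 : 0 <= rho.
Local Notation k := (slope rho).
Local Notation N := (nrm rho).

(** The rationalized form of the positive root also covers [rho = 0], where the quadratic becomes
    linear. Its denominator is positive: [b <= 0] forces [rho > 0], and then the square root exceeds
    [- b]. *)
Lemma slope_spec : 0 < k /\ 2 * ch * rho * k ^+ 2 + (4 * ch - (m + ch - ga) * rho) * k - 2 * ch = 0.
Proof.
rewrite /slope; set b := 4 * ch - _; set s := Num.sqrt _.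
have q0 : 0 <= b ^+ 2 + 16 * ch ^+ 2 * rho by apply: addr_ge0; [exact: sqr_ge0|apply: mulr_ge0 => //; apply: mulr_ge0 => //; exact: sqr_ge0].
have s2 : s ^+ 2 = b ^+ 2 + 16 * ch ^+ 2 * rho by rewrite sqr_sqrtr.
have s0 : 0 <= s by exact: sqrtr_ge0.
have D0 : 0 < b + s.
  have [b0|b0] := ltP 0 b; first by rewrite ltr_wpDr.
  have rho1 : 0 < rho.
    rewrite lt_def rho0 andbT; apply/eqP => r0; move: b0; rewrite /b r0 mulr0 subr0.
    by rewrite leNgt mulr_gt0.
  have : (- b) ^+ 2 < s ^+ 2 by rewrite s2 sqrrN ltrDl !mulr_gt0// exprn_gt0.
  rewrite ltr_pXn2r ?nnegrE ?oppr_ge0// => h; lra.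
split; first by rewrite divr_gt0// mulr_gt0.
have Dn : b + s != 0 by rewrite gt_eqF.
have -> : 2 * ch * rho * (4 * ch / (b + s)) ^+ 2 + b * (4 * ch / (b + s)) - 2 * ch =
   2 * ch * (b ^+ 2 + 16 * ch ^+ 2 * rho - s ^+ 2) / (b + s) ^+ 2 by field.
by rewrite s2 subrr mulr0 mul0r.
Qed.

Local Opaque slope.

Let k0 : 0 < k. Proof. exact: slope_spec.1. Qed.
Let keq := slope_spec.2.

Lemma nrm_ge1 : 1 <= N.
Proof. by rewrite lerDl; apply: mulr_ge0 => //; exact: sqr_ge0. Qed.

Lemma nrm_gt0 : 0 < N.
Proof. exact: lt_le_trans ltr01 nrm_ge1. Qed.

(** The slope at which [slow] would vanish for positive [rho]. *)
Definition slopeK : R := (m + ch) / (2 * ch).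

Lemma slopeK_ge : 2^-1 <= slopeK.
Proof.
rewrite /slopeK ler_pdivlMr ?mulr_gt0//; have -> : 2^-1 * (2 * ch) = ch by field.
by rewrite lerDr ltW.
Qed.

(** Were [k] larger than [slopeK], the terms of the quadratic containing [rho] would have a
    nonnegative sum and force [k <= 1/2], which is at most [slopeK]. *)
Lemma slope_le : k <= slopeK.
Proof.
rewrite leNgt; apply/negP => h; have := slopeK_ge.
have h1 : (m + ch) < 2 * ch * k by move: h; rewrite /slopeK ltr_pdivrMr ?mulr_gt0// mulrC.
have h2 : 0 <= rho * k * (2 * ch * k - (m + ch)) by apply: mulr_ge0; [apply: mulr_ge0 => //; exact: ltW|rewrite subr_ge0 ltW].
have h3 : 0 <= ga * rho * k by apply: mulr_ge0; [exact: mulr_ge0|exact: ltW].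
have h4 : 4 * ch * k <= 2 * ch by move: keq; rewrite expr2 => h5; lra.
have : k <= 2^-1.
  by rewrite -(ler_pM2l (mulr_gt0 (ltr0n R 4 : 0 < 4) ch0)); lra.
by move=> h6 h7; have := le_lt_trans h7 (lt_le_trans h h6); rewrite ltxx.
Qed.

Definition slopeC : R := slopeK * (m + ch + ga + 2 * ch * slopeK) / (4 * ch).

(** The quadratic rearranges to [4 ch (k - 1/2) = rho k ((m + ch - ga) - 2 ch k)], and [slopeC]
    bounds the right side through [k <= slopeK]. *)
Lemma slope_half : `|k - 2^-1| <= slopeC * rho.
Proof.
have c40 : 0 < 4 * ch by rewrite mulr_gt0.
have -> : k - 2^-1 = (rho * k) * ((m + ch - ga) - 2 * ch * k) / (4 * ch).
  have E : 4 * ch * (k - 2^-1) = (rho * k) * ((m + ch - ga) - 2 * ch * k).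
    move: keq => h; have -> : 4 * ch * (k - 2^-1) = 4 * ch * k - 2 * ch by field.
    by apply/eqP; rewrite -subr_eq0 -h; apply/eqP; ring.
  by rewrite -E; field; rewrite gt_eqF.
rewrite normrM normfV (gtr0_norm c40) /slopeC [leRHS]mulrAC ler_pM2r ?invr_gt0//.
have -> : slopeK * (m + ch + ga + 2 * ch * slopeK) * rho = (rho * slopeK) * ((m + ch + ga) + 2 * ch * slopeK).
  by ring.
apply: normM_le.
  by rewrite ger0_norm; [apply: ler_wpM2l => //; exact: slope_le|apply: mulr_ge0 => //; exact: ltW].
apply: normB_le.
  by have M := m0; have Ch := ch0; have Ga := ga0; rewrite ler_norml; apply/andP; split; lra.
rewrite ger0_norm; last by apply: mulr_ge0; [apply: mulr_ge0 => //|]; exact: ltW.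
by rewrite ler_pM2l ?mulr_gt0//; exact: slope_le.
Qed.

(* Energy identity of the slow eigenvector: the last term is the coupling, quadratic in [1 - 2 k]. *)
Lemma slow_rayleigh : - slow rho * N = m * rho + ga * rho ^+ 2 * k ^+ 2 + ch * rho * (1 - 2 * k) ^+ 2.
Proof.
apply/eqP; rewrite -subr_eq0; apply/eqP.
transitivity (- (rho * k) * (2 * ch * rho * k ^+ 2 + (4 * ch - (m + ch - ga) * rho) * k - 2 * ch)).
  by rewrite /slow /nrm; ring.
by rewrite keq mulr0.
Qed.

(** Half of [m] leaves room for the term [rho k^2] of [nrm], and [ch] is the coefficient of the
    coupling term in [slow_rayleigh]. *)
Definition rateA : R := Num.min (m / 2) ch.

Lemma rateA_gt0 : 0 < rateA.
Proof. by rewrite lt_min ch0 divr_gt0. Qed.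

(** One statement for both regimes: [c = rho] at low and [c = 1] at high frequencies. In the energy
    identity [k^2] is paid for by [m] and by the coupling, through
    [k^2 <= 1/2 + (1 - 2 k)^2 / 2]. *)
Lemma slow_le (c : R) : 0 <= c -> c <= 1 -> c <= rho -> slow rho <= - rateA * c.
Proof.
move=> c0 c1 cr; rewrite mulNr lerNr -(ler_pM2r nrm_gt0) slow_rayleigh.
have a0 := rateA_gt0; have am : rateA <= m / 2 by rewrite ge_min lexx.
have ac : rateA <= ch by rewrite ge_min lexx orbT.
have kk : k ^+ 2 <= 2^-1 + 2^-1 * (1 - 2 * k) ^+ 2.
  rewrite -subr_ge0; have -> : 2^-1 + 2^-1 * (1 - 2 * k) ^+ 2 - k ^+ 2 = (k - 1) ^+ 2 by field.
  exact: sqr_ge0.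
set q := (1 - 2 * k) ^+ 2 in kk *; have q0 : 0 <= q by exact: sqr_ge0.
apply: (@le_trans _ _ (rateA * (rho + rho * (2^-1 + 2^-1 * q)))).
  rewrite -mulrA ler_pM2l// /nrm mulrDr mulr1 lerD//.
  have t1 : rho * k ^+ 2 <= rho * (2^-1 + 2^-1 * q) by rewrite ler_wpM2l.
  by apply: le_trans t1; rewrite ler_piMl//; apply: mulr_ge0 => //; exact: sqr_ge0.
have t2 : 0 <= ga * rho ^+ 2 * k ^+ 2.
  by apply: mulr_ge0; [apply: mulr_ge0 => //|]; exact: sqr_ge0.
have t3 : rateA * rho <= m / 2 * rho by rewrite ler_wpM2r.
have t4 : rateA * (rho * q) <= ch * (rho * q) by rewrite ler_wpM2r// mulr_ge0.
have t5 : 0 <= rateA * rho by rewrite mulr_ge0// ltW.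
have t6 : 0 <= ch * (rho * q) by apply: mulr_ge0; [exact: ltW|exact: mulr_ge0].
have -> : rateA * (rho + rho * (2^-1 + 2^-1 * q)) = rateA * rho + 2^-1 * (rateA * rho) + 2^-1 * (rateA * (rho * q)) by ring.
have -> : m * rho = 2 * (m / 2 * rho) by field.
rewrite -mulrA; lra.
Qed.

Lemma fast_le : fast rho <= - rateA.
Proof.
have ac : rateA <= ch by rewrite ge_min lexx orbT.
have : 0 <= ga * rho by rewrite mulr_ge0.
have : 0 <= 2 * ch * rho * k by apply: mulr_ge0; [apply: mulr_ge0 => //; apply: mulr_ge0 => //|]; exact: ltW.
have M := m0; have Ch := ch0; rewrite /fast; lra.
Qed.

Lemma slow_diff : `|slow rho - (- m * rho)| <= 2 * ch * slopeC * rho ^+ 2.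
Proof.
have -> : slow rho - (- m * rho) = 2 * ch * rho * (k - 2^-1) by rewrite /slow; field.
have -> : 2 * ch * slopeC * rho ^+ 2 = 2 * ch * rho * (slopeC * rho) by ring.
by apply: normM_le; [rewrite ger0_norm//; apply: mulr_ge0 => //; apply: mulr_ge0 => //; exact: ltW|exact: slope_half].
Qed.

Lemma slopeC_ge0 : 0 <= slopeC.
Proof.
have K0 : 0 <= slopeK by apply: le_trans slopeK_ge; rewrite invr_ge0.
apply: divr_ge0; last by apply: mulr_ge0 => //; exact: ltW.
apply: mulr_ge0 => //; have M := m0; have Ch := ch0; have Ga := ga0.
have : 0 <= 2 * ch * slopeK by apply: mulr_ge0 => //; apply: mulr_ge0 => //; exact: ltW.
by move: slopeK K0 => q _ ?; lra.
Qed.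

End FixRho.

Local Opaque slope.

Lemma exp_dominates5 (a : R) : 0 < a -> exists2 C, 0 <= C &
  forall (j : nat) x, (j <= 5)%N -> 0 <= x -> x ^+ j * expR (- a * x) <= C.
Proof.
move=> a0.
have [C0 [p0 H0]] := exp_dominates 0 a0; have [C1 [p1 H1]] := exp_dominates 1 a0.
have [C2 [p2 H2]] := exp_dominates 2 a0; have [C3 [p3 H3]] := exp_dominates 3 a0.
have [C4 [p4 H4]] := exp_dominates 4 a0; have [C5 [p5 H5]] := exp_dominates 5 a0.
exists (C0 + C1 + C2 + C3 + C4 + C5); first by rewrite !addr_ge0// ltW.
move=> j x j5 x0; rewrite mulNr.
case: j j5 => [|[|[|[|[|[|//]]]]]] _.
- by apply: (le_trans (H0 x x0)); lra.
- by apply: (le_trans (H1 x x0)); lra.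
- by apply: (le_trans (H2 x x0)); lra.
- by apply: (le_trans (H3 x x0)); lra.
- by apply: (le_trans (H4 x x0)); lra.
- by apply: (le_trans (H5 x x0)); lra.
Qed.

Lemma slow_fast_bounds (rho t : R) : 0 <= rho -> 0 <= t ->
  expR (fast rho * t) <= expR (- rateA * t) /\
  (1 <= rho -> expR (slow rho * t) <= expR (- rateA * t)) /\
  (rho <= 1 -> expR (slow rho * t) <= expR (- rateA * (rho * t))) /\
  expR (- m * rho * t) <= expR (- rateA * (rho * t)).
Proof.
move=> r0 t0; have M := m0; have rm : rateA <= m by apply: (@le_trans _ _ (m / 2)); [rewrite ge_min lexx|lra].
split; first by rewrite ler_expR ler_wpM2r//; exact: fast_le.
split.
  by move=> r1; rewrite ler_expR ler_wpM2r//; have := slow_le r0 ler01 (lexx 1) r1; rewrite mulr1.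
split.
  by move=> r1; rewrite ler_expR mulrA ler_wpM2r//; exact: slow_le.
by rewrite ler_expR mulrA ler_wpM2r// ler_wpM2r// lerN2.
Qed.

(** Squares appear because they multiply energies. The [rho] next to [coefB] is the squared size of
    the cross product with [xi] that accompanies this coefficient. *)
Lemma coef_bounds : exists2 C, 0 <= C & forall rho t, 0 <= rho -> 1 <= t ->
  [/\ coefA rho t ^+ 2 * t ^+ 2 <= C,
      coefB rho t ^+ 2 * rho * t ^+ 3 <= C &
      coefD rho t ^+ 2 * t ^+ 4 <= C].
Proof.
have [C0 C00 HC] := exp_dominates5 rateA_gt0.
set K := slopeK; set c := slopeC; set L := 2 * ch * c.
have K0 : 0 <= K by apply: le_trans slopeK_ge; rewrite invr_ge0.
have c0 : 0 <= c by exact: slopeC_ge0.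
have L0 : 0 <= L by apply: mulr_ge0 => //; apply: mulr_ge0 => //; exact: ltW.
pose B1 := (L + K ^+ 2 + K ^+ 2) * C0.
pose B2 := (K * L + c + K ^+ 3 + K) * (C0 + C0).
pose B3 := (K ^+ 2 * L + c * (K + 2^-1) + K ^+ 4 + 1) * C0.
have sq0 (u v b : R) : 0 <= v -> `|u| * v <= b -> u ^+ 2 * v ^+ 2 <= b ^+ 2.
  move=> v0 h; rewrite -exprMn -[leLHS]real_normK ?num_real// normrM (ger0_norm v0).
  by rewrite lerXn2r ?nnegrE ?mulr_ge0//; apply: le_trans h; rewrite mulr_ge0.
exists (B1 ^+ 2 + B2 ^+ 2 + B3 ^+ 2 + (3 * C0) ^+ 2 + 8 * C0).
  by do !apply: addr_ge0; try exact: sqr_ge0; apply: mulr_ge0.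
have D1 := sqr_ge0 B1; have D2 := sqr_ge0 B2; have D3 := sqr_ge0 B3; have D4 := sqr_ge0 (3 * C0).
move=> rho t r0 t1; have t0 : 0 <= t by exact: le_trans t1.
have [f1 [s1 [s2 z1]]] := slow_fast_bounds r0 t0.
have [k0 _] := slope_spec r0; have kK := slope_le r0; have kc := slope_half r0.
have x0 : 0 <= rho * t by exact: mulr_ge0.
have HE j (j5 : (j <= 5)%N) := HC j _ j5 x0; have HF j (j5 : (j <= 5)%N) := HC j _ j5 t0.
have t4 : t ^+ 4 = (t ^+ 2) ^+ 2 by rewrite -exprM.
have p0 := expR_ge0 (- m * rho * t); have p1 := expR_ge0 (slow rho * t); have p2 := expR_ge0 (fast rho * t).
have n0 : `|expR (- m * rho * t)| <= expR (- rateA * (rho * t)) by rewrite ger0_norm.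
have n2 : `|expR (fast rho * t)| <= expR (- rateA * t) by rewrite ger0_norm.
have [r1|r1] := leP rho 1.
  have n1 : `|expR (slow rho * t) - expR (- m * rho * t)| <= L * rho ^+ 2 * t * expR (- rateA * (rho * t)).
    apply: (le_trans (expR_sub_le (s2 r1) z1)); rewrite ler_wpM2r ?expR_ge0//.
    by rewrite -mulrBl normrM (ger0_norm t0) ler_wpM2r//; exact: slow_diff.
  have LA := low_coefA (ltW k0) kK L0 r0 r1 t0 n0 n2 n1 HE HF.
  have LB := low_coefB (ltW k0) kK kc c0 L0 r0 r1 t0 n0 n2 n1 HE HF.
  have LD := low_coefD (ltW k0) kK kc c0 L0 r0 t0 n0 n2 n1 HE HF.
  split.
  - have := sq0 _ _ _ t0 LA; rewrite -/B1 => h; apply: (le_trans h); move: (B1 ^+ 2) (B2 ^+ 2) (B3 ^+ 2) ((3 * C0) ^+ 2) D1 D2 D3 D4 => *; lra.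
  - rewrite -mulrA in LB; have v0 : 0 <= t * (1 + rho * t) by apply: mulr_ge0 => //; exact: addr_ge0.
    have := sq0 _ _ _ v0 LB; rewrite -/B2 => h.
    apply: (@le_trans _ _ (B2 ^+ 2)); last by move: (B1 ^+ 2) (B2 ^+ 2) (B3 ^+ 2) ((3 * C0) ^+ 2) D1 D2 D3 D4 => *; lra.
    apply: le_trans h; rewrite -mulrA ler_wpM2l ?sqr_ge0//.
    have -> : (t * (1 + rho * t)) ^+ 2 = t ^+ 2 * (1 + rho * t + (rho * t) + (rho * t) ^+ 2) by ring.
    have -> : rho * t ^+ 3 = t ^+ 2 * (rho * t) by ring.
    rewrite ler_wpM2l ?exprn_ge0//; move: (rho * t) x0 => x x0; have := sqr_ge0 x; lra.
  - have tt0 : 0 <= t ^+ 2 by rewrite exprn_ge0.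
    have := sq0 _ _ _ tt0 LD; rewrite -/B3 t4 => h; apply: (le_trans h); move: (B1 ^+ 2) (B2 ^+ 2) (B3 ^+ 2) ((3 * C0) ^+ 2) D1 D2 D3 D4 => *; lra.
have r1' := ltW r1.
have a0 := ltW rateA_gt0.
have z2 : expR (- m * rho * t) <= 1.
  by rewrite -[leRHS](@expR0 R) ler_expR !mulNr oppr_le0 !mulr_ge0// ltW.
have F1 : expR (- rateA * t) <= 1 by rewrite -[leRHS](@expR0 R) ler_expR mulNr oppr_le0 mulr_ge0.
have HA := high_coefA (slope rho) r1' t1 p0 z1 p1 p2 (s1 r1') f1 HE HF.
have HB := high_coefB (slope rho) r1' t1 p0 z1 z2 p1 p2 (s1 r1') f1 F1 HE HF.
have HD := high_coefD (slope rho) r1' t1 p0 z1 p1 p2 (s1 r1') f1 HE HF.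
split.
- have := sq0 _ _ _ t0 HA => h; apply: (le_trans h); move: (B1 ^+ 2) (B2 ^+ 2) (B3 ^+ 2) ((3 * C0) ^+ 2) D1 D2 D3 D4 => *; lra.
- by apply: (le_trans HB); move: (B1 ^+ 2) (B2 ^+ 2) (B3 ^+ 2) ((3 * C0) ^+ 2) D1 D2 D3 D4 => *; lra.
- have tt0 : 0 <= t ^+ 2 by rewrite exprn_ge0.
  have := sq0 _ _ _ tt0 HD; rewrite t4 => h; apply: (le_trans h); move: (B1 ^+ 2) (B2 ^+ 2) (B3 ^+ 2) ((3 * C0) ^+ 2) D1 D2 D3 D4 => *; lra.
Qed.

End Multipliers.

(** * The linear system at a fixed frequency *)

Section ScalarODE.
Context {R : realType}.
Implicit Types (f : R -> R) (t s l : R).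

(** The equation holds for positive times only; the function is constant there, and the right limit
    at 0 reaches the initial value. *)
Lemma is_derive0_cst f t : (forall s, 0 < s -> is_derive s (1 : R) f 0) ->
  f s @[s --> 0^'+] --> f 0 -> 0 < t -> f t = f 0.
Proof.
move=> Df f0 t0.
have E s : 0 < s -> s < t -> f s = f t.
  move=> s0 st.
  have D x : x \in `]s, t[ -> is_derive x (1 : R) f ((fun=> 0) x).
    by rewrite in_itv /= => /andP[sx _]; exact: Df (lt_trans s0 sx).
  have C : {within `[s, t], continuous f}.
    apply: derivable_within_continuous => x; rewrite in_itv /= => /andP[sx _].
    by have := Df x (lt_le_trans s0 sx); case.
  by have [c _] := MVT st D C; rewrite mul0r => /eqP; rewrite subr_eq0 => /eqP.
have L : f s @[s --> 0^'+] --> f t.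
  apply: cvg_near_cst; near=> s; apply: E; first by near: s; exact: nbhs_right_gt.
  by near: s; exact: nbhs_right_lt.
exact: (cvg_unique _ L f0).
Unshelve. all: by end_near. Qed.

Lemma exp_ode f l t : (forall s, 0 < s -> is_derive s (1 : R) f (l * f s)) ->
  f s @[s --> 0^'+] --> f 0 -> 0 < t -> f t = expR (l * t) * f 0.
Proof.
move=> Df f0 t0; pose g s := expR (- l * s) * f s.
have Dg s : 0 < s -> is_derive s (1 : R) g 0.
  move=> s0; have := is_derive_mul (is_derive_exp (is_derive_scale (- l) (is_derive_id s (1 : R)))) (Df s s0).
  by move/is_derive_eq; apply; ring.
have g0 : g s @[s --> 0^'+] --> g 0.
  have h : expR (- l * s) @[s --> (0 : R)^'+] --> expR (- l * 0).
    apply: cvg_within_filter; apply: (continuous_comp (f := fun s => - l * s)); last exact: continuous_expR.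
    exact: mulrl_continuous.
  exact (cvgM h f0).
have := is_derive0_cst Dg g0 t0; rewrite /g mulr0 expR0 mul1r => <-.
by rewrite mulrA -expRD mulNr subrr expR0 mul1r.
Qed.

End ScalarODE.

Section CrossProduct.
Context {R : realType}.
Implicit Types (d v w : 'I_3 -> R) (i : 'I_3).

Definition crs d v i : R := d (i + 1) * v (i + 2) - d (i + 2) * v (i + 1).

Lemma ord3D : [/\ (0 + 1 = 1 :> 'I_3), (0 + 2 = 2 :> 'I_3) & [/\ (1 + 1 = 2 :> 'I_3), (1 + 2 = 0 :> 'I_3),
  (2 + 1 = 0 :> 'I_3) & (2 + 2 = 1 :> 'I_3)]].
Proof. by do ?split; exact: val_inj. Qed.

Lemma crsE d v : [/\ crs d v 0 = d 1 * v 2 - d 2 * v 1, crs d v 1 = d 2 * v 0 - d 0 * v 2 &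
  crs d v 2 = d 0 * v 1 - d 1 * v 0].
Proof. by have [e1 e2 [e3 e4 e5 e6]] := ord3D; rewrite /crs e1 e2 e3 e4 e5 e6. Qed.

Lemma crs_crs d v i : crs d (crs d v) i = d i * (\sum_j d j * v j) - (\sum_j d j ^+ 2) * v i.
Proof.
have [e0 e1 e2] := crsE d v; have [h0 h1 h2] := crsE d (crs d v).
by move: i; apply: ord3P; rewrite !sum3E ?h0 ?h1 ?h2 ?e0 ?e1 ?e2; ring.
Qed.

Lemma crs_sqr d v : \sum_i crs d v i ^+ 2 = (\sum_j d j ^+ 2) * (\sum_j v j ^+ 2) - (\sum_j d j * v j) ^+ 2.
Proof. by have [e0 e1 e2] := crsE d v; rewrite !sum3E e0 e1 e2; ring. Qed.

Lemma crsN d v i : crs d (fun j => - v j) i = - crs d v i.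
Proof. by rewrite /crs; ring. Qed.

End CrossProduct.

Lemma cvg_cM {R : realType} (c : R) (f : R -> R) (l : R) :
  f s @[s --> 0^'+] --> l -> c * f s @[s --> 0^'+] --> c * l.
Proof. by move=> h; exact (cvgM (cvg_cst c) h). Qed.

Arguments cvg_cM {R} c {f l}.

Lemma cvg_cdot {R : realType} (d : 'I_3 -> R) (v : 'I_3 -> R -> R) (l : 'I_3 -> R) :
  (forall i, v i s @[s --> 0^'+] --> l i) -> \sum_j d j * v j s @[s --> 0^'+] --> \sum_j d j * l j.
Proof.
move=> h; have -> : (fun s => \sum_j d j * v j s) = (fun s => d 0 * v 0 s + d 1 * v 1 s + d 2 * v 2 s).
  by apply/funext => s; rewrite sum3E.
rewrite sum3E; exact (cvgD (cvgD (cvg_cM (d 0) (h 0)) (cvg_cM (d 1) (h 1))) (cvg_cM (d 2) (h 2))).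
Qed.

(** * Slow, fast and potential modes *)

Section Modes.
Context {R : realType}.
Local Notation sp := (R * R * R)%type.
Variables (m ch ga ka : R).
Hypotheses (m0 : 0 < m) (ch0 : 0 < ch) (ga0 : 0 <= ga) (ka0 : 0 <= ka).
Variables (xi : sp) (a q : 'I_3 -> R -> R).
Local Notation d := (cd xi).
Local Notation rho := (dp xi xi).

(** The system for [U = a] and [W = i q] with [a] and [q] real; as the gradient symbol is [i] times
    a real vector, the system preserves this form. *)
Definition real_ode := forall t : R, 0 < t -> forall i : 'I_3,
  [/\ is_derive t (1 : R) (a i) (- ((m + ch) * rho * a i t) - 2 * ch * crs d (q^~ t) i),
      is_derive t (1 : R) (q i) (- ((ga * rho + 4 * ch) * q i t) - ka * (\sum_j d j * q j t) * d i + 2 * ch * crs d (a^~ t) i) &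
      \sum_j d j * a j t = 0].

Hypothesis ode : real_ode.
Hypotheses (ca : forall i, a i s @[s --> 0^'+] --> a i 0) (cq : forall i, q i s @[s --> 0^'+] --> q i 0).

(* The vorticity [D x W]; [a + k z] and [z - k rho a] are the slow and the fast mode. *)
Let z (i : 'I_3) (t : R) : R := - crs d (q^~ t) i.

Let rhoE : \sum_j d j ^+ 2 = rho.
Proof. by rewrite dp_sum; apply: eq_bigr => j _; rewrite expr2. Qed.

Let rho0 : 0 <= rho. Proof. exact: dp_ge0. Qed.

(** Incompressibility extends from positive times to the initial time by right continuity. *)
Lemma mode_div0 : \sum_j d j * a j 0 = 0.
Proof.
have L : \sum_j d j * a j s @[s --> 0^'+] --> \sum_j d j * a j 0.
  exact: cvg_cdot.
have L0 : \sum_j d j * a j s @[s --> (0 : R)^'+] --> (0 : R).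
  apply: cvg_near_cst; near=> s; have s0 : 0 < s by near: s; exact: nbhs_right_gt.
  by have [_ _] := ode s0 0.
exact: (cvg_unique _ L L0).
Unshelve. all: by end_near. Qed.

Let Da (t : R) i : 0 < t -> is_derive t (1 : R) (a i) (- ((m + ch) * rho * a i t) + 2 * ch * z i t).
Proof. by move=> t0; have [H _ _] := ode t0 i; apply: (is_derive_eq H); rewrite /z; ring. Qed.

(** The cross product with [xi] kills the gradient term, and [ka] with it; incompressibility reduces
    the double cross product to [- rho a]. So [(a, z)] closes up componentwise. *)
Let Dz (t : R) i : 0 < t -> is_derive t (1 : R) (z i) (- ((ga * rho + 4 * ch) * z i t) + 2 * ch * rho * a i t).
Proof.
move=> t0; have [_ _ Hd] := ode t0 i.
have [_ H1 _] := ode t0 (i + 1); have [_ H2 _] := ode t0 (i + 2).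
have H := is_derive_opp (is_derive_sub (is_derive_scale (d (i + 1)) H2) (is_derive_scale (d (i + 2)) H1)).
apply: (is_derive_eq H).
have C := crs_crs d (a^~ t) i; rewrite Hd rhoE mulr0 sub0r in C.
rewrite /z; have -> : 2 * ch * rho * a i t = - (2 * ch) * crs d (crs d (a^~ t)) i by rewrite C; ring.
by rewrite {3}/crs /crs; ring.
Qed.

Let cz i : z i s @[s --> 0^'+] --> z i 0.
Proof.
have h1 := cvg_cM (d (i + 1)) (@cq (i + 2)); have h2 := cvg_cM (d (i + 2)) (@cq (i + 1)).
exact (cvgN (cvgB h1 h2)).
Qed.

Local Notation k := (slope m ch ga rho).
Let keq := (slope_spec m ga ch0 rho0).2.

(** The coefficients [(1, k)] form a left eigenvector: the defect in the equation is a multiple of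
    the quadratic that defines [slope]. *)
Let modeA i t : 0 < t -> a i t + k * z i t = expR (slow m ch ga rho * t) * (a i 0 + k * z i 0).
Proof.
pose f s := a i s + k * z i s.
have Df (s : R) : 0 < s -> is_derive s (1 : R) f (slow m ch ga rho * f s).
  move=> s0; have H := is_derive_add (Da i s0) (is_derive_scale k (Dz i s0)).
  apply: (is_derive_eq H); apply/eqP; rewrite -subr_eq0; apply/eqP.
  transitivity (- z i s * (2 * ch * rho * k ^+ 2 + (4 * ch - (m + ch - ga) * rho) * k - 2 * ch)).
    by rewrite /f /slow; ring.
  by rewrite keq mulr0.
have f0 : f s @[s --> 0^'+] --> f 0 by exact (cvgD (@ca i) (cvg_cM k (@cz i))).
exact: exp_ode.
Qed.

Let modeB i t : 0 < t -> z i t - k * rho * a i t = expR (fast m ch ga rho * t) * (z i 0 - k * rho * a i 0).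
Proof.
pose f s := z i s - k * rho * a i s.
have Df (s : R) : 0 < s -> is_derive s (1 : R) f (fast m ch ga rho * f s).
  move=> s0; have H := is_derive_sub (Dz i s0) (is_derive_scale (k * rho) (Da i s0)).
  apply: (is_derive_eq H); apply/eqP; rewrite -subr_eq0; apply/eqP.
  transitivity (- rho * a i s * (2 * ch * rho * k ^+ 2 + (4 * ch - (m + ch - ga) * rho) * k - 2 * ch)).
    by rewrite /f /fast; ring.
  by rewrite keq mulr0.
have f0 : f s @[s --> 0^'+] --> f 0 by exact (cvgB (@cz i) (cvg_cM (k * rho) (@ca i))).
exact: exp_ode.
Qed.

Let Nn : 1 + rho * k ^+ 2 != 0.
Proof. by rewrite gt_eqF// (lt_le_trans ltr01)// lerDl; apply: mulr_ge0 => //; exact: sqr_ge0. Qed.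

(** The passage from [(a, z)] to the two modes has determinant [1 + rho k^2], which is [nrm];
    inverting it produces the coefficients. *)
Lemma mode_velocity i t : 0 < t -> a i t - expR (- m * rho * t) * (a i 0 + 2^-1 * z i 0) =
  coefA m ch ga rho t * a i 0 + coefB m ch ga rho t * z i 0.
Proof.
move=> t0; have A := modeA i t0; have B := modeB i t0.
have -> : a i t = ((a i t + k * z i t) - k * (z i t - k * rho * a i t)) / (1 + rho * k ^+ 2) by field.
rewrite A B /coefA /coefB /nrm; move: (expR _) (expR _) (expR _) k Nn => ? ? ? ? N0; by field.
Qed.

Let mode_vorticity i t : 0 < t -> z i t - 2^-1 * rho * expR (- m * rho * t) * (a i 0 + 2^-1 * z i 0) =
  rho * coefB m ch ga rho t * a i 0 + coefD m ch ga rho t * z i 0.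
Proof.
move=> t0; have A := modeA i t0; have B := modeB i t0.
have -> : z i t = (k * rho * (a i t + k * z i t) + (z i t - k * rho * a i t)) / (1 + rho * k ^+ 2) by field.
rewrite A B /coefB /coefD /nrm; move: (expR _) (expR _) (expR _) k Nn => ? ? ? ? N0; by field.
Qed.

Let rateG := ga * rho + ka * rho + 4 * ch.

Let mode_div t : 0 < t -> \sum_j d j * q j t = expR (- rateG * t) * \sum_j d j * q j 0.
Proof.
pose f s := \sum_j d j * q j s.
have Df (s : R) : 0 < s -> is_derive s (1 : R) f (- rateG * f s).
  move=> s0; have [[_ h0 _] [_ h1 _] [_ h2 _]] := And3 (ode s0 0) (ode s0 1) (ode s0 2).
  have H := is_derive_add (is_derive_add (is_derive_scale (d 0) h0) (is_derive_scale (d 1) h1)) (is_derive_scale (d 2) h2).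
  have -> : f = (fun s => d 0 * q 0 s + d 1 * q 1 s + d 2 * q 2 s) by apply/funext => x; rewrite /f sum3E.
  apply: (is_derive_eq H); rewrite !sum3E /rateG -rhoE sum3E.
  by have [e0 e1 e2] := crsE d (a^~ s); rewrite e0 e1 e2; ring.
have f0 : f s @[s --> 0^'+] --> f 0 by exact: cvg_cdot.
exact: exp_ode.
Qed.

Let P i := solproj (fun i _ => q i 0) i xi.

(** Multiplication by [rho] clears the denominator of [gradproj], so the identity includes
    [rho = 0]. *)
Let rhoP i : rho * P i = rho * q i 0 - d i * \sum_j d j * q j 0.
Proof.
have [d0|d0] := eqVneq rho 0; first by rewrite (cd_dp0 i d0) d0 !mul0r subr0.
rewrite /P /solproj mulrBr; congr (_ - _); rewrite !mulr_sumr; apply: eq_bigr => j _.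
by rewrite /gradproj; field.
Qed.

(* [rho W = D x (D x W) - D (D . W)] recovers the field from its vorticity and its divergence. *)
Lemma mode_microrotation i t : 0 < t ->
  q i t - 2^-1 * expR (- m * rho * t) * crs d (a^~ 0) i - 4^-1 * rho * expR (- m * rho * t) * P i =
  coefB m ch ga rho t * crs d (a^~ 0) i + coefD m ch ga rho t * P i + expR (- rateG * t) * (q i 0 - P i).
Proof.
(* The recovery formula determines [W] for [rho != 0] only. At zero frequency the projection is the
   identity and [W] decays like [exp (- 4 ch t)], which is [coefD] there. *)
move=> t0; have [r0|r0] := eqVneq rho 0.
  have D0 j : d j = 0 by exact: cd_dp0.
  have -> : P i = q i 0.
    by rewrite /P /solproj big1 ?subr0// => j _; rewrite /gradproj D0 !mul0r.
  have -> : crs d (a^~ 0) i = 0 by rewrite /crs !D0 !mul0r subrr.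
  have E : q i t = expR (- (4 * ch) * t) * q i 0.
    have Dq (s : R) : 0 < s -> is_derive s (1 : R) (q i) (- (4 * ch) * q i s).
      move=> s0; have [_ H _] := ode s0 i; apply: (is_derive_eq H).
      have -> : crs d (a^~ s) i = 0 by rewrite /crs !D0 !mul0r subrr.
      by rewrite D0 r0; ring.
    exact: (exp_ode Dq (@cq i) t0).
  rewrite E /coefD /nrm /fast r0 !(mulr0, mul0r, addr0, subr0, add0r) divr1.
  by ring.
apply: (mulfI r0).
have CR v j : crs d (crs d v) j = d j * (\sum_j d j * v j) - rho * v j by rewrite crs_crs rhoE.
have CC j s : crs d (z^~ s) j = rho * q j s - d j * \sum_l d l * q l s.
  by rewrite /z crsN CR; ring.
pose V j := rho * coefB m ch ga rho t * a j 0 + coefD m ch ga rho t * z j 0.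
have E1 : crs d (z^~ t) i - 2^-1 * rho * expR (- m * rho * t) * (crs d (a^~ 0) i + 2^-1 * crs d (z^~ 0) i) = crs d V i.
  by rewrite /crs /V -!mode_vorticity//; ring.
have E2 : crs d V i = rho * coefB m ch ga rho t * crs d (a^~ 0) i + coefD m ch ga rho t * crs d (z^~ 0) i.
  by rewrite /crs /V; ring.
have C0 : crs d (z^~ 0) i = rho * P i by rewrite CC rhoP.
have Ct' : crs d (z^~ t) i = rho * q i t - expR (- rateG * t) * (rho * q i 0 - rho * P i).
  by rewrite CC mode_div// rhoP; ring.
rewrite E2 C0 Ct' in E1.
move: E1; move: (crs d (a^~ 0) i) (P i) (q i t) (q i 0) (coefB _ _ _ _ _) (coefD _ _ _ _ _) (expR _) (expR _) => A1 A2 A3 A4 A5 A6 A7 A8 E1.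
apply/eqP; rewrite -subr_eq0; apply/eqP; move/eqP: E1; rewrite -subr_eq0 => /eqP <-.
have -> : 4^-1 = 2^-1 * 2^-1 :> R by field.
by ring.
Qed.

(** Lagrange's identity for the cross product; it is here that the projected datum replaces the full
    one. *)
Let sqP : rho * \sum_i P i ^+ 2 = \sum_i crs d (q^~ 0) i ^+ 2.
Proof.
rewrite crs_sqr rhoE.
have -> : \sum_i P i ^+ 2 = \sum_i q i 0 * P i.
  by rewrite -(solproj_dot (fun i _ => q i 0) (fun i _ => q i 0) xi); apply: eq_bigr => i _; rewrite expr2.
have -> : rho * (\sum_i q i 0 * P i) = \sum_i (rho * q i 0 ^+ 2 - (\sum_j d j * q j 0) * (d i * q i 0)).
  by rewrite mulr_sumr; apply: eq_bigr => i _; rewrite mulrCA rhoP; ring.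
by rewrite sumrB -!mulr_sumr expr2.
Qed.

Let sumP : \sum_i (q i 0 - P i) ^+ 2 = \sum_i q i 0 ^+ 2 - \sum_i P i ^+ 2.
Proof.
have E : \sum_i P i ^+ 2 = \sum_i q i 0 * P i.
  by rewrite -(solproj_dot (fun i _ => q i 0) (fun i _ => q i 0) xi); apply: eq_bigr => i _; rewrite expr2.
transitivity (\sum_i q i 0 ^+ 2 - 2 * (\sum_i q i 0 * P i) + \sum_i P i ^+ 2).
  by rewrite mulr_sumr -sumrB -big_split /=; apply: eq_bigr => i _; ring.
by rewrite -E; ring.
Qed.

Lemma sum_sqrZ (c : R) (f : 'I_3 -> R) : \sum_i (c * f i) ^+ 2 = c ^+ 2 * \sum_i f i ^+ 2.
Proof. by rewrite mulr_sumr; apply: eq_bigr => i _; rewrite exprMn. Qed.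

(** [sqP] rewrites the initial energy of [z] as [rho] times that of the projected field. *)
Lemma mode_velocity_le t : 0 < t ->
  \sum_i (a i t - expR (- m * rho * t) * (a i 0 - 2^-1 * crs d (q^~ 0) i)) ^+ 2 <=
  2 * (coefA m ch ga rho t ^+ 2 * (\sum_i a i 0 ^+ 2) + coefB m ch ga rho t ^+ 2 * rho * \sum_i P i ^+ 2).
Proof.
move=> t0; rewrite -(mulrA _ rho) sqP -!sum_sqrZ -big_split mulr_sumr; apply: ler_sum => i _ /=.
have := mode_velocity i t0; rewrite {1}/z mulrN => ->; rewrite /z.
move: (coefA _ _ _ _ _ * _) (crs _ _ _) (coefB _ _ _ _ _) => u v w.
rewrite -subr_ge0; have -> : 2 * (u ^+ 2 + (w * v) ^+ 2) - (u + w * - v) ^+ 2 = (u + w * v) ^+ 2 by ring.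
exact: sqr_ge0.
Qed.

(** By Pythagoras the energies of the projected and the gradient part add up to that of [q]; by
    incompressibility the cross product with [xi] multiplies the energy of [a] by exactly [rho]. *)
Lemma mode_microrotation_le t : 0 < t ->
  \sum_i (q i t - 2^-1 * expR (- m * rho * t) * crs d (a^~ 0) i - 4^-1 * rho * expR (- m * rho * t) * P i) ^+ 2 <=
  3 * (coefB m ch ga rho t ^+ 2 * rho * (\sum_i a i 0 ^+ 2) +
       (coefD m ch ga rho t ^+ 2 + expR (- (4 * ch) * t)) * \sum_i q i 0 ^+ 2).
Proof.
move=> t0; have P0 : 0 <= \sum_i P i ^+ 2 by apply: sumr_ge0 => i _; exact: sqr_ge0.
have Q0 : 0 <= \sum_i (q i 0 - P i) ^+ 2 by apply: sumr_ge0 => i _; exact: sqr_ge0.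
set e3 := expR (- rateG * t).
have e3le : e3 ^+ 2 <= expR (- (4 * ch) * t).
  rewrite expr2; apply: (@le_trans _ _ e3).
    rewrite ler_piMl ?expR_ge0// /e3 -[leRHS](@expR0 R) ler_expR mulNr oppr_le0 mulr_ge0 ?(ltW t0)//.
    apply: addr_ge0; first by apply: addr_ge0; exact: mulr_ge0.
    by apply: mulr_ge0 => //; exact: ltW.
  rewrite /e3 ler_expR ler_wpM2r ?(ltW t0)// lerN2 /rateG lerDr.
  by apply: addr_ge0; exact: mulr_ge0.
have SA : \sum_i crs d (a^~ 0) i ^+ 2 = rho * \sum_i a i 0 ^+ 2.
  by rewrite crs_sqr mode_div0 expr0n subr0 rhoE.
apply: (@le_trans _ _ (3 * (coefB m ch ga rho t ^+ 2 * (\sum_i crs d (a^~ 0) i ^+ 2) +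
   coefD m ch ga rho t ^+ 2 * (\sum_i P i ^+ 2) + e3 ^+ 2 * \sum_i (q i 0 - P i) ^+ 2))).
  rewrite -!sum_sqrZ -!big_split mulr_sumr; apply: ler_sum => i _ /=.
  rewrite mode_microrotation// -/e3.
  move: (coefB _ _ _ _ _ * _) (coefD _ _ _ _ _ * _) (e3 * _) => u v w.
  rewrite -subr_ge0; have -> : 3 * (u ^+ 2 + v ^+ 2 + w ^+ 2) - (u + v + w) ^+ 2 = (u - v) ^+ 2 + (v - w) ^+ 2 + (u - w) ^+ 2 by ring.
  by apply: addr_ge0; [apply: addr_ge0|]; exact: sqr_ge0.
rewrite ler_pM2l// SA mulrA -addrA lerD2l mulrDl; move: Q0; rewrite sumP subr_ge0 => QP.
apply: lerD; first by apply: ler_wpM2l => //; exact: sqr_ge0.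
apply: ler_pM => //; [exact: sqr_ge0|by rewrite subr_ge0|by rewrite gerBl].
Qed.

End Modes.

Lemma mode_bounds (R : realType) (m ch ga ka : R) : 0 < m -> 0 < ch -> 0 <= ga -> 0 <= ka ->
  exists2 C, 0 <= C & forall (xi : R * R * R) (a q : 'I_3 -> R -> R) (t : R), 1 <= t ->
  real_ode m ch ga ka xi a q ->
  (forall i, a i s @[s --> 0^'+] --> a i 0) -> (forall i, q i s @[s --> 0^'+] --> q i 0) ->
  let e0 := gs (m * t) xi in let P i := solproj (fun i _ => q i 0) i xi in
  \sum_i (a i t - e0 * (a i 0 - 2^-1 * crs (cd xi) (q^~ 0) i)) ^+ 2 <=
    C * (t ^- 2 * (\sum_i a i 0 ^+ 2) + t ^- 3 * \sum_i P i ^+ 2) /\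
  \sum_i (q i t - e0 * (2^-1 * crs (cd xi) (a^~ 0) i + 4^-1 * dp xi xi * P i)) ^+ 2 <=
    C * (t ^- 3 * (\sum_i a i 0 ^+ 2) + t ^- 4 * \sum_i q i 0 ^+ 2).
Proof.
move=> m0 ch0 ga0 ka0; have [C C0 HC] := coef_bounds m0 ch0 ga0.
have h4 : 0 < 4 * ch by rewrite mulr_gt0.
have [D [D0 HD]] := exp_dominates 4 h4.
(* [C] covers the coefficients, [D] the decay of the gradient part against [t ^+ 4], and 3 is the
   number of terms squared together in the microrotation estimate. *)
exists (3 * (C + D)); first by rewrite mulr_ge0// addr_ge0// ltW.
move=> xi a q t t1 ode ca cq e0 P; have t0 : 0 < t by exact: lt_le_trans t1.
have [hA hB hD] := HC (dp xi xi) t (dp_ge0 xi) t1.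
have e0E : e0 = expR (- m * dp xi xi * t) by rewrite /e0 /gs; congr expR; ring.
have hE : expR (- (4 * ch) * t) * t ^+ 4 <= D by have := HD t (ltW t0); rewrite mulNr mulrC.
have p2 : 0 < t ^+ 2 by rewrite exprn_gt0.
have p3 : 0 < t ^+ 3 by rewrite exprn_gt0.
have p4 : 0 < t ^+ 4 by rewrite exprn_gt0.
rewrite -ler_pdivlMr// in hA; rewrite -ler_pdivlMr// in hB; rewrite -ler_pdivlMr// in hD; rewrite -ler_pdivlMr// in hE.
have SA : 0 <= \sum_i a i 0 ^+ 2 by apply: sumr_ge0 => i _; exact: sqr_ge0.
have SP : 0 <= \sum_i P i ^+ 2 by apply: sumr_ge0 => i _; exact: sqr_ge0.
have SQ : 0 <= \sum_i q i 0 ^+ 2 by apply: sumr_ge0 => i _; exact: sqr_ge0.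
split.
  rewrite e0E; apply: (le_trans (mode_velocity_le ch0 ode ca cq t0)).
  apply: (@le_trans _ _ (2 * (C / t ^+ 2 * (\sum_i a i 0 ^+ 2) + C / t ^+ 3 * \sum_i P i ^+ 2))).
    by rewrite ler_pM2l//; apply: lerD; rewrite ler_wpM2r.
  have i2 : 0 <= C * (t ^- 2 * \sum_i a i 0 ^+ 2) by apply: mulr_ge0 => //; apply: mulr_ge0 => //; rewrite invr_ge0 ltW.
  have i3 : 0 <= C * (t ^- 3 * \sum_i P i ^+ 2) by apply: mulr_ge0 => //; apply: mulr_ge0 => //; rewrite invr_ge0 ltW.
  have j2 : 0 <= D * (t ^- 2 * \sum_i a i 0 ^+ 2) by apply: mulr_ge0; [exact: ltW|apply: mulr_ge0 => //; rewrite invr_ge0 ltW].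
  have j3 : 0 <= D * (t ^- 3 * \sum_i P i ^+ 2) by apply: mulr_ge0; [exact: ltW|apply: mulr_ge0 => //; rewrite invr_ge0 ltW].
  rewrite -!(mulrA C); move: (t ^- 2 * _) (t ^- 3 * _) i2 i3 j2 j3 => u v ? ? ? ?; lra.
have -> : \sum_i (q i t - e0 * (2^-1 * crs (cd xi) (a^~ 0) i + 4^-1 * dp xi xi * P i)) ^+ 2 =
  \sum_i (q i t - 2^-1 * expR (- m * dp xi xi * t) * crs (cd xi) (a^~ 0) i - 4^-1 * dp xi xi * expR (- m * dp xi xi * t) * P i) ^+ 2.
  by apply: eq_bigr => i _; congr (_ ^+ 2); rewrite e0E; ring.
apply: (le_trans (mode_microrotation_le ch0 ga0 ka0 ode ca cq t0)).
rewrite -(mulrA 3) ler_pM2l// [leRHS]mulrDr.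
apply: lerD.
  by rewrite (mulrA (C + D)) ler_wpM2r//; apply: (le_trans hB); rewrite ler_pM2r ?invr_gt0// lerDl ltW.
rewrite (mulrA (C + D)) ler_wpM2r// (mulrDl C); exact: (lerD hD hE).
Qed.

(** * Splitting the complex system into real ones *)

Section ComplexModes.
Context {R : realType}.
Local Notation sp := (R * R * R)%type.
Local Open Scope complex_scope.
Local Notation Re := complex.Re.
Local Notation Im := complex.Im.
Implicit Types (x y : R[i]) (V W : 'rV[R[i]]_3) (xi : sp) (i j : 'I_3).

Lemma complex_parts x y (c : R) :
  [/\ Re (x + y) = Re x + Re y, Im (x + y) = Im x + Im y, Re (x - y) = Re x - Re y, Im (x - y) = Im x - Im y &
  [/\ Re (x * y) = Re x * Re y - Im x * Im y, Im (x * y) = Re x * Im y + Im x * Re y,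
      Re (c%:C * x) = c * Re x & Im (c%:C * x) = c * Im x]].
Proof. by case: x y => [a b] [e f]; do 2 split => //=; ring. Qed.

Let ReD x y : Re (x + y) = Re x + Re y. Proof. by have [] := complex_parts x y 0. Qed.
Let ImD x y : Im (x + y) = Im x + Im y. Proof. by have [] := complex_parts x y 0. Qed.
Let ReB x y : Re (x - y) = Re x - Re y. Proof. by have [] := complex_parts x y 0. Qed.
Let ImB x y : Im (x - y) = Im x - Im y. Proof. by have [] := complex_parts x y 0. Qed.
Let ReM x y : Re (x * y) = Re x * Re y - Im x * Im y. Proof. by have [_ _ _ _ []] := complex_parts x y 0. Qed.
Let ImM x y : Im (x * y) = Re x * Im y + Im x * Re y. Proof. by have [_ _ _ _ []] := complex_parts x y 0. Qed.
Let ReZ (c : R) x : Re (c%:C * x) = c * Re x. Proof. by have [_ _ _ _ []] := complex_parts x x c. Qed.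
Let ImZ (c : R) x : Im (c%:C * x) = c * Im x. Proof. by have [_ _ _ _ []] := complex_parts x x c. Qed.

Let ReS (F : 'I_3 -> R[i]) : Re (\sum_i F i) = \sum_i Re (F i).
Proof. by rewrite !sum3E !ReD. Qed.
Let ImS (F : 'I_3 -> R[i]) : Im (\sum_i F i) = \sum_i Im (F i).
Proof. by rewrite !sum3E !ImD. Qed.

Lemma grad_symbol_parts xi i : Re (grad_symbol xi 0 i) = 0 /\ Im (grad_symbol xi 0 i) = cd xi i.
Proof. by rewrite mxE. Qed.

Let ReG xi i : Re (grad_symbol xi 0 i) = 0. Proof. by have [] := grad_symbol_parts xi i. Qed.
Let ImG xi i : Im (grad_symbol xi 0 i) = cd xi i. Proof. by have [] := grad_symbol_parts xi i. Qed.

Lemma dot_grad xi V : Re (dot (grad_symbol xi) V) = - \sum_i cd xi i * Im (V 0 i) /\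
  Im (dot (grad_symbol xi) V) = \sum_i cd xi i * Re (V 0 i).
Proof.
rewrite /dot ReS ImS -sumrN; split; apply: eq_bigr => i _; rewrite ?ReM ?ImM ReG ImG; ring.
Qed.

Lemma dot_grad2 xi : dot (grad_symbol xi) (grad_symbol xi) = (- dp xi xi)%:C.
Proof.
have [h1 h2] := dot_grad xi (grad_symbol xi).
have e1 : \sum_i cd xi i * Im (grad_symbol xi 0 i) = dp xi xi.
  by rewrite dp_sum; apply: eq_bigr => i _; rewrite ImG.
have e2 : \sum_i cd xi i * Re (grad_symbol xi 0 i) = 0 by rewrite big1// => i _; rewrite ReG mulr0.
by move: h1 h2; rewrite e1 e2; case: (dot _ _) => a b /= -> ->.
Qed.

Lemma cross_grad xi V i : Re (cross (grad_symbol xi) V 0 i) = - crs (cd xi) (fun j => Im (V 0 j)) i /\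
  Im (cross (grad_symbol xi) V 0 i) = crs (cd xi) (fun j => Re (V 0 j)) i.
Proof. by rewrite mxE ReB ImB !ReM !ImM !ReG !ImG /crs; split; ring. Qed.

Section Decouple.
Variables (mu chi ga ka : R) (xi : sp) (U W : R -> 'rV[R[i]]_3).
Hypothesis ode : micropolar_ode mu chi ga ka xi U W.

Let lin2 (a b : R[i]) V V' i : (a *: V + b *: V') 0 i = a * V 0 i + b * V' 0 i.
Proof. by rewrite !mxE. Qed.

Let lin4 (a b c e : R[i]) V1 V2 V3 V4 i : (a *: V1 + b *: V2 + c *: V3 - e *: V4) 0 i =
  a * V1 0 i + b * V2 0 i + c * V3 0 i - e * V4 0 i.
Proof. by rewrite !mxE. Qed.

(* [D] is [i] times a real vector, so the system splits into two copies of a real one *)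
Lemma real_ode_ReIm : real_ode mu chi ga ka xi (fun i t => Re (U t 0 i)) (fun i t => Im (W t 0 i)).
Proof.
move=> t t0 i; have [hU hW hd] := ode t0; have [dU _] := hU i; have [_ dW] := hW i.
have [g1 g2] := dot_grad xi (W t); have [_ g3] := dot_grad xi (U t).
have [c1 _] := cross_grad xi (W t) i; have [_ c2] := cross_grad xi (U t) i.
split.
- apply: (is_derive_eq dU); rewrite lin2 ReD dot_grad2 -(rmorphM _) !ReZ c1; ring.
- apply: (is_derive_eq dW); rewrite lin4 ImB !ImD dot_grad2 -(rmorphM _) !ImZ c2 ImM !ImZ !ReZ ReG ImG g1 g2; ring.
- by rewrite hd in g3; rewrite -g3.
Qed.

(** The solution multiplied by [- i] is again a solution; its real form has [Im U] and [- Re W],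
    whence the sign. *)
Lemma real_ode_ImRe : real_ode mu chi ga ka xi (fun i t => Im (U t 0 i)) (fun i t => - Re (W t 0 i)).
Proof.
move=> t t0 i; have [hU hW hd] := ode t0; have [_ dU] := hU i; have [dW _] := hW i.
have [g1 g2] := dot_grad xi (W t); have [g3 _] := dot_grad xi (U t).
have [_ c1] := cross_grad xi (W t) i; have [c2 _] := cross_grad xi (U t) i.
split.
- apply: (is_derive_eq dU); rewrite lin2 ImD dot_grad2 -(rmorphM _) !ImZ c1 crsN; ring.
- apply: (is_derive_eq (is_derive_opp dW)).
  rewrite lin4 ReB !ReD dot_grad2 -(rmorphM _) !ReZ c2 ReM !ImZ !ReZ ReG ImG g1 g2.
  have -> : \sum_j cd xi j * - Re (W t 0 j) = - \sum_j cd xi j * Re (W t 0 j).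
    by rewrite -sumrN; apply: eq_bigr => j _; rewrite mulrN.
  ring.
- by rewrite hd in g3; move/eqP: g3; rewrite eq_sym oppr_eq0 => /eqP.
Qed.

End Decouple.
End ComplexModes.

(** * Profiles in physical space *)

Section InverseTransform.
Context {R : realType}.
Local Notation sp := (R * R * R)%type.
Local Notation mu := (@leb3s R).
Implicit Types (x y xi : sp) (a b p q : sp -> R) (A B : 'I_3 -> sp -> R) (i j : 'I_3).

(** Real part of the inverse transform; taking real parts spares the bookkeeping of Hermitian
    symmetry of the symbols. *)
Definition invft a b x : R := c3^-1 * Rt a b x.

Lemma invft_ext a b p q : a =1 p -> b =1 q -> invft a b = invft p q.
Proof. by move=> /funext -> /funext ->. Qed.

Lemma invftD a b p q x : L12 a -> L12 b -> L12 p -> L12 q ->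
  invft a b x + invft p q x = invft (fun y => a y + p y) (fun y => b y + q y) x.
Proof.
by move=> [a1 _] [b1 _] [p1 _] [q1 _]; rewrite /invft /Rt CtD// StD//; ring.
Qed.

Lemma invftZ (c : R) a b x : L12 a -> L12 b ->
  c * invft a b x = invft (fun y => c * a y) (fun y => c * b y) x.
Proof. by move=> [a1 _] [b1 _]; rewrite /invft /Rt CtZ// StZ//; ring. Qed.

Lemma invftB a b p q x : L12 a -> L12 b -> L12 p -> L12 q ->
  invft a b x - invft p q x = invft (fun y => a y - p y) (fun y => b y - q y) x.
Proof.
by move=> [a1 _] [b1 _] [p1 _] [q1 _]; rewrite /invft /Rt CtB// StB//; ring.
Qed.

Lemma partial_invft a b i : rapid a -> rapid b ->
  partial i (invft a b) = invft (fun xi => - (cd xi i * b xi)) (fun xi => cd xi i * a xi).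
Proof.
move=> ra rb; apply/funext => x.
exact: is_derive_E (is_derive_scale c3^-1 (is_derive_Rt i x ra rb)).
Qed.

Lemma rapid_dp a : rapid a -> rapid (fun xi => dp xi xi * a xi).
Proof.
move=> ra; have h i : rapid (fun xi => cd xi i * (cd xi i * a xi)) by do 2 apply: rapid_cd.
apply: rapid_ext (rapidD (rapidD (h 0) (h 1)) (h 2)) => xi.
by rewrite dp_sum sum3E; ring.
Qed.

Lemma rapid_crs A i : (forall j, rapid (A j)) -> rapid (fun xi => crs (cd xi) (A^~ xi) i).
Proof. by move=> rA; apply: rapidB; exact: rapid_cd. Qed.

Section Fields.
Variables (u : field3 R) (A B : 'I_3 -> sp -> R).
Hypotheses (rA : forall i, rapid (A i)) (rB : forall i, rapid (B i)).
Hypothesis uE : forall i, (fun x => u x 0 i) = invft (A i) (B i).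

Lemma curl_invft i x : curl u x 0 i =
  invft (fun xi => - crs (cd xi) (B^~ xi) i) (fun xi => crs (cd xi) (A^~ xi) i) x.
Proof.
rewrite mxE !uE !partial_invft// invftB; last 4 first.
- exact/rapid_L12/rapidN/rapid_cd.
- exact/rapid_L12/rapid_cd.
- exact/rapid_L12/rapidN/rapid_cd.
- exact/rapid_L12/rapid_cd.
by congr (_ _); apply: invft_ext => xi; rewrite /crs; ring.
Qed.

Lemma laplacian_invft i x : laplacian u x 0 i =
  invft (fun xi => - (dp xi xi * A i xi)) (fun xi => - (dp xi xi * B i xi)) x.
Proof.
rewrite mxE uE sum3E !partial_invft//; do ?by [apply: rapid_cd|apply/rapidN/rapid_cd].
have h a j : rapid a -> L12 (fun xi => - (cd xi j * (cd xi j * a xi))).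
  by move=> ra; exact/rapid_L12/rapidN/rapid_cd/rapid_cd.
have h' a j : rapid a -> L12 (fun xi => cd xi j * - (cd xi j * a xi)).
  by move=> ra; exact/rapid_L12/rapid_cd/rapidN/rapid_cd.
rewrite invftD; [|exact: h|exact: h'|exact: h|exact: h'].
rewrite invftD; last 4 first.
- by apply: L12D; exact: h.
- by apply: L12D; exact: h'.
- exact: h.
- exact: h'.
by congr (_ _); apply: invft_ext => xi; rewrite dp_sum sum3E; ring.
Qed.
End Fields.

Lemma heat_invft (s : R) (u : field3 R) A B : 0 < s -> (forall i, ft (fun x => u x 0 i) (A i) (B i)) ->
  forall i, (fun x => heat s u x 0 i) = invft (fun xi => gs s xi * A i xi) (fun xi => gs s xi * B i xi).
Proof.
move=> s0 Fu i; apply/funext => x; rewrite mxE; exact: (heat_Rt x s0 (Fu i)).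
Qed.

Lemma leray_invft (s : R) (w v : field3 R) A B : 0 < s -> (forall i, ft (fun x => w x 0 i) (A i) (B i)) ->
  is_leray_proj w v ->
  forall i, (fun x => heat s v x 0 i) = invft (fun xi => gs s xi * solproj A i xi) (fun xi => gs s xi * solproj B i xi).
Proof.
move=> s0 Fw wv i; apply/funext => x; rewrite mxE.
have Lw j : L2 mu (fun x => w x 0 j) by case: (Fw j).
exact: (leray_heat Fw Lw wv x i s0).
Qed.

End InverseTransform.

(** * Error estimates *)

Lemma ae_impl d (T : measurableType d) (R : realType) (mu : {measure set T -> \bar R}) (P Q : T -> Prop) :
  (forall x, P x -> Q x) -> {ae mu, forall x, P x} -> {ae mu, forall x, Q x}.
Proof. by move=> PQ; apply: filterS. Qed.

Section ErrorBound.
Context {R : realType}.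
Local Notation sp := (R * R * R)%type.
Local Notation mu := (@leb3s R).
Implicit Types (x y xi : sp) (i j : 'I_3).

Definition energy (u : field3 R) : R := \sum_i Int mu (fun x => u x 0 i ^+ 2).

Lemma energy_ge0 u : 0 <= energy u.
Proof. by apply: sumr_ge0 => i _; apply: Int_ge0 => x; exact: sqr_ge0. Qed.

(** Passage from frequencies to space, through [inversion] in each component. In its uses [f] is the
    solution at time [t], [p + i q] the symbol of the profile and [e] the error. *)
Lemma energy_inversion (f e : field3 R) (a b p q : 'I_3 -> sp -> R) (G : sp -> R) :
  (forall i, ft (fun x => f x 0 i) (a i) (b i)) -> (forall i, rapid (p i)) -> (forall i, rapid (q i)) ->
  (forall i x, e x 0 i = f x 0 i - invft (p i) (q i) x) -> L1 mu G ->
  (\forall xi \ae mu, \sum_i ((a i xi - p i xi) ^+ 2 + (b i xi - q i xi) ^+ 2) <= G xi) ->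
  (forall i, L2 mu (fun x => e x 0 i)) /\ energy e <= c3^-1 * Int mu G.
Proof.
move=> Ff rp rq eE LG GE; split=> [i|].
  have -> : (fun x => e x 0 i) = (fun x => f x 0 i - c3^-1 * Rt (p i) (q i) x) by apply/funext => x; exact: eE.
  have [Lf _ _ _] := Ff i.
  by apply: L2B => //; apply: L2Z; apply: L2_Rt; exact: rapid_L12.
have L i : L1 mu (fun xi => (a i xi - p i xi) ^+ 2 + (b i xi - q i xi) ^+ 2).
  have [_ La Lb _] := Ff i.
  exact: (L1D (L2B La (rapid_L12 (rp i)).2).2 (L2B Lb (rapid_L12 (rq i)).2).2).
apply: (@le_trans _ _ (c3^-1 * \sum_i Int mu (fun xi => (a i xi - p i xi) ^+ 2 + (b i xi - q i xi) ^+ 2))).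
  rewrite mulr_sumr; apply: ler_sum => i _.
  have -> : (fun x => e x 0 i ^+ 2) = (fun x => (f x 0 i - c3^-1 * Rt (p i) (q i) x) ^+ 2).
    by apply/funext => x; rewrite eE.
  exact: (inversion (Ff i) (rapid_L12 (rp i)) (rapid_L12 (rq i))).
rewrite ler_pM2l ?invr_gt0 ?c3_gt0//.
have <- : Int mu (fun xi => \sum_i ((a i xi - p i xi) ^+ 2 + (b i xi - q i xi) ^+ 2)) =
  \sum_i Int mu (fun xi => (a i xi - p i xi) ^+ 2 + (b i xi - q i xi) ^+ 2) := Int_sum _ L.
exact: (Int_ae_le (L1_sum _ L) LG GE).
Qed.

Lemma energy_ft (u : field3 R) (a b : 'I_3 -> sp -> R) : (forall i, ft (fun x => u x 0 i) (a i) (b i)) ->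
  L1 mu (fun xi => \sum_i (a i xi ^+ 2 + b i xi ^+ 2)) /\
  Int mu (fun xi => \sum_i (a i xi ^+ 2 + b i xi ^+ 2)) <= 4 * c3 * energy u.
Proof.
move=> Fu; have L i : L1 mu (fun xi => a i xi ^+ 2 + b i xi ^+ 2).
  by have [_ La Lb _] := Fu i; exact: (L1D La.2 Lb.2).
split; first exact: (L1_sum _ L).
have -> : Int mu (fun xi => \sum_i (a i xi ^+ 2 + b i xi ^+ 2)) = \sum_i Int mu (fun xi => a i xi ^+ 2 + b i xi ^+ 2) := Int_sum _ L.
by rewrite /energy mulr_sumr; apply: ler_sum => i _; exact: (ft_bound (Fu i)).
Qed.

Lemma L2norm_energy (u : field3 R) : (forall i, L2 mu (fun x => u x 0 i)) -> L2norm u = (Num.sqrt (energy u))%:E.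
Proof. exact: L2norm_E. Qed.

(** From [A^2 + B^2 <= (A + B)^2] for nonnegative [A] and [B]. *)
Lemma sqrt_split (c r s X u v : R) : 0 <= c -> 0 < r -> 0 < s -> 0 <= u -> 0 <= v ->
  X <= c ^+ 2 * (r ^- 2 * u + s ^- 2 * v) -> Num.sqrt X <= c / r * Num.sqrt u + c / s * Num.sqrt v.
Proof.
move=> c0 r0 s0 u0 v0 H; have h1 := sqrtr_ge0 u; have h2 := sqrtr_ge0 v.
have A0 : 0 <= c / r * Num.sqrt u by apply: mulr_ge0 => //; apply: divr_ge0 => //; exact: ltW.
have B0 : 0 <= c / s * Num.sqrt v by apply: mulr_ge0 => //; apply: divr_ge0 => //; exact: ltW.
rewrite -[leRHS]ger0_norm ?addr_ge0// -sqrtr_sqr; apply: ler_wsqrtr; apply: (le_trans H).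
apply: (@le_trans _ _ ((c / r * Num.sqrt u) ^+ 2 + (c / s * Num.sqrt v) ^+ 2)); last first.
  move: (c / r * _) (c / s * _) A0 B0 => A B A0 B0; rewrite -subr_ge0.
  by have -> : (A + B) ^+ 2 - (A ^+ 2 + B ^+ 2) = 2 * (A * B) by [ring]; rewrite !mulr_ge0.
rewrite !exprMn !sqr_sqrtr// !exprVn; rewrite le_eqVlt; apply/orP; left; apply/eqP; ring.
Qed.

Lemma powR32_sqr (t : R) : 0 <= t -> (t `^ (3 / 2)) ^+ 2 = t ^+ 3.
Proof.
move=> t0; rewrite -powR_mulrn ?powR_ge0// -powRrM.
by have -> : 3 / 2 * 2%:R = 3%:R :> R by [field]; rewrite powR_mulrn.
Qed.

Lemma crsZ (d v : 'I_3 -> R) (c : R) i : crs d (fun j => c * v j) i = c * crs d v i.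
Proof. by rewrite /crs; ring. Qed.

Lemma solprojN (A : 'I_3 -> sp -> R) i xi : solproj (fun j y => - A j y) i xi = - solproj A i xi.
Proof.
rewrite /solproj; have -> : \sum_j gradproj i j xi * - A j xi = - \sum_j gradproj i j xi * A j xi.
  by rewrite -sumrN; apply: eq_bigr => j _; rewrite mulrN.
ring.
Qed.

End ErrorBound.

(** * Assembly of the two estimates *)

Section Assembly.
Context {R : realType}.
Local Notation sp := (R * R * R)%type.
Local Notation mu := (@leb3s R).
Variables (m ch ga ka K : R) (u0 w0 v : field3 R) (u w : R -> field3 R) (t : R).
Hypotheses (m0 : 0 < m) (K0 : 0 <= K) (t1 : 1 <= t).
Hypothesis bounds : forall (xi : sp) (a q : 'I_3 -> R -> R) (t : R), 1 <= t ->
  real_ode m ch ga ka xi a q ->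
  (forall i, a i s @[s --> 0^'+] --> a i 0) -> (forall i, q i s @[s --> 0^'+] --> q i 0) ->
  let e0 := gs (m * t) xi in let P i := solproj (fun i _ => q i 0) i xi in
  \sum_i (a i t - e0 * (a i 0 - 2^-1 * crs (cd xi) (q^~ 0) i)) ^+ 2 <=
    K * (t ^- 2 * (\sum_i a i 0 ^+ 2) + t ^- 3 * \sum_i P i ^+ 2) /\
  \sum_i (q i t - e0 * (2^-1 * crs (cd xi) (a^~ 0) i + 4^-1 * dp xi xi * P i)) ^+ 2 <=
    K * (t ^- 3 * (\sum_i a i 0 ^+ 2) + t ^- 4 * \sum_i q i 0 ^+ 2).
Hypothesis wv : is_leray_proj w0 v.
Variables (U W : R -> sp -> 'rV[R[i]]_3).
Hypotheses (FU : is_fourier_field u0 (U 0)) (FW : is_fourier_field w0 (W 0)).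
Hypothesis Ft : forall t, 0 < t -> is_fourier_field (u t) (U t) /\ is_fourier_field (w t) (W t).
Hypothesis ae : {ae mu, forall xi,
  [/\ right_continuous0 (U ^~ xi), right_continuous0 (W ^~ xi) &
      micropolar_ode m ch ga ka xi (U ^~ xi) (W ^~ xi)]}.

Let t0 : 0 < t. Proof. exact: lt_le_trans t1. Qed.
Let mt0 : 0 < m * t. Proof. exact: mulr_gt0. Qed.

Let a i xi := complex.Re (U 0 xi 0 i).
Let b i xi := complex.Im (U 0 xi 0 i).
Let p i xi := complex.Re (W 0 xi 0 i).
Let q i xi := complex.Im (W 0 xi 0 i).
Local Notation g := (gs (m * t)).

Let Fu i : ft (fun x => u0 x 0 i) (a i) (b i). Proof. exact: is_fourier2_ft (FU i). Qed.
Let Fw i : ft (fun x => w0 x 0 i) (p i) (q i). Proof. exact: is_fourier2_ft (FW i). Qed.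
Let Fut i : ft (fun x => u t x 0 i) (fun xi => complex.Re (U t xi 0 i)) (fun xi => complex.Im (U t xi 0 i)).
Proof. by have [h _] := Ft t0; exact: is_fourier2_ft (h i). Qed.
Let Fwt i : ft (fun x => w t x 0 i) (fun xi => complex.Re (W t xi 0 i)) (fun xi => complex.Im (W t xi 0 i)).
Proof. by have [_ h] := Ft t0; exact: is_fourier2_ft (h i). Qed.

Let rg (A : 'I_3 -> sp -> R) i : L2 mu (A i) -> rapid (fun xi => g xi * A i xi).
Proof. exact: rapid_gs. Qed.
Let La i : L2 mu (a i). Proof. by case: (Fu i). Qed.
Let Lb i : L2 mu (b i). Proof. by case: (Fu i). Qed.
Let Lp i : L2 mu (p i). Proof. by case: (Fw i). Qed.
Let Lq i : L2 mu (q i). Proof. by case: (Fw i). Qed.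
Let ra i := rg (La i). Let rb i := rg (Lb i). Let rp i := rg (Lp i). Let rq i := rg (Lq i).
Let rsp i := rg (L2_solproj i Lp). Let rsq i := rg (L2_solproj i Lq).

Let data := fun xi => \sum_i (a i xi ^+ 2 + b i xi ^+ 2).
Let data_w := fun xi => \sum_i (p i xi ^+ 2 + q i xi ^+ 2).
Let data_v := fun xi => \sum_i (solproj p i xi ^+ 2 + solproj q i xi ^+ 2).

(** The two real systems control the squares of complementary real and imaginary parts, and their
    sum is the complex estimate. The sign of [- Re W] passes through [crs] and [solproj] by
    linearity. *)
Let pointwise : \forall xi \ae mu,
  \sum_i ((complex.Re (U t xi 0 i) - g xi * (a i xi - 2^-1 * crs (cd xi) (q^~ xi) i)) ^+ 2 +
          (complex.Im (U t xi 0 i) - g xi * (b i xi + 2^-1 * crs (cd xi) (p^~ xi) i)) ^+ 2) <=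
    K * (t ^- 2 * data xi + t ^- 3 * data_v xi) /\
  \sum_i ((complex.Re (W t xi 0 i) - g xi * (- (2^-1 * crs (cd xi) (b^~ xi) i) + 4^-1 * dp xi xi * solproj p i xi)) ^+ 2 +
          (complex.Im (W t xi 0 i) - g xi * (2^-1 * crs (cd xi) (a^~ xi) i + 4^-1 * dp xi xi * solproj q i xi)) ^+ 2) <=
    K * (t ^- 3 * data xi + t ^- 4 * data_w xi).
Proof.
apply: (ae_impl _ ae) => xi [cU cW ode].
have [B1 B2] := bounds t1 (real_ode_ReIm ode) (fun i => (cU i).1) (fun i => (cW i).2).
have cN i : - complex.Re (W s xi 0 i) @[s --> 0^'+] --> - complex.Re (W 0 xi 0 i).
  exact (cvgN (cW i).1).
have [B3 B4] := bounds t1 (real_ode_ImRe ode) (fun i => (cU i).2) cN.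
have P1 i : solproj (fun i _ => complex.Im (W 0 xi 0 i)) i xi = solproj q i xi by [].
have P2 i : solproj (fun i (_ : sp) => - complex.Re (W 0 xi 0 i)) i xi = - solproj p i xi.
  by rewrite -(solprojN p).
have dE : data xi = \sum_i a i xi ^+ 2 + \sum_i b i xi ^+ 2 by rewrite -big_split.
have dwE : data_w xi = \sum_i p i xi ^+ 2 + \sum_i q i xi ^+ 2 by rewrite -big_split.
have dvE : data_v xi = \sum_i solproj p i xi ^+ 2 + \sum_i solproj q i xi ^+ 2 by rewrite -big_split.
split; rewrite big_split /=.
- have -> : K * (t ^- 2 * data xi + t ^- 3 * data_v xi) =
    K * (t ^- 2 * (\sum_i a i xi ^+ 2) + t ^- 3 * \sum_i solproj q i xi ^+ 2) +
    K * (t ^- 2 * (\sum_i b i xi ^+ 2) + t ^- 3 * \sum_i solproj p i xi ^+ 2) by rewrite dE dvE; ring.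
  apply: lerD; first exact: B1.
  apply: le_trans (le_trans B3 _); rewrite le_eqVlt; apply/orP; left; apply/eqP.
    by apply: eq_bigr => i _; rewrite crsN mulrN opprK.
  by congr (_ * (_ + _ * _)); apply: eq_bigr => i _; rewrite P2 sqrrN.
- have -> : K * (t ^- 3 * data xi + t ^- 4 * data_w xi) =
    K * (t ^- 3 * (\sum_i b i xi ^+ 2) + t ^- 4 * \sum_i p i xi ^+ 2) +
    K * (t ^- 3 * (\sum_i a i xi ^+ 2) + t ^- 4 * \sum_i q i xi ^+ 2) by rewrite dE dwE; ring.
  apply: lerD; last exact: B2.
  apply: le_trans (le_trans B4 _); rewrite le_eqVlt; apply/orP; left; apply/eqP.
    by apply: eq_bigr => i _; rewrite P2 -sqrrN; congr (_ ^+ 2); ring.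
  by congr (_ * (_ + _ * _)); apply: eq_bigr => i _; rewrite sqrrN.
Qed.

Let eu := fun x => u t x - heat (m * t) u0 x - 2^-1 *: curl (heat (m * t) w0) x.
Let ew := fun x => w t x - 2^-1 *: curl (heat (m * t) u0) x + 4^-1 *: laplacian (heat (m * t) v) x.

Let Ldata := energy_ft Fu.
Let Ldata_w := energy_ft Fw.

(** The profile is built from the symbol of [w0] itself, while the pointwise bound sees only its
    projection; [leray_bound] turns the latter into the energy of [v]. *)
Lemma velocity_error : (forall i, L2 mu (fun x => eu x 0 i)) /\
  energy eu <= 4 * K * (t ^- 2 * energy u0 + t ^- 3 * energy v).
Proof.
pose P i xi := g xi * a i xi + 2^-1 * - crs (cd xi) (fun j => g xi * q j xi) i.
pose Q i xi := g xi * b i xi + 2^-1 * crs (cd xi) (fun j => g xi * p j xi) i.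
have rP i : rapid (P i) by apply: rapidD => //; apply/rapidZ/rapidN; exact: (rapid_crs i rq).
have rQ i : rapid (Q i) by apply: rapidD => //; apply/rapidZ; exact: (rapid_crs i rp).
have eE i x : eu x 0 i = u t x 0 i - invft (P i) (Q i) x.
  have lin (y z y' : 'rV[R]_3) (c : R) : (y - z - c *: y') 0 i = y 0 i - (z 0 i + c * y' 0 i).
    by rewrite !mxE; ring.
  rewrite /eu lin (curl_invft rp rq (heat_invft mt0 Fw)).
  have -> : heat (m * t) u0 x 0 i = invft (fun xi => g xi * a i xi) (fun xi => g xi * b i xi) x.
    by rewrite -(heat_invft mt0 Fu i).
  rewrite invftZ; [|exact/rapid_L12/rapidN/(rapid_crs i rq)|exact/rapid_L12/(rapid_crs i rp)].
  rewrite invftD//; [exact: rapid_L12 (ra i)|exact: rapid_L12 (rb i)| |].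
    exact/rapid_L12/rapidZ/rapidN/(rapid_crs i rq).
  exact/rapid_L12/rapidZ/(rapid_crs i rp).
have Lv : L1 mu data_v.
  by apply: L1_sum => i; exact: (L1D (L2_solproj i Lp).2 (L2_solproj i Lq).2).
have LG : L1 mu (fun xi => K * (t ^- 2 * data xi + t ^- 3 * data_v xi)).
  by apply: L1Z; apply: L1D; apply: L1Z => //; exact: Ldata.1.
have GE : \forall xi \ae mu, \sum_i ((complex.Re (U t xi 0 i) - P i xi) ^+ 2 + (complex.Im (U t xi 0 i) - Q i xi) ^+ 2) <=
   K * (t ^- 2 * data xi + t ^- 3 * data_v xi).
  apply: (ae_impl _ pointwise) => xi [h _]; apply: le_trans h; rewrite le_eqVlt; apply/orP; left; apply/eqP.
  by apply: eq_bigr => i _; rewrite /P /Q !crsZ; congr (_ ^+ 2 + _ ^+ 2); ring.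
have [L H] := energy_inversion Fut rP rQ eE LG GE.
split=> //; apply: (le_trans H); rewrite IntZ ?IntD ?IntZ//; last 4 first.
- exact: Ldata.1.
- exact/L1Z/Ldata.1.
- exact: L1Z.
- by apply: L1D; apply: L1Z => //; exact: Ldata.1.
have c30 : 0 < c3 :> R := c3_gt0.
have i2 : 0 <= t ^- 2 by rewrite invr_ge0 exprn_ge0// ltW.
have i3 : 0 <= t ^- 3 by rewrite invr_ge0 exprn_ge0// ltW.
(* The [c3^-1] of the inversion meets the [4 c3] of the transform bounds, and the factor 4
   remains. *)
have -> : 4 * K * (t ^- 2 * energy u0 + t ^- 3 * energy v) =
  c3^-1 * (K * (t ^- 2 * (4 * c3 * energy u0) + t ^- 3 * (4 * c3 * energy v))).
  by field; rewrite ?gt_eqF.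

apply: ler_wpM2l; first by rewrite invr_ge0 ltW.
apply: ler_wpM2l => //; apply: lerD; apply: ler_wpM2l => //; first exact: Ldata.2.
have Lw j : L2 mu (fun x => w0 x 0 j) by case: (Fw j).
exact: (leray_bound Fw Lw wv).
Qed.

(** Here the profile itself contains the projection, through the Laplacian of the heat flow of [v];
    [leray_invft] provides its symbol. *)
Lemma microrotation_error : (forall i, L2 mu (fun x => ew x 0 i)) /\
  energy ew <= 4 * K * (t ^- 3 * energy u0 + t ^- 4 * energy w0).
Proof.
pose P i xi := 2^-1 * - crs (cd xi) (fun j => g xi * b j xi) i - 4^-1 * - (dp xi xi * (g xi * solproj p i xi)).
pose Q i xi := 2^-1 * crs (cd xi) (fun j => g xi * a j xi) i - 4^-1 * - (dp xi xi * (g xi * solproj q i xi)).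
have rc1 i : rapid (fun xi => 2^-1 * - crs (cd xi) (fun j => g xi * b j xi) i) by apply/rapidZ/rapidN; exact: (rapid_crs i rb).
have rc2 i : rapid (fun xi => 2^-1 * crs (cd xi) (fun j => g xi * a j xi) i) by apply/rapidZ; exact: (rapid_crs i ra).
have rd1 i : rapid (fun xi => - (dp xi xi * (g xi * solproj p i xi))) by apply/rapidN/rapid_dp.
have rd2 i : rapid (fun xi => - (dp xi xi * (g xi * solproj q i xi))) by apply/rapidN/rapid_dp.
have rP i : rapid (P i) by apply: rapidB => //; exact: rapidZ.
have rQ i : rapid (Q i) by apply: rapidB => //; exact: rapidZ.
have eE i x : ew x 0 i = w t x 0 i - invft (P i) (Q i) x.
  have lin (y z y' : 'rV[R]_3) (c c' : R) : (y - c *: z + c' *: y') 0 i = y 0 i - (c * z 0 i - c' * y' 0 i).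
    by rewrite !mxE; ring.
  rewrite /ew lin (curl_invft ra rb (heat_invft mt0 Fu)) (laplacian_invft rsp rsq (leray_invft mt0 Fw wv)).
  rewrite !invftZ; [|exact: rapid_L12|exact: rapid_L12|exact/rapid_L12/rapidN/(rapid_crs i rb)|exact/rapid_L12/(rapid_crs i ra)].
  by rewrite invftB//; apply: rapid_L12 => //; exact: rapidZ.
have LG : L1 mu (fun xi => K * (t ^- 3 * data xi + t ^- 4 * data_w xi)).
  by apply: L1Z; apply: L1D; apply: L1Z; [exact: Ldata.1|exact: Ldata_w.1].
have GE : \forall xi \ae mu, \sum_i ((complex.Re (W t xi 0 i) - P i xi) ^+ 2 + (complex.Im (W t xi 0 i) - Q i xi) ^+ 2) <=
   K * (t ^- 3 * data xi + t ^- 4 * data_w xi).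
  apply: (ae_impl _ pointwise) => xi [_ h]; apply: le_trans h; rewrite le_eqVlt; apply/orP; left; apply/eqP.
  by apply: eq_bigr => i _; rewrite /P /Q !crsZ; congr (_ ^+ 2 + _ ^+ 2); ring.
have [L H] := energy_inversion Fwt rP rQ eE LG GE.
split=> //; apply: (le_trans H); rewrite IntZ ?IntD ?IntZ//; last 5 first.
- exact: Ldata_w.1.
- exact: Ldata.1.
- exact/L1Z/Ldata.1.
- exact/L1Z/Ldata_w.1.
- by apply: L1D; apply: L1Z; [exact: Ldata.1|exact: Ldata_w.1].
have c30 : 0 < c3 :> R := c3_gt0.
have i3 : 0 <= t ^- 3 by rewrite invr_ge0 exprn_ge0// ltW.
have i4 : 0 <= t ^- 4 by rewrite invr_ge0 exprn_ge0// ltW.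
have -> : 4 * K * (t ^- 3 * energy u0 + t ^- 4 * energy w0) =
  c3^-1 * (K * (t ^- 3 * (4 * c3 * energy u0) + t ^- 4 * (4 * c3 * energy w0))).
  by field; rewrite ?gt_eqF.

apply: ler_wpM2l; first by rewrite invr_ge0 ltW.
by apply: ler_wpM2l => //; apply: lerD; apply: ler_wpM2l => //; [exact: Ldata.2|exact: Ldata_w.2].
Qed.

Lemma velocity_error_L2norm : (L2norm eu <=
  (Num.sqrt (4 * K) / t)%:E * L2norm u0 + (Num.sqrt (4 * K) / t `^ (3 / 2))%:E * L2norm v)%E.
Proof.
have [L H] := velocity_error.
have Lu j : L2 mu (fun x => u0 x 0 j) by case: (Fu j).
rewrite !L2norm_energy//; last exact: leray_L2 wv.
rewrite -!EFinM -EFinD lee_fin; apply: sqrt_split; rewrite ?sqrtr_ge0 ?energy_ge0 ?powR_gt0//.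
by rewrite sqr_sqrtr ?mulr_ge0// powR32_sqr// ltW.
Qed.

Lemma microrotation_error_L2norm : (L2norm ew <=
  (Num.sqrt (4 * K) / t `^ (3 / 2))%:E * L2norm u0 + (Num.sqrt (4 * K) / t ^+ 2)%:E * L2norm w0)%E.
Proof.
have [L H] := microrotation_error.
have Lu j : L2 mu (fun x => u0 x 0 j) by case: (Fu j).
have Lw j : L2 mu (fun x => w0 x 0 j) by case: (Fw j).
rewrite !L2norm_energy//.
rewrite -!EFinM -EFinD lee_fin; apply: sqrt_split; rewrite ?sqrtr_ge0 ?energy_ge0 ?powR_gt0 ?exprn_gt0//.
by rewrite sqr_sqrtr ?mulr_ge0// powR32_sqr ?(ltW t0)// -exprM.
Qed.

End Assembly.

Theorem theorem1p1 (R : realType) (mu chi gamma kappa : R)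
    (mu_gt0 : 0 < mu) (chi_gt0 : 0 < chi)
    (gamma_ge0 : 0 <= gamma) (kappa_ge0 : 0 <= kappa) :
  exists C : R,
  forall (u0 w0 Pw0 : field3 R) (uL wL : R -> field3 R),
    L2sigma u0 -> L2_field w0 -> is_leray_proj w0 Pw0 ->
    micropolar_solution mu chi gamma kappa u0 w0 uL wL ->
  forall t : R, 1 <= t ->
    (L2norm (fun x => uL t x - heat (mu * t) u0 x
                      - 2^-1 *: curl (heat (mu * t) w0) x)%R
       <= (C / t)%:E * L2norm u0
          + (C / t `^ (3 / 2))%:E * L2norm Pw0)%E
    /\
    (L2norm (fun x => wL t x - 2^-1 *: curl (heat (mu * t) u0) x
                      + 4^-1 *: laplacian (heat (mu * t) Pw0) x)%R
       <= (C / t `^ (3 / 2))%:E * L2norm u0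
          + (C / t ^+ 2)%:E * L2norm w0)%E.
Proof.
have [K K0 bounds] := mode_bounds mu_gt0 chi_gt0 gamma_ge0 kappa_ge0.
(* The factor [4 * K] bounds energies, of which the norms are the square roots. *)
exists (Num.sqrt (4 * K)) => u0 w0 Pw0 uL wL _ _ proj [U [W [FU FW Ft ae]]] t t1; split.
- exact: (velocity_error_L2norm mu_gt0 K0 t1 bounds proj FU FW Ft ae).
- exact: (microrotation_error_L2norm mu_gt0 K0 t1 bounds proj FU FW Ft ae).
Qed.
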